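(* Let $p>2$, $f=2$, $q=p^2$, $k=(k_0,k_1)$ with $r_i=k_i-2\ge q$, and suppose $r=r_0+pr_1\equiv pa_1\pmod{q-1}$ with $1\le a_1\le p-1$ (i.e. $a=a_0+pa_1$ with $a_0=0$). Assume $p\nmid r_0$, that $p\mid r_1$ if $a_1=1$, and that $a_p$ lies in a finite extension of $\mathbb{Q}_{p^2}$ with $v(a_p)\in(\frac12,1)$. Then the map $\mathrm{ind}_{KZ}^G\mathrm{soc}(Q)\to\bar\Theta_{k_0,k_1,a_p}$ vanishes on $T(\mathrm{ind}_{KZ}^G\mathrm{soc}(Q))$, i.e. it factors through $T$.
   Context: Setting with $f=2$: $\mathbb{Q}_{p^2}$ unramified quadratic over $\mathbb{Q}_p$, ring of integers $\mathbb{Z}_{p^2}$, residue field $\mathbb F_{q}$, Teichmüller lifts $[\lambda]$; $G=\mathrm{GL}_2(\mathbb{Q}_{p^2})$, $K=\mathrm{GL}_2(\mathbb{Z}_{p^2})$, $Z$ the center, $\Gamma=\mathrm{GL}_2(\mathbb F_q)$, $v(p)=1$. For a ring $R$, $V(R)=\mathrm{Sym}^{r_0}R^2\otimes\mathrm{Sym}^{r_1}R^2$ is modeled on polynomials homogeneous of degree $r_i$ in $(X_i,Y_i)$, $i=0,1$; $\begin{pmatrix}a&b\\c&d\end{pmatrix}\in K$ acts by $v\mapsto v(a^{\sigma^i}X_i+c^{\sigma^i}Y_i,b^{\sigma^i}X_i+d^{\sigma^i}Y_i)$ ($\sigma$ Frobenius), $p\in Z$ acts trivially. $[g,v]$ is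 the function supported on $KZg^{-1}$ with $g'\mapsto g'g\cdot v$. Hecke operator: $T([g,v])=\sum_{\lambda\in\mathbb F_q}[g\begin{pmatrix}p&[\lambda]\\0&1\end{pmatrix},v(X_i,(-[\lambda])^{p^i}X_i+pY_i)]+[g\begin{pmatrix}1&0\\0&p\end{pmatrix},v(pX_i,Y_i)]$; on the induction of a mod $p$ weight $\mathrm{Sym}^{s_0}\otimes\mathrm{Sym}^{s_1}\otimes\det^m$ it is $T([g,v])=\sum_\lambda[g\begin{pmatrix}p&[\lambda]\\0&1\end{pmatrix},v(X_i,(-\lambda)^{p^i}X_i)]+[g\begin{pmatrix}1&0\\0&p\end{pmatrix},v(0,Y_i)]$. For $a_p$ in a finite extension $E$ (ring of integers $\mathcal O_E$, residue field $k_E$): $\Theta_{k,a_p}$ is the image of $\mathrm{ind}_{KZ}^GV(\mathcal O_E)$ in $\mathrm{ind}_{KZ}^GV(E)/(T-a_p)$ and $\bar\Theta_{k,a_p}=\Theta_{k,a_p}\otimes k_E$, with natural surjection $\mathrm{ind}_{KZ}^GV_r\twoheadrightarrow\bar\Theta_{k,a_p}$, $V_r=V(\bar{\mathbb F}_p)$. Let $\theta_0=X_0Y_1^p-Y_0X_1^p$, $\theta_1=X_1Y_0^p-Y_1X_0^p$, $V_r^*$ the subspace of elements $\theta_0P_0+\theta_1P_1$ of $V_r$, $X_r$ the $\Gamma$-submodule generated by $X_0^{r_0}X_1^{r_1}$, $Q=V_r/(V_r^*+X_r)$; under the hypotheses the surjection factors through $\mathrm{ind}_{KZ}^GQ\twoheadrightarrow\bar\Theta_{k,a_p}$,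 and the map in the claim is its restriction to $\mathrm{ind}_{KZ}^G\mathrm{soc}(Q)\subseteq\mathrm{ind}_{KZ}^GQ$. *)

(* Defs.v *)
From HB Require Import structures.
From mathcomp Require Import all_boot all_order all_algebra all_field.
From mathcomp Require Import boolp classical_sets functions.
From mathcomp Require Import freeg mpoly.

Set Implicit Arguments.
Unset Strict Implicit.
Unset Printing Implicit Defensive.

Import Order.TTheory GRing.Theory Num.Theory.
Local Open Scope ring_scope.
Local Open Scope quotient_scope.

Section Span.
Variables (R : nzRingType) (M : lmodType R) (S : M -> Prop).

Inductive lspan : M -> Prop :=
| span0 : lspan 0
| span_cons a x y : S x -> lspan y -> lspan (a *: x + y).

Lemma span_gen x : S x -> lspan x.
Proof. by move=> Sx; rewrite -[x]scale1r -[1 *: x]addr0; apply: span_cons Sx span0. Qed.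

Lemma spanD x y : lspan x -> lspan y -> lspan (x + y).
Proof.
by elim=> [|a u w Su _ IH] sy; rewrite ?add0r // -addrA; apply: span_cons => //; exact: IH.
Qed.

Lemma spanZ a x : lspan x -> lspan (a *: x).
Proof.
elim=> [|b u w Su _ IH]; first by rewrite scaler0; exact: span0.
by rewrite scalerDr scalerA; exact: span_cons.
Qed.

Lemma spanN x : lspan x -> lspan (- x).
Proof. by rewrite -scaleN1r; exact: spanZ. Qed.

Definition quot_rel (x y : M) : bool := `[< lspan (x - y) >].

Lemma quot_rel_equiv : equiv_class_of quot_rel.
Proof.
split=> [x|x y|y x z].
- by apply/asboolP; rewrite subrr; exact: span0.
- by apply/asboolP/asboolP => /spanN; rewrite opprB.
- move=> /asboolP xy /asboolP yz; apply/asboolP.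
  by rewrite -[x - z](subrKA y); exact: spanD.
Qed.

Canonical quot_equiv := EquivRelPack quot_rel_equiv.
Canonical quot_equiv_direct := defaultEncModRel quot_rel.

(* The quotient of M by the submodule spanned by S. *)
Definition quotmod := {eq_quot quot_rel}.
HB.instance Definition _ := Quotient.on quotmod.
HB.instance Definition _ := Choice.on quotmod.
HB.instance Definition _ : EqQuotient M quot_rel quotmod := EqQuotient.on quotmod.

Definition proj (x : M) : quotmod := \pi_quotmod x.

Lemma projP x y : proj x = proj y <-> lspan (x - y).
Proof.
split=> [/eqP|sxy]; first by rewrite /proj piE => /asboolP.
by apply/eqP; rewrite /proj piE; apply/asboolP.
Qed.

Lemma proj_repr (u : quotmod) : proj (repr u) = u.
Proof. exact: reprK. Qed.

Definition quot_add (u w : quotmod) := proj (repr u + repr w).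
Definition quot_opp (u : quotmod) := proj (- repr u).
Definition quot_scale (a : R) (u : quotmod) := proj (a *: repr u).

Lemma quot_addE x y : quot_add (proj x) (proj y) = proj (x + y).
Proof.
apply/projP; rewrite opprD addrACA; apply: spanD; apply/projP; exact: proj_repr.
Qed.

Lemma quot_oppE x : quot_opp (proj x) = proj (- x).
Proof. by apply/projP; rewrite -opprD; apply/spanN/projP; exact: proj_repr. Qed.

Lemma quot_scaleE a x : quot_scale a (proj x) = proj (a *: x).
Proof. by apply/projP; rewrite -scalerBr; apply/spanZ/projP; exact: proj_repr. Qed.

Lemma quot_addA : associative quot_add.
Proof.
move=> u v w; rewrite -[u]proj_repr -[v]proj_repr -[w]proj_repr.
by rewrite !quot_addE addrA.
Qed.

Lemma quot_addC : commutative quot_add.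
Proof.
by move=> u v; rewrite -[u]proj_repr -[v]proj_repr !quot_addE addrC.
Qed.

Lemma quot_add0 : left_id (proj 0) quot_add.
Proof. by move=> u; rewrite -[u]proj_repr quot_addE add0r. Qed.

Lemma quot_addN : left_inverse (proj 0) quot_opp quot_add.
Proof. by move=> u; rewrite -[u]proj_repr quot_oppE quot_addE addNr. Qed.

HB.instance Definition _ :=
  GRing.isZmodule.Build quotmod quot_addA quot_addC quot_add0 quot_addN.

Lemma quot_scaleA a b u : quot_scale a (quot_scale b u) = quot_scale (a * b) u.
Proof. by rewrite -[u]proj_repr !quot_scaleE scalerA. Qed.

Lemma quot_scale1 : left_id 1 quot_scale.
Proof. by move=> u; rewrite -[u]proj_repr quot_scaleE scale1r. Qed.

Lemma proj_add x y : proj x + proj y = proj (x + y).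
Proof. exact: quot_addE. Qed.

Lemma quot_scaleDr : right_distributive quot_scale +%R.
Proof.
move=> a u w; rewrite -[u]proj_repr -[w]proj_repr proj_add.
by rewrite !quot_scaleE proj_add scalerDr.
Qed.

Lemma quot_scaleDl u : {morph quot_scale^~ u : a b / a + b}.
Proof.
move=> a b; rewrite -[u]proj_repr !quot_scaleE proj_add.
by rewrite scalerDl.
Qed.

HB.instance Definition _ := GRing.Zmodule_isLmodule.Build R quotmod
  quot_scaleA quot_scale1 quot_scaleDr quot_scaleDl.

Lemma proj_is_linear : linear proj.
Proof.
by move=> a x y; rewrite -proj_add -quot_scaleE.
Qed.

HB.instance Definition _ := GRing.isLinear.Build R M quotmod *:%R proj proj_is_linear.

End Span.

Arguments proj {R M} S x.

Section Integrality.
Variables (E : fieldType) (v : E -> rat).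
Definition vge (c : rat) (x : E) : bool := (x == 0) || (c <= v x).
Definition vgt (c : rat) (x : E) : bool := (x == 0) || (c < v x).
End Integrality.

(* Q_p, Q_{p^2} = L, the coefficient field E, the residue field F_q of L and   *)
(* Fbar = \bar F_p, with the maps between them. Qp is the completion of Q at p, *)
(* L is unramified of degree 2 over Qp, and v is the valuation of the finite    *)
(* extension E with v(p) = 1. The value of v at 0 is unspecified: every use of  *)
(* v goes through vge / vgt or through a nonzero argument. Likewise red is only *)
(* meaningful on O_E.                                                           *)
Record padic_setting (p : nat) (Qp : fieldType) (L : fieldExtType Qp)
    (E : fieldExtType L) (Fq : finFieldType) (Fbar : closedFieldType) := {
  v : E -> rat;
  sigma : {rmorphism L -> L};
  red : E -> Fbar;
  iota : {rmorphism Fq -> Fbar};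
  teich : Fq -> L;

  valM : forall x y, x != 0 -> y != 0 -> v (x * y) = v x + v y;
  valD : forall x y c, vge v c x -> vge v c y -> vge v c (x + y);
  val_p : v p%:R = 1;

  Qp_char0 : [pchar Qp] =i pred0;
  Qp_dense : forall (x : Qp) (N : nat),
    exists r : rat, vge v N%:R ((x - ratr r)%:A%:A);
  Qp_complete : forall u : nat -> Qp,
    (forall N : nat, exists n0, forall m n, (n0 <= m)%N -> (n0 <= n)%N ->
        vge v N%:R ((u m - u n)%:A%:A)) ->
    exists l : Qp, forall N : nat, exists n0, forall n, (n0 <= n)%N ->
        vge v N%:R ((u n - l)%:A%:A);

  L_quadratic : \dim {:L} = 2;
  L_unramified : forall x : L, x != 0 -> v x%:A \is a Num.int;

  sigma_Qp : forall c : Qp, sigma c%:A = c%:A;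
  sigma_frob : forall x : L, vge v 0 x%:A -> vgt v 0 (sigma x - x ^+ p)%:A;

  red1 : red 1 = 1;
  redD : forall x y, vge v 0 x -> vge v 0 y -> red (x + y) = red x + red y;
  redM : forall x y, vge v 0 x -> vge v 0 y -> red (x * y) = red x * red y;
  red_eq0 : forall x, vge v 0 x -> (red x = 0 <-> vgt v 0 x);

  Fq_card : #|Fq| = (p ^ 2)%N;
  Fq_residue : forall x : L, vge v 0 x%:A -> exists l, red x%:A = iota l;
  Fbar_algebraic : forall x : Fbar, algebraicOver iota x;

  teich_int : forall l, vge v 0 (teich l)%:A;
  teich_red : forall l, red (teich l)%:A = iota l;
  teich_root : forall l, teich l ^+ (p ^ 2) = teich l
}.

Definition mx2 (R : nzRingType) (a b c d : R) : 'M[R]_2 :=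
  \matrix_(i < 2, j < 2)
    if i == 0 then (if j == 0 then a else b) else (if j == 0 then c else d).

Section Polynomials.
Variable R : comNzRingType.

(* The variables, in the order X_0, Y_0, X_1, Y_1. *)
Definition iX0 : 'I_4 := inord 0.
Definition iY0 : 'I_4 := inord 1.
Definition iX1 : 'I_4 := inord 2.
Definition iY1 : 'I_4 := inord 3.

(* P lies in Sym^{s0} R^2 (x) Sym^{s1} R^2. *)
Definition bihomog (s0 s1 : nat) (P : {mpoly R[4]}) : Prop :=
  forall m, m \in msupp P -> (m iX0 + m iY0 = s0)%N /\ (m iX1 + m iY1 = s1)%N.

(* P(a_i X_i + c_i Y_i, b_i X_i + d_i Y_i), where m_i = (a_i, b_i; c_i, d_i). *)
Definition subst (m0 m1 : 'M[R]_2) (P : {mpoly R[4]}) : {mpoly R[4]} :=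
  comp_mpoly [tuple m0 0 0 *: 'X_iX0 + m0 1 0 *: 'X_iY0;
                    m0 0 1 *: 'X_iX0 + m0 1 1 *: 'X_iY0;
                    m1 0 0 *: 'X_iX1 + m1 1 0 *: 'X_iY1;
                    m1 0 1 *: 'X_iX1 + m1 1 1 *: 'X_iY1] P.

Definition theta0 (p : nat) : {mpoly R[4]} := 'X_iX0 * 'X_iY1 ^+ p - 'X_iY0 * 'X_iX1 ^+ p.
Definition theta1 (p : nat) : {mpoly R[4]} := 'X_iX1 * 'X_iY0 ^+ p - 'X_iY1 * 'X_iX0 ^+ p.

End Polynomials.

Section Setting.
Variables (p : nat) (Qp : fieldType) (L : fieldExtType Qp) (E : fieldExtType L).
Variables (Fq : finFieldType) (Fbar : closedFieldType).
Variable D : padic_setting p E Fq Fbar.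

Definition inK (k : 'M[L]_2) : Prop :=
  (forall i j, vge (v D) 0 (k i j)%:A) /\ (\det k != 0 /\ v D (\det k)%:A = 0).

(* KZ is the union of the p^n K, as p is a uniformizer of L. *)
Definition decKZ (h k : 'M[L]_2) : Prop :=
  inK k /\ exists n : int, h = (p%:R ^ n) *: k.
Definition inKZ (h : 'M[L]_2) : Prop := exists k, decKZ h k.

(* The k in K through which h = p^n k acts. *)
Definition Kpart (h : 'M[L]_2) : 'M[L]_2 := xget 0 (decKZ h).

Section Induction.
Variables (R : nzRingType) (W : lmodType R) (act : 'M[L]_2 -> W -> W).

(* ind_{KZ}^G S for a KZ-stable submodule S of W, with functions on             *)
(* G = GL_2(L) extended by 0 to all matrices.                                   *)
Definition ind (S : W -> Prop) (f : 'M[L]_2 -> W) : Prop :=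
  [/\ forall g, S (f g),
      forall g, g \notin unitmx -> f g = 0,
      forall h g, inKZ h -> g \in unitmx -> f (h *m g) = act h (f g)
    & exists s : seq 'M[L]_2, forall g, f g != 0 ->
        exists h x, [/\ inKZ h, x \in s & g = h *m x]].

(* The element [g, w]. *)
Definition bracket (g : 'M[L]_2) (w : W) : 'M[L]_2 -> W := fun g' =>
  if `[< inKZ (g' *m g) >] then act (g' *m g) w else 0.

(* The defining formula of T([g, w]), where w = phi P for a polynomial P;       *)
(* pi is the image of p in R and t the lift of F_q to R.                        *)
Definition hecke_formula (R' : comNzRingType) (pi : R') (t : Fq -> R')
    (phi : {mpoly R'[4]} -> W) (g : 'M[L]_2) (P : {mpoly R'[4]}) : 'M[L]_2 -> W :=
  \sum_(l : Fq)
     bracket (g *m mx2 p%:R (teich D l) 0 1)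
       (phi (subst (mx2 1 (- t l) 0 pi) (mx2 1 ((- t l) ^+ p) 0 pi) P))
  + bracket (g *m mx2 1 0 0 p%:R)
       (phi (subst (mx2 pi 0 0 1) (mx2 pi 0 0 1) P)).

End Induction.

(* The action of KZ on V(R), for R = E or Fbar and e the map from O_L to R. *)
Definition KZact (R : comNzRingType) (e : L -> R) (h : 'M[L]_2)
    (P : {mpoly R[4]}) : {mpoly R[4]} :=
  subst (map_mx e (Kpart h)) (map_mx (e \o sigma D) (Kpart h)) P.

Definition KZactE := KZact (in_alg E).
Definition KZactF := KZact (red D \o in_alg E).

Section Weight.
Variables (r0 r1 : nat) (ap : E).

Definition indVE : ('M[L]_2 -> {mpoly E[4]}) -> Prop :=
  ind KZactE (bihomog r0 r1).
Definition indVO (f : 'M[L]_2 -> {mpoly E[4]}) : Prop :=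
  indVE f /\ forall g m, vge (v D) 0 (f g)@_m.
Definition indVr : ('M[L]_2 -> {mpoly Fbar[4]}) -> Prop :=
  ind KZactF (bihomog r0 r1).

(* The graph of T on ind V(E): T is the linear operator determined by the       *)
(* values T([g, w]), so its graph is the span of the pairs ([g, w], T([g, w])). *)
Definition heckeE (f h : 'M[L]_2 -> {mpoly E[4]}) : Prop :=
  lspan (fun u : ('M[L]_2 -> {mpoly E[4]}) * ('M[L]_2 -> {mpoly E[4]}) =>
    exists g P, [/\ g \in unitmx, bihomog r0 r1 P &
      u = (bracket KZactE g P,
           hecke_formula KZactE p%:R (fun l => (teich D l)%:A) id g P)])
    (f, h).

(* Contains ind V(E) / (T - a_p) as the image of ind V(E). *)
Definition coker : lmodType E :=
  quotmod (fun F : 'M[L]_2 -> {mpoly E[4]} =>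
    exists f h, heckeE f h /\ F = h - ap *: f).
Definition to_coker (F : 'M[L]_2 -> {mpoly E[4]}) : coker := proj _ F.

Definition inTheta (x : coker) : Prop := exists F, indVO F /\ x = to_coker F.
Definition Theta : choiceType := {x : coker | `[< inTheta x >]}.

(* Fbar (x)_{O_E} Theta = Fbar (x)_{k_E} (Theta (x) k_E), as the free           *)
(* Fbar-module on the 1 (x) x, x in Theta, modulo O_E-linearity in x.           *)
Definition ThetaBar : lmodType Fbar :=
  quotmod (fun z : {freeg Theta / Fbar} =>
    (exists x y s : Theta, val s = val x + val y /\
       z = << s >> - << x >> - << y >>) \/
    (exists c (x y : Theta), [/\ vge (v D) 0 c, val y = c *: val x &
       z = << y >> - red D c *: << x >>])).
Definition tensor1 (x : Theta) : ThetaBar := proj _ << x >>.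

(* The action of Gamma = GL_2(F_q) on V_r. *)
Definition Gact (g : 'M[Fq]_2) : {mpoly Fbar[4]} -> {mpoly Fbar[4]} :=
  subst (map_mx (iota D) g) (map_mx (fun a => iota D a ^+ p) g).

Definition Vstar (P : {mpoly Fbar[4]}) : Prop :=
  bihomog r0 r1 P /\ exists P0 P1, P = theta0 _ p * P0 + theta1 _ p * P1.
Definition Xr : {mpoly Fbar[4]} -> Prop :=
  lspan (fun P => exists2 g : 'M[Fq]_2, g \in unitmx &
                   P = Gact g ('X_iX0 ^+ r0 * 'X_iX1 ^+ r1)).

(* Q is the image inQ of V_r in Qamb, on which Gamma and KZ act through V_r. *)
Definition Qamb : lmodType Fbar :=
  quotmod (fun P : {mpoly Fbar[4]} => Vstar P \/ Xr P).
Definition projQ : {mpoly Fbar[4]} -> Qamb := proj _.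
Definition inQ (x : Qamb) : Prop := exists P, bihomog r0 r1 P /\ x = projQ P.
Definition GactQ (g : 'M[Fq]_2) (x : Qamb) : Qamb := projQ (Gact g (repr x)).
Definition KZactQ (h : 'M[L]_2) (x : Qamb) : Qamb := projQ (KZactF h (repr x)).

Definition submoduleQ (S : Qamb -> Prop) : Prop :=
  [/\ forall x, S x -> inQ x, S 0,
      forall a x y, S x -> S y -> S (a *: x + y)
    & forall g x, g \in unitmx -> S x -> S (GactQ g x)].
Definition simpleQ (S : Qamb -> Prop) : Prop :=
  [/\ submoduleQ S, exists2 x, S x & x != 0
    & forall S', submoduleQ S' -> (forall x, S' x -> S x) ->
        (exists2 x, S' x & x != 0) -> forall x, S x -> S' x].
Definition socQ : Qamb -> Prop := lspan (fun x => exists2 S, simpleQ S & S x).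

Definition indQ : ('M[L]_2 -> Qamb) -> Prop := ind KZactQ inQ.
Definition indsocQ : ('M[L]_2 -> Qamb) -> Prop := ind KZactQ socQ.

(* phi embeds Sym^{s0} (x) Sym^{s1} (x) det^m, 0 <= s0, s1 <= p - 1, in Q. *)
Definition weight_embedding (s0 s1 m : nat)
    (phi : {linear {mpoly Fbar[4]} -> Qamb}) : Prop :=
  [/\ (s0 < p)%N, (s1 < p)%N,
      forall P, bihomog s0 s1 P -> inQ (phi P) /\ (phi P = 0 -> P = 0)
    & forall g P, g \in unitmx -> bihomog s0 s1 P ->
        phi (iota D (\det g) ^+ m *: Gact g P) = GactQ g (phi P)].

(* The graph of T on ind soc(Q): soc(Q) is the sum of its irreducible           *)
(* submodules, each of which is a weight, and T is given on the induction of a  *)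
(* weight by the formula for p = 0 and t the inclusion of F_q.                  *)
Definition heckeQ (f h : 'M[L]_2 -> Qamb) : Prop :=
  lspan (fun u : ('M[L]_2 -> Qamb) * ('M[L]_2 -> Qamb) =>
    exists s0 s1 m phi g P,
      [/\ weight_embedding s0 s1 m phi, g \in unitmx, bihomog s0 s1 P &
      u = (bracket KZactQ g (phi P), hecke_formula KZactQ 0 (iota D) phi g P)])
    (f, h).

(* The natural surjection from ind V_r to ThetaBar. It is determined by these   *)
(* conditions, as the reductions of elements of ind V(O_E) span ind V_r.        *)
Definition natural_surjection
    (nat_map : ('M[L]_2 -> {mpoly Fbar[4]}) -> ThetaBar) : Prop :=
  (forall a f h, indVr f -> indVr h ->
     nat_map (a *: f + h) = a *: nat_map f + nat_map h) /\
  (forall F (x : Theta), indVO F -> val x = to_coker F ->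
     nat_map (fun g => map_mpoly (red D) (F g)) = tensor1 x).

Definition factors_through_indQ
    (nat_map : ('M[L]_2 -> {mpoly Fbar[4]}) -> ThetaBar)
    (Phi : ('M[L]_2 -> Qamb) -> ThetaBar) : Prop :=
  forall f, indVr f -> nat_map f = Phi (projQ \o f).

End Weight.
End Setting.

(* Main.v *)
(* Write nu g S for the image of [g, S] in ThetaBar. Put
   V = sum_t [t]^(q-2) ([t] X_0 + Y_0)^(r_0) ([t]^p X_1 + Y_1)^(r_1).
   Then T [g, V] is divisible by p, and [g, V] itself is T F up to p for an integral F. As
   v(a_p) > 1/2, applying T - a_p to [g, V] / p + (a_p / p) F and reducing leaves only the
   terms of T [g, V] / p, which after division by the unit r_0 give
     sum_l (- l)^(p a_1 - 2) nu (g (p, [l]; 0, 1)) w = nu (g (1, 0; 0, p)) w',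
   where w = X_0^(r_0 - 1) Y_0 X_1^(r_1) and w' = Y_0^(r_0 - 1) X_0 Y_1^(r_1).
   Evaluating at the points (x, y, x^p, y^p) with x, y in F_q turns elements of V_r into
   functions and kills V_r^*, and X_r becomes a small space of functions. It follows that
   every weight of Q has a multiple of w as highest weight vector and satisfies
   s_0 + p s_1 = p a_1 - 2, so that the relation is the vanishing of T on its lowest weight
   vector. Translating g by unipotents and comparing coefficients extends it to the whole
   weight. *)
Require Import Defs.
From mathcomp Require Import all_boot all_order all_algebra all_field.
From mathcomp Require Import boolp classical_sets functions.
From mathcomp Require Import freeg mpoly ring zify lra.

Set Implicit Arguments.
Unset Strict Implicit.
Unset Printing Implicit Defensive.

Import Order.TTheory GRing.Theory Num.Theory.
Local Open Scope ring_scope.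

(** * Substitutions and bihomogeneous polynomials *)

(** The weight [t]^(q-2) is a Fourier kernel: summed over t against a polynomial in t of degree
    below q - 1 it gives, modulo p, minus the coefficient of t. The part of T [g, V] of order 0 in p
    thus becomes the coefficient of t in (t - l)^(p a_1), which is divisible by p: this is the use
    of a_0 = 0. At first order in p, the term with Y_0 has the coefficient r_0 (p a_1 - 1), whence
    the hypothesis on r_0, and the term with Y_1 has r_1 p (a_1 - 1), which vanishes. If a_1 = 1,
    the exponent in the latter sum is divisible by q - 1, the sum is nonzero for l <> 0, and p | r_1
    takes over. V comes from T modulo p because Y_0^(r_0) Y_1^(r_1) does, by r_0 >= q, and V is a
    combination of its unipotent translates. The correcting terms carry p / a_p or a_p^2 / p, hence
    the two bounds on v(a_p). As ThetaBar is given by generators and relations, a class is shown to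
    vanish by exhibiting an explicit preimage under T - a_p, up to a multiple of positive
    valuation. *)

Lemma mulmx2E (R : nzRingType) (m n : 'M[R]_2) i j :
  (m *m n) i j = m i 0 * n 0 j + m i 1 * n 1 j.
Proof.
rewrite mxE !big_ord_recl big_ord0 addr0.
by congr (_ + m _ _ * n _ _); exact: val_inj.
Qed.

Section Substitution.
Variable R : comNzRingType.
Implicit Types (P Q : {mpoly R[4]}) (a b : R) (m n : 'M[R]_2).

Lemma ord4P (C : 'I_4 -> Prop) : C iX0 -> C iY0 -> C iX1 -> C iY1 -> forall i, C i.
Proof.
move=> C0 C1 C2 C3 i.
have [-> //|i0] := eqVneq i iX0; have [-> //|i1] := eqVneq i iY0.
have [-> //|i2] := eqVneq i iX1; have [-> //|i3] := eqVneq i iY1.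
move: i0 i1 i2 i3; rewrite -!val_eqE /= !inordK //.
by case: i => [[|[|[|[|]]]]].
Qed.

Definition subst_morph (m n : 'M[R]_2) : {rmorphism {mpoly R[4]} -> {mpoly R[4]}} :=
  comp_mpoly
  [tuple m 0 0 *: 'X_iX0 + m 1 0 *: 'X_iY0; m 0 1 *: 'X_iX0 + m 1 1 *: 'X_iY0;
         n 0 0 *: 'X_iX1 + n 1 0 *: 'X_iY1; n 0 1 *: 'X_iX1 + n 1 1 *: 'X_iY1].

Lemma substD m n : {morph subst m n : P Q / P + Q}.
Proof. exact: (rmorphD (subst_morph m n)). Qed.
Lemma substB m n : {morph subst m n : P Q / P - Q}.
Proof. exact: (rmorphB (subst_morph m n)). Qed.
Lemma substM m n : {morph subst m n : P Q / P * Q}.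
Proof. exact: (rmorphM (subst_morph m n)). Qed.
Lemma substXn m n k : {morph subst m n : P / P ^+ k}.
Proof. exact: (rmorphXn (subst_morph m n)). Qed.
Lemma subst0 m n : subst m n 0 = 0.
Proof. exact: (rmorph0 (subst_morph m n)). Qed.
Lemma subst1 m n : subst m n 1 = 1.
Proof. exact: (rmorph1 (subst_morph m n)). Qed.
Lemma substZ m n a : {morph subst m n : P / a *: P}.
Proof. by move=> P; exact: comp_mpolyZ. Qed.
Lemma subst_sum m n (I : Type) (r : seq I) (C : pred I) (F : I -> {mpoly R[4]}) :
  subst m n (\sum_(i <- r | C i) F i) = \sum_(i <- r | C i) subst m n (F i).
Proof. exact: (rmorph_sum (subst_morph m n)). Qed.

Lemma substX0 m n : subst m n 'X_iX0 = m 0 0 *: 'X_iX0 + m 1 0 *: 'X_iY0.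
Proof. by rewrite /subst comp_mpolyXU /= inordK. Qed.
Lemma substY0 m n : subst m n 'X_iY0 = m 0 1 *: 'X_iX0 + m 1 1 *: 'X_iY0.
Proof. by rewrite /subst comp_mpolyXU /= inordK. Qed.
Lemma substX1 m n : subst m n 'X_iX1 = n 0 0 *: 'X_iX1 + n 1 0 *: 'X_iY1.
Proof. by rewrite /subst comp_mpolyXU /= inordK. Qed.
Lemma substY1 m n : subst m n 'X_iY1 = n 0 1 *: 'X_iX1 + n 1 1 *: 'X_iY1.
Proof. by rewrite /subst comp_mpolyXU /= inordK. Qed.

Definition substE := (substD, substB, substM, substXn, substZ,
  substX0, substY0, substX1, substY1, subst0, subst1).

(** This reduces identities between substitutions or evaluations to the four variables. *)
Lemma mpoly4_ind (C : {mpoly R[4]} -> Prop) :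
  (forall a P Q, C P -> C Q -> C (a *: P + Q)) -> (forall P Q, C P -> C Q -> C (P * Q)) ->
  C 0 -> C 1 -> C 'X_iX0 -> C 'X_iY0 -> C 'X_iX1 -> C 'X_iY1 -> forall P, C P.
Proof.
move=> CD CM C0 C1 CX0 CY0 CX1 CY1 P; rewrite [P]mpolyE.
elim/big_rec: _ => // u Q _ CQ; apply: CD => //; rewrite mpolyXE_id.
elim/big_rec: _ => // i S _; apply: (CM).
have Ci : C 'X_i by move: i; apply: ord4P.
by elim: (u i) => [|k IH]; rewrite ?expr0 // exprS; apply: CM.
Qed.

(** The columns of a matrix are the images of X_i and Y_i, so that substitution is a left action
    without a transpose. *)
Lemma subst_comp m n m' n' P :
  subst m n (subst m' n' P) = subst (m *m m') (n *m n') P.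
Proof.
elim/mpoly4_ind: P => [a P Q|P Q||||||].
- by rewrite !(substD, substZ) => -> ->.
- by rewrite !substM => -> ->.
all: rewrite !substE //; rewrite !mulmx2E !scalerDr !scalerA !scalerDl;
  by rewrite ?[_ * m' _ _]mulrC ?[_ * m' 1 _]mulrC ?[_ * n' _ _]mulrC
             ?[_ * n' 1 _]mulrC ?[m _ _ * _]mulrC ?[n _ _ * _]mulrC addrACA.
Qed.

Lemma subst_id P : subst 1%:M 1%:M P = P.
Proof.
elim/mpoly4_ind: P => [a P Q|P Q||||||].
- by rewrite !(substD, substZ) => -> ->.
- by rewrite !substM => -> ->.
all: by rewrite !substE // !mxE /= ?scale0r ?scale1r ?add0r ?addr0.
Qed.

Lemma bihomogP s0 s1 P : bihomog s0 s1 P <->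
  (forall u : 'X_{1..4}, P@_u != 0 -> (u iX0 + u iY0 = s0)%N /\ (u iX1 + u iY1 = s1)%N).
Proof. by split=> H m; have := H m; rewrite mcoeff_msupp. Qed.

Lemma bihomog0 s0 s1 : bihomog s0 s1 (0 : {mpoly R[4]}).
Proof. by apply/bihomogP => m; rewrite mcoeff0 eqxx. Qed.

Lemma bihomogZD s0 s1 a P Q :
  bihomog s0 s1 P -> bihomog s0 s1 Q -> bihomog s0 s1 (a *: P + Q).
Proof.
move=> /bihomogP hP /bihomogP hQ; apply/bihomogP => m.
rewrite mcoeffD mcoeffZ; have [P0|/hP //] := eqVneq P@_m 0.
by rewrite P0 mulr0 add0r => /hQ.
Qed.

Lemma bihomogD s0 s1 P Q :
  bihomog s0 s1 P -> bihomog s0 s1 Q -> bihomog s0 s1 (P + Q).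
Proof. by move=> hP hQ; rewrite -[P]scale1r; exact: bihomogZD. Qed.

Lemma bihomogZ s0 s1 a P : bihomog s0 s1 P -> bihomog s0 s1 (a *: P).
Proof. by move=> hP; rewrite -[a *: P]addr0; apply: bihomogZD => //; exact: bihomog0. Qed.

Lemma bihomogB s0 s1 P Q :
  bihomog s0 s1 P -> bihomog s0 s1 Q -> bihomog s0 s1 (P - Q).
Proof. by move=> hP hQ; rewrite addrC -scaleN1r; exact: bihomogZD. Qed.

Lemma bihomog_sum s0 s1 (I : Type) (r : seq I) (C : pred I) (F : I -> {mpoly R[4]}) :
  (forall i, C i -> bihomog s0 s1 (F i)) -> bihomog s0 s1 (\sum_(i <- r | C i) F i).
Proof. by move=> hF; elim/big_ind: _ => //; [exact: bihomog0 | exact: bihomogD]. Qed.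

Lemma bihomogM s0 s1 t0 t1 P Q : bihomog s0 s1 P -> bihomog t0 t1 Q ->
  bihomog (s0 + t0) (s1 + t1) (P * Q).
Proof.
move=> hP hQ m /msuppM_le /allpairsP[[u1 u2] /= [/hP[<- <-] /hQ[<- <-] ->]].
by rewrite !mnmDE; split; lia.
Qed.

Lemma bihomog1 : bihomog 0 0 (1 : {mpoly R[4]}).
Proof. by move=> m; rewrite msupp1 inE => /eqP ->; rewrite !mnmE. Qed.

Lemma bihomogX s0 s1 P k : bihomog s0 s1 P -> bihomog (k * s0) (k * s1) (P ^+ k).
Proof.
move=> hP; elim: k => [|k IH]; first exact: bihomog1.
by rewrite exprS !mulSn; apply: bihomogM.
Qed.

Lemma iE : ((iX0 == iY0) = false) * ((iX0 == iX1) = false) * ((iX0 == iY1) = false)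
 * ((iY0 == iX0) = false) * ((iY0 == iX1) = false) * ((iY0 == iY1) = false)
 * ((iX1 == iX0) = false) * ((iX1 == iY0) = false) * ((iX1 == iY1) = false)
 * ((iY1 == iX0) = false) * ((iY1 == iY0) = false) * ((iY1 == iX1) = false).
Proof. by rewrite -!val_eqE /= !inordK. Qed.

Lemma bihomogX0 : bihomog 1 0 ('X_iX0 : {mpoly R[4]}).
Proof. by move=> m; rewrite msuppX inE => /eqP ->; rewrite !mnm1E !iE eqxx. Qed.
Lemma bihomogY0 : bihomog 1 0 ('X_iY0 : {mpoly R[4]}).
Proof. by move=> m; rewrite msuppX inE => /eqP ->; rewrite !mnm1E !iE eqxx. Qed.
Lemma bihomogX1 : bihomog 0 1 ('X_iX1 : {mpoly R[4]}).
Proof. by move=> m; rewrite msuppX inE => /eqP ->; rewrite !mnm1E !iE eqxx. Qed.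
Lemma bihomogY1 : bihomog 0 1 ('X_iY1 : {mpoly R[4]}).
Proof. by move=> m; rewrite msuppX inE => /eqP ->; rewrite !mnm1E !iE eqxx. Qed.

(** Indexed by the exponents of Y_0 and Y_1, because the class in Q depends on them through
    [i + p * j]. As subtraction is truncated, the bidegree is (s0, s1) only for [i <= s0] and
    [j <= s1]. *)
Definition monY (s0 s1 i j : nat) : {mpoly R[4]} :=
  'X_iX0 ^+ (s0 - i) * 'X_iY0 ^+ i * ('X_iX1 ^+ (s1 - j) * 'X_iY1 ^+ j).

Lemma bihomog_prod s0 s1 i j k l (P Q P' Q' : {mpoly R[4]}) :
  (i + j = s0)%N -> (k + l = s1)%N ->
  bihomog 1 0 P -> bihomog 1 0 Q -> bihomog 0 1 P' -> bihomog 0 1 Q' ->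
  bihomog s0 s1 (P ^+ i * Q ^+ j * (P' ^+ k * Q' ^+ l)).
Proof.
move=> <- <- hP hQ hP' hQ'.
have -> : (i + j = (i * 1 + j * 1) + (k * 0 + l * 0))%N by lia.
have -> : (k + l = (i * 0 + j * 0) + (k * 1 + l * 1))%N by lia.
by do 2!apply: bihomogM; apply: bihomogX.
Qed.

Lemma bihomog_monY s0 s1 i j : (i <= s0)%N -> (j <= s1)%N ->
  bihomog s0 s1 (monY s0 s1 i j).
Proof.
move=> hi hj; apply: bihomog_prod; rewrite ?subnK //;
  [exact: bihomogX0|exact: bihomogY0|exact: bihomogX1|exact: bihomogY1].
Qed.

Definition mnmY (s0 s1 i j : nat) : 'X_{1..4} :=
  (U_(iX0) *+ (s0 - i) + U_(iY0) *+ i + (U_(iX1) *+ (s1 - j) + U_(iY1) *+ j))%MM.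

Lemma monYE s0 s1 i j : monY s0 s1 i j = 'X_[mnmY s0 s1 i j].
Proof. by rewrite /monY /mnmY !mpolyXD !mpolyXn. Qed.

Lemma mnmYE (s0 s1 i j : nat) :
  (mnmY s0 s1 i j iX0 = (s0 - i)%N) * (mnmY s0 s1 i j iY0 = i) *
  (mnmY s0 s1 i j iX1 = (s1 - j)%N) * (mnmY s0 s1 i j iY1 = j).
Proof. by rewrite /mnmY !mnmDE !mulmnE !mnm1E !iE !eqxx /=; do !split; lia. Qed.

Lemma bihomog_decomp s0 s1 P : bihomog s0 s1 P ->
  P = \sum_(i < s0.+1) \sum_(j < s1.+1) P@_(mnmY s0 s1 i j) *: monY s0 s1 i j.
Proof.
move=> /bihomogP hP; apply/mpolyP => m.
rewrite raddf_sum /=; under eq_bigr do rewrite raddf_sum /=.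
under eq_bigr do under eq_bigr do rewrite mcoeffZ monYE mcoeffX.
rewrite pair_big /=.
have [Pm|/hP[h0 h1]] := eqVneq P@_m 0.
  rewrite Pm big1 // => -[i j] _ /=.
  by case: eqP => [->|]; rewrite ?Pm ?mul0r ?mulr0.
have l0 : (m iY0 < s0.+1)%N by lia.
have l1 : (m iY1 < s1.+1)%N by lia.
have mE : mnmY s0 s1 (m iY0) (m iY1) = m.
  by apply/mnmP; apply: ord4P; rewrite mnmYE //; lia.
rewrite (bigD1 (Ordinal l0, Ordinal l1)) //= mE eqxx mulr1 big1 ?addr0 //.
move=> [i j] /= /eqP ij; case: eqP => [E|]; rewrite ?mulr0 //; case: ij.
congr (_, _); apply: val_inj => /=.
  by rewrite -[RHS](congr1 (fun f : 'X_{1..4} => f iY0) E) mnmYE.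
by rewrite -[RHS](congr1 (fun f : 'X_{1..4} => f iY1) E) mnmYE.
Qed.

Lemma subst_bihomog s0 s1 m n P : bihomog s0 s1 P -> bihomog s0 s1 (subst m n P).
Proof.
have H10 a b : bihomog 1 0 (a *: 'X_iX0 + b *: 'X_iY0 : {mpoly R[4]}).
  by apply/bihomogZD/bihomogZ; [exact: bihomogX0 | exact: bihomogY0].
have H01 a b : bihomog 0 1 (a *: 'X_iX1 + b *: 'X_iY1 : {mpoly R[4]}).
  by apply/bihomogZD/bihomogZ; [exact: bihomogX1 | exact: bihomogY1].
move=> /bihomog_decomp ->; rewrite subst_sum; apply: bihomog_sum => i _.
rewrite subst_sum; apply: bihomog_sum => j _; rewrite substZ; apply: bihomogZ.
have := ltn_ord i; have := ltn_ord j; rewrite !ltnS => hj hi.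
by rewrite /monY !substE; apply: bihomog_prod => //; rewrite subnK.
Qed.

End Substitution.

(** * Valuations, reductions and Teichmueller lifts *)

Section Valuation.
Variables (p : nat) (Qp : fieldType) (L : fieldExtType Qp) (E : fieldExtType L).
Variables (Fq : finFieldType) (Fbar : closedFieldType).
Variable D : padic_setting p E Fq Fbar.
Hypothesis p_prime : prime p.
Local Notation v := (v D).
Local Notation red := (red D).
Implicit Types (x y : E).

Lemma charE0 : [pchar E] =i pred0.
Proof.
move=> n; rewrite -(Qp_char0 D n).
by rewrite (fmorph_pchar (in_alg E)) (fmorph_pchar (in_alg L)).
Qed.

Lemma natE_neq0 n : (0 < n)%N -> n%:R != 0 :> E.
Proof. by move=> n0; rewrite (pcharf0P E).1 -?lt0n //; exact: charE0. Qed.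

Lemma pE_neq0 : p%:R != 0 :> E.
Proof. exact/natE_neq0/prime_gt0. Qed.

Lemma v_one : v 1 = 0.
Proof.
have := Defs.valM D (oner_neq0 E) (oner_neq0 E).
by rewrite mulr1 => /eqP; rewrite -subr_eq0 opprD addNKr oppr_eq0 => /eqP.
Qed.

Lemma v_opp x : v (- x) = v x.
Proof.
have [->|x0] := eqVneq x 0; first by rewrite oppr0.
have N1 : (-1 : E) != 0 by rewrite oppr_eq0 oner_neq0.
rewrite -mulN1r Defs.valM //; suff -> : v (-1) = 0 by rewrite add0r.
have := Defs.valM D N1 N1; rewrite mulrNN mulr1 v_one => /esym/eqP.
by rewrite -mulr2n mulrn_eq0 /= => /eqP.
Qed.

Lemma v_inv x : x != 0 -> v x^-1 = - v x.
Proof.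
move=> x0; have /eqP := Defs.valM D x0 (invr_neq0 x0).
by rewrite mulfV // v_one eq_sym addrC addr_eq0 => /eqP.
Qed.

Lemma vge0 c : vge v c 0.
Proof. by rewrite /vge eqxx. Qed.

Lemma vge_le a b x : a <= b -> vge v b x -> vge v a x.
Proof. by rewrite /vge => ab /orP[->//|bx]; rewrite (le_trans ab bx) orbT. Qed.

Lemma vgt_vge a b x : a <= b -> vgt v b x -> vge v a x.
Proof. by rewrite /vge /vgt => ab /orP[->//|bx]; rewrite (le_trans ab (ltW bx)) orbT. Qed.

Lemma vge_vgt a b x : a < b -> vge v b x -> vgt v a x.
Proof. by rewrite /vge /vgt => ab /orP[->//|bx]; rewrite (lt_le_trans ab bx) orbT. Qed.

Lemma vgeM a b x y : vge v a x -> vge v b y -> vge v (a + b) (x * y).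
Proof.
rewrite /vge; have [->|x0] := eqVneq x 0; first by rewrite mul0r eqxx.
have [->|y0] := eqVneq y 0; first by rewrite mulr0 eqxx.
by rewrite mulf_eq0 (negPf x0) (negPf y0) /= => ax ay; rewrite Defs.valM ?lerD.
Qed.

Lemma vgeN a x : vge v a (- x) = vge v a x.
Proof. by rewrite /vge oppr_eq0 v_opp. Qed.

Lemma vgeD a x y : vge v a x -> vge v a y -> vge v a (x + y).
Proof. exact: Defs.valD. Qed.

Lemma vgeB a x y : vge v a x -> vge v a y -> vge v a (x - y).
Proof. by move=> ax ay; apply: vgeD; rewrite ?vgeN. Qed.

Lemma vge_sum a (I : Type) (r : seq I) (C : pred I) (F : I -> E) :
  (forall i, C i -> vge v a (F i)) -> vge v a (\sum_(i <- r | C i) F i).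
Proof. by move=> hF; elim/big_ind: _ => //; [exact: vge0 | exact: vgeD]. Qed.

Lemma int1 : vge v 0 1.
Proof. by rewrite /vge v_one lexx orbT. Qed.

Lemma intM x y : vge v 0 x -> vge v 0 y -> vge v 0 (x * y).
Proof. by move=> hx hy; rewrite -[0 : rat]addr0; exact: vgeM. Qed.

Lemma intX x n : vge v 0 x -> vge v 0 (x ^+ n).
Proof. by move=> hx; elim: n => [|n IH]; rewrite ?int1 // exprS intM. Qed.

Lemma int_nat n : vge v 0 n%:R.
Proof. by elim: n => [|n IH]; rewrite ?vge0 // mulrS vgeD // int1. Qed.

Lemma vgep : vge v 1 p%:R.
Proof. by rewrite /vge val_p lexx orbT. Qed.

Lemma red0 : red 0 = 0.
Proof.
have := redD (vge0 0) (vge0 0).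
by rewrite addr0 => /eqP; rewrite -subr_eq0 opprD addNKr oppr_eq0 => /eqP.
Qed.

Lemma red_vgt x : vgt v 0 x -> red x = 0.
Proof. by move=> x0; apply/red_eq0 => //; exact: (vgt_vge (lexx 0) x0). Qed.

Lemma red_p : red p%:R = 0.
Proof. exact/red_vgt/(vge_vgt ltr01 vgep). Qed.

Lemma redN x : vge v 0 x -> red (- x) = - red x.
Proof.
move=> hx; apply/eqP; rewrite -addr_eq0 -redD ?vgeN //.
by rewrite addNr red0.
Qed.

Lemma redB x y : vge v 0 x -> vge v 0 y -> red (x - y) = red x - red y.
Proof. by move=> hx hy; rewrite redD ?vgeN // redN. Qed.

Lemma red_sum (I : Type) (r : seq I) (C : pred I) (F : I -> E) :
  (forall i, C i -> vge v 0 (F i)) ->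
  red (\sum_(i <- r | C i) F i) = \sum_(i <- r | C i) red (F i).
Proof.
move=> hF; elim: r => [|i r IH]; rewrite ?big_nil ?red0 // !big_cons.
by case: ifP => // Ci; rewrite redD ?IH ?hF ?vge_sum.
Qed.

Lemma redXn x n : vge v 0 x -> red (x ^+ n) = red x ^+ n.
Proof.
by move=> hx; elim: n => [|n IH]; rewrite ?red1 // !exprS redM ?IH ?intX.
Qed.

Lemma red_nat n : red n%:R = n%:R.
Proof. by elim: n => [|n IH]; rewrite ?red0 // !mulrS redD ?int1 ?int_nat // red1 IH. Qed.

Lemma pFbar : p \in [pchar Fbar].
Proof. by rewrite inE p_prime -red_nat red_p eqxx. Qed.

Lemma pFq : p \in [pchar Fq].
Proof. by rewrite -(fmorph_pchar (Defs.iota D) p) pFbar. Qed.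

Lemma sigma_int (x : L) : vge v 0 x%:A -> vge v 0 (sigma D x)%:A.
Proof.
move=> hx; rewrite -[sigma D x](subrK (x ^+ p)) scalerDl.
apply: vgeD; first exact: (vgt_vge (lexx 0) (sigma_frob hx)).
by rewrite -in_algE rmorphXn /= intX.
Qed.

Lemma red_sigma (x : L) : vge v 0 x%:A -> red (sigma D x)%:A = red x%:A ^+ p.
Proof.
move=> hx; apply/eqP; rewrite -subr_eq0 -redXn // -redB ?intX ?sigma_int //.
have -> : (sigma D x)%:A - x%:A ^+ p = (sigma D x - x ^+ p)%:A :> E.
  by rewrite -!in_algE rmorphB rmorphXn.
by rewrite (red_vgt (sigma_frob hx)) eqxx.
Qed.

(** Elements of L have integral valuation because L is unramified, so positive valuation already
    means divisibility by p. This may fail in E, which is why sums of Teichmueller lifts are pulled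
    back to L. *)
Lemma vge1_L (x : L) : vge v 0 x%:A -> red x%:A = 0 -> vge v 1 x%:A.
Proof.
move=> hx /(red_eq0 hx); rewrite /vgt /vge => /orP[->//|vx].
have [-> //|x0] := eqVneq (x%:A : E) 0.
have /(L_unramified D) /intrP[n vn] : x != 0.
  by apply: contraNneq x0 => ->; rewrite scale0r.
by move: vx; rewrite vn orFb; rewrite -[0 : rat]/(0%:~R) -[1 : rat]/(1%:~R) ltr_int ler_int.
Qed.

Definition TE (l : Fq) : E := (teich D l)%:A.

Lemma TE_int l : vge v 0 (TE l). Proof. exact: teich_int. Qed.
Lemma TE_red l : red (TE l) = Defs.iota D l. Proof. exact: teich_red. Qed.
Lemma TE_root l : TE l ^+ (p ^ 2) = TE l.
Proof. by rewrite /TE -!in_algE -rmorphXn /= teich_root. Qed.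

Lemma q_gt1 : (1 < p ^ 2)%N.
Proof. by have := prime_gt1 p_prime; nia. Qed.

(** X^q - X has at most q roots in E, and the q Teichmueller lifts, which have distinct reductions,
    exhaust them. *)
Lemma TE_uniq x l : x ^+ (p ^ 2) = x -> red x = Defs.iota D l -> x = TE l.
Proof.
move=> xq xl; pose P := 'X^(p ^ 2) - 'X : {poly E}.
have sP : size P = (p ^ 2).+1.
  by rewrite size_polyDl size_polyXn // size_polyN size_polyX ltnS q_gt1.
have P0 : P != 0 by rewrite -size_poly_eq0 sP.
have TEinj : injective TE.
  by move=> a b /(congr1 red); rewrite !TE_red => /fmorph_inj.
pose s := map TE (enum Fq).
have [/mapP[l' _ xE]|xs] := boolP (x \in s).
  by rewrite xE; congr TE; apply: (fmorph_inj (Defs.iota D)); rewrite -xl xE TE_red.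
have rs : all (root P) (x :: s).
  apply/allP => y; rewrite inE => /predU1P[->|/mapP[l' _ ->]];
    by rewrite /root !hornerE ?xq ?TE_root subrr.
have us : uniq (x :: s) by rewrite /= xs map_inj_uniq ?enum_uniq.
by have := max_poly_roots P0 rs us; rewrite sP /= size_map -cardT (Fq_card D) ltnn.
Qed.

Lemma TEN l : (2 < p)%N -> TE (- l) = - TE l.
Proof.
move=> p2; apply/esym/TE_uniq; last by rewrite redN ?TE_int // TE_red rmorphN.
rewrite -mulN1r exprMn TE_root -signr_odd oddX /=.
by have /even_prime [pE|->] := p_prime; rewrite ?expr1 //; move: p2; rewrite pE.
Qed.

End Valuation.

(** * Power sums over a finite field *)

Section PowerSums.
Variables (F : finFieldType) (K : fieldType) (h : {rmorphism F -> K}).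
Local Notation q1 := (#|F|.-1).

Lemma card_gt1 : (1 < #|F|)%N.
Proof. by rewrite (cardD1 0) (cardD1 1) !inE oner_neq0. Qed.

Lemma expf_card1 (x : F) : x != 0 -> x ^+ q1 = 1.
Proof.
move=> x0; apply: (mulfI x0); rewrite -exprS prednK ?mulr1 ?expf_card //.
exact: ltnW card_gt1.
Qed.

Lemma expf_congr (x : F) a b : (0 < a)%N -> (0 < b)%N -> a = b %[mod q1] -> x ^+ a = x ^+ b.
Proof.
move=> a0 b0 ab; have [->|x0] := eqVneq x 0; first by rewrite !expr0n !gtn_eqF.
have expE c : x ^+ c = x ^+ (c %% q1).
  by rewrite {1}(divn_eq c q1) exprD mulnC exprM expf_card1 // expr1n mul1r.
by rewrite expE ab -expE.
Qed.

Lemma card_natr0 : #|F|%:R = 0 :> F.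
Proof.
apply: (addrI (\sum_(x : F) x)); rewrite addr0 -sum1_card natr_sum -big_split /=.
by rewrite -(reindex_inj (addIr 1) (P := xpredT) (F := id)).
Qed.

(** For k = 0 the sum is q = 0, with 0^0 = 1. If q - 1 does not divide k, some unit y has y^k <> 1,
    and the substitution x -> y x multiplies the sum by y^k. *)
Lemma sum_expf k : \sum_(x : F) x ^+ k = if (0 < k)%N && (q1 %| k)%N then -1 else 0.
Proof.
have q1_gt0 : (0 < q1)%N by have := card_gt1; lia.
case: posnP => [->|k0] /=.
  rewrite -[RHS]card_natr0 -sum1_card natr_sum.
  by apply: eq_bigr => x _; rewrite expr0.
case: ifP => [/dvdnP[d kE]|ndiv].
  rewrite (bigD1 0) //= expr0n gtn_eqF // add0r.
  have -> : \sum_(x : F | x != 0) x ^+ k = q1%:R.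
    rewrite -(cardC1 (0 : F)) -sum1_card natr_sum; apply: eq_bigr => x x0.
    by rewrite kE mulnC exprM expf_card1 // expr1n.
  by apply/eqP; rewrite -subr_eq0 opprK natr1 prednK ?card_natr0 // ltnW ?card_gt1.
have [y y0 yk] : exists2 y : F, y != 0 & y ^+ k != 1.
  (* Otherwise X^(k mod (q - 1)) - 1, of positive degree below q - 1, would vanish at all q - 1
     units. *)
  apply: contrapT => nE.
  have all1 (y : F) : y != 0 -> y ^+ (k %% q1) = 1.
    move=> y0; have : y ^+ k = 1 by apply/eqP/negPn/negP => yk; apply: nE; exists y.
    by rewrite {1}(divn_eq k q1) exprD mulnC exprM expf_card1 // expr1n mul1r.
  have r0 : (0 < k %% q1)%N by rewrite lt0n; move: ndiv; rewrite /dvdn => ->.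
  pose P := 'X^(k %% q1) - 1 : {poly F}.
  have sP : size P = (k %% q1).+1 by rewrite size_XnsubC.
  have P0 : P != 0 by rewrite -size_poly_eq0 sP.
  have rs : all (root P) (enum (predC1 (0 : F))).
    by apply/allP => y; rewrite mem_enum inE => /all1 y1; rewrite /root !hornerE y1 subrr.
  have := max_poly_roots P0 rs (enum_uniq _).
  by rewrite sP -cardE cardC1 ltnS leqNgt ltn_pmod.
have /eqP : \sum_(x : F) x ^+ k = y ^+ k * \sum_(x : F) x ^+ k.
  rewrite mulr_sumr (reindex_inj (mulfI y0)) /=.
  by apply: eq_bigr => x _; rewrite exprMn.
rewrite -subr_eq0 -{1}[X in X - _]mul1r -mulrBl mulf_eq0 subr_eq0 eq_sym (negPf yk) /=.
by move/eqP.
Qed.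

(** Discrete Fourier inversion: among the exponents q1 - j + i with i < q1, only i = j gives a
    multiple of q1. Since q1 - j > 0, the point x = 0 contributes nothing. *)
Lemma sum_extract (f : {poly K}) j : (size f <= q1)%N -> (j < q1)%N ->
  \sum_(x : F) h x ^+ (q1 - j) * f.[h x] = - f`_j.
Proof.
move=> sf jq; under eq_bigr do rewrite (horner_coef_wide _ sf) mulr_sumr.
rewrite exchange_big /= (bigD1 (Ordinal jq)) //= [X in _ + X]big1 ?addr0.
  under eq_bigr do rewrite mulrCA -exprD subnK 1?ltnW // -rmorphXn.
  rewrite -mulr_sumr -rmorph_sum sum_expf dvdnn /= (leq_ltn_trans _ jq) //.
  by rewrite rmorphN rmorph1 mulrN1.
move=> i ij; under eq_bigr do rewrite mulrCA -exprD -rmorphXn.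
rewrite -mulr_sumr -rmorph_sum sum_expf; case: ifP; rewrite ?rmorph0 ?mulr0 //.
case/andP => _ /dvdnP[d dE]; case/negP: ij; rewrite -val_eqE /=; apply/eqP.
have key (q n : nat) : (j < q -> n < q -> q - j + n = d * q -> n = j)%N.
  by case: d {dE} => [|[|d]]; rewrite ?mulSn; lia.
exact: (key _ _ jq (ltn_ord i) dE).
Qed.

End PowerSums.

(** * Integrality and reduction of polynomials *)

Section Reduction.
Variables (p : nat) (Qp : fieldType) (L : fieldExtType Qp) (E : fieldExtType L).
Variables (Fq : finFieldType) (Fbar : closedFieldType).
Variable D : padic_setting p E Fq Fbar.
Local Notation v := (v D).
Local Notation red := (red D).
Implicit Types (P Q : {mpoly E[4]}) (S T : {mpoly Fbar[4]}) (a c : E).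

Definition pge (e : rat) P := forall u : 'X_{1..4}, vge v e P@_u.

Lemma pge0 e : pge e 0. Proof. by move=> u; rewrite mcoeff0 vge0. Qed.
Lemma pgeD e P Q : pge e P -> pge e Q -> pge e (P + Q).
Proof. by move=> hP hQ u; rewrite mcoeffD vgeD. Qed.
Lemma pgeB e P Q : pge e P -> pge e Q -> pge e (P - Q).
Proof. by move=> hP hQ u; rewrite mcoeffB vgeB. Qed.
Lemma pgeZ e e' c P : vge v e c -> pge e' P -> pge (e + e') (c *: P).
Proof. by move=> hc hP u; rewrite mcoeffZ vgeM. Qed.
Lemma pge_sum e (I : Type) (r : seq I) (C : pred I) (F : I -> {mpoly E[4]}) :
  (forall i, C i -> pge e (F i)) -> pge e (\sum_(i <- r | C i) F i).
Proof. by move=> hF; elim/big_ind: _ => //; [exact: pge0 | exact: pgeD]. Qed.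
Lemma pgeM e e' P Q : pge e P -> pge e' Q -> pge (e + e') (P * Q).
Proof. by move=> hP hQ u; rewrite mcoeffM; apply: vge_sum => k _; exact: vgeM. Qed.

(** [red] respects sums and products only on O_E. Reduction is therefore a relation that includes
    integrality and is closed under the ring operations. *)
Definition rd P S := forall u : 'X_{1..4}, vge v 0 P@_u /\ red P@_u = S@_u.

Lemma rd_pge P S : rd P S -> pge 0 P. Proof. by move=> h u; case: (h u). Qed.

Lemma mcoeff_map_red P u : (map_mpoly red P)@_u = red P@_u.
Proof.
rewrite /map_mpoly /mmap raddf_sum /=.
have mmE m : mmap1 (fun i => 'X_i) m = 'X_[m] :> {mpoly Fbar[4]} by rewrite mpolyXE_id.
under eq_bigr do rewrite mmE mcoeffCM mcoeffX.
have [uP|uP] := boolP (u \in msupp P).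
  rewrite (bigD1_seq u) ?msupp_uniq //= eqxx mulr1 big1 ?addr0 // => i /negPf ->.
  by rewrite mulr0.
rewrite (memN_msupp_eq0 uP) red0 big_seq big1 // => i iP.
by case: eqP => [iu|]; rewrite ?mulr0 //; move: uP; rewrite -iu iP.
Qed.

Lemma rd_map P S : rd P S -> map_mpoly red P = S.
Proof. by move=> h; apply/mpolyP => u; rewrite mcoeff_map_red; case: (h u). Qed.

Lemma pge_rd P : pge 0 P -> rd P (map_mpoly red P).
Proof. by move=> hP u; rewrite mcoeff_map_red. Qed.

Lemma rd0 : rd 0 0. Proof. by move=> u; rewrite !mcoeff0 vge0 red0. Qed.
Lemma rdD P Q S T : rd P S -> rd Q T -> rd (P + Q) (S + T).
Proof.
by move=> hP hQ u; have [a1 a2] := hP u; have [a3 a4] := hQ u;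
  rewrite !mcoeffD -a2 -a4 vgeD // redD.
Qed.
Lemma rdZ c P S : vge v 0 c -> rd P S -> rd (c *: P) (red c *: S).
Proof. by move=> hc hP u; have [a1 a2] := hP u; rewrite !mcoeffZ -a2 intM // redM. Qed.
Lemma rdN P S : rd P S -> rd (- P) (- S).
Proof. by move=> hP u; have [a1 a2] := hP u; rewrite !mcoeffN -a2 vgeN redN. Qed.
Lemma rdB P Q S T : rd P S -> rd Q T -> rd (P - Q) (S - T).
Proof. by move=> hP hQ; apply: rdD => //; exact: rdN. Qed.
Lemma rd_sum (I : Type) (r : seq I) (C : pred I) (F : I -> {mpoly E[4]}) G :
  (forall i, C i -> rd (F i) (G i)) ->
  rd (\sum_(i <- r | C i) F i) (\sum_(i <- r | C i) G i).
Proof. by move=> hF; elim/big_ind2: _ => //; [exact: rd0 | move=> *; exact: rdD]. Qed.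
Lemma rd1 : rd 1 1.
Proof. by move=> u; rewrite !mcoeff1; case: eqP => _; rewrite ?red0 ?vge0 ?red1 ?int1. Qed.
Lemma rdM P Q S T : rd P S -> rd Q T -> rd (P * Q) (S * T).
Proof.
move=> hP hQ u; rewrite !mcoeffM.
have hk k : vge v 0 (P@_k.1 * Q@_k.2).
  by have [? _] := hP k.1; have [? _] := hQ k.2; exact: intM.
rewrite red_sum => [|k _]; last exact: (hk (k.1 : 'X_{1..4}, k.2 : 'X_{1..4})).
split; first by apply: vge_sum => k _; exact: (hk (k.1 : 'X_{1..4}, k.2 : 'X_{1..4})).
apply: eq_bigr => k _.
by have [? <-] := hP k.1; have [? <-] := hQ k.2; rewrite redM.
Qed.
Lemma rdXn P S n : rd P S -> rd (P ^+ n) (S ^+ n).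
Proof. by move=> h; elim: n => [|n IH]; [exact: rd1 | rewrite !exprS; exact: rdM]. Qed.
Lemma rdX i : rd 'X_i 'X_i.
Proof. by move=> u; rewrite !mcoeffX; case: eqP => _; rewrite ?red0 ?vge0 ?red1 ?int1. Qed.

Lemma rd_pge1 P : pge 1 P -> rd P 0.
Proof.
move=> h u; rewrite mcoeff0; split; first by apply: (vge_le ler01).
exact/red_vgt/(vge_vgt ltr01).
Qed.

Lemma rd_bihomog s0 s1 P S : rd P S -> bihomog s0 s1 P -> bihomog s0 s1 S.
Proof.
move=> h /bihomogP hP; apply/bihomogP => u; have [_ <-] := h u => ru.
by apply: hP; apply: contraNneq ru => ->; rewrite red0.
Qed.

Lemma rd_monY s0 s1 i j : rd (monY E s0 s1 i j) (monY Fbar s0 s1 i j).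
Proof. by rewrite /monY; do !apply: rdM; apply/rdXn/rdX. Qed.

Definition rdm (k : 'M[E]_2) (k' : 'M[Fbar]_2) :=
  forall i j, vge v 0 (k i j) /\ red (k i j) = k' i j.

Lemma rd_subst s0 s1 k0 k1 k0' k1' P S : bihomog s0 s1 P -> rdm k0 k0' -> rdm k1 k1' ->
  rd P S -> rd (subst k0 k1 P) (subst k0' k1' S).
Proof.
move=> hP h0 h1 hPS; have hS := rd_bihomog hPS hP.
rewrite (bihomog_decomp hP) (bihomog_decomp hS) !subst_sum.
apply: rd_sum => i _; rewrite !subst_sum; apply: rd_sum => j _.
rewrite !substZ; have [hu <-] := hPS (mnmY s0 s1 i j); apply: rdZ => //.
have lin2 (k : 'M[E]_2) k' (a b c d : 'I_2) e f : rdm k k' ->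
    rd (k a b *: 'X_e + k c d *: 'X_f : {mpoly E[4]}) (k' a b *: 'X_e + k' c d *: 'X_f).
  by move=> hk; apply: rdD; [have [? <-] := hk a b|have [? <-] := hk c d]; apply/rdZ/rdX.
by rewrite /monY !substE; do !apply: rdM; apply/rdXn/lin2.
Qed.

End Reduction.

(** * Cosets of KZ and compact induction *)

Section Groups.
Variables (p : nat) (Qp : fieldType) (L : fieldExtType Qp) (E : fieldExtType L).
Variables (Fq : finFieldType) (Fbar : closedFieldType).
Variable D : padic_setting p E Fq Fbar.
Hypothesis p_prime : prime p.
Local Notation v := (v D).
Local Notation intL x := (vge v 0 ((x : L)%:A)).
Implicit Types (g h k : 'M[L]_2).

Lemma intLD (x y : L) : intL x -> intL y -> intL (x + y).
Proof. by rewrite scalerDl; exact: vgeD. Qed.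
Lemma intLM (x y : L) : intL x -> intL y -> intL (x * y).
Proof. by move=> hx hy; rewrite -in_algE rmorphM /= intM. Qed.
Lemma intL0 : intL 0. Proof. by rewrite scale0r vge0. Qed.
Lemma intL1 : intL 1. Proof. by rewrite scale1r int1. Qed.
Lemma intLN (x : L) : intL x -> intL (- x).
Proof. by rewrite scaleNr vgeN. Qed.

Lemma pL_neq0 : p%:R != 0 :> L.
Proof.
apply: contraNneq (pE_neq0 D p_prime) => pL.
by rewrite -(rmorph_nat (in_alg E)) pL rmorph0.
Qed.

Lemma val_pz (n : int) : v ((p%:R ^ n : L)%:A) = n%:~R.
Proof.
have p0 := pE_neq0 D p_prime.
have pX (m : nat) : v (p%:R ^+ m) = m%:R.
  elim: m => [|m IH]; first by rewrite v_one.
  by rewrite exprS Defs.valM ?expf_neq0 // val_p IH mulrS.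
have pXn (m : nat) : (p%:R ^+ m : L)%:A = p%:R ^+ m :> E.
  by rewrite -in_algE rmorphXn rmorph_nat.
case: n => n; first by rewrite -exprnP pXn pX.
by rewrite NegzE -exprnN -in_algE fmorphV /= pXn v_inv ?expf_neq0 // pX mulrNz.
Qed.

Lemma inK1 : inK D 1%:M.
Proof.
split=> [i j|]; last by rewrite det1 oner_neq0 scale1r v_one.
by rewrite !mxE; case: eqP => _; rewrite ?intL0 ?intL1.
Qed.

Lemma inKM k k' : inK D k -> inK D k' -> inK D (k *m k').
Proof.
case=> ki [kd kv] [ki' [kd' kv']]; split=> [i j|].
  by rewrite mulmx2E intLD ?intLM.
rewrite det_mulmx mulf_neq0 //; split=> //.
rewrite -in_algE rmorphM /= Defs.valM ?kv ?kv' ?addr0 //;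
  by rewrite -[X in X != 0]in_algE fmorph_eq0.
Qed.

Lemma inK_unit k : inK D k -> k \in unitmx.
Proof. by case=> _ [kd _]; rewrite unitmxE unitfE. Qed.

Lemma inKV k : inK D k -> inK D (invmx k).
Proof.
move=> kK; have [ki [kd kv]] := kK.
have dE : (\det k)%:A != 0 :> E by rewrite -in_algE fmorph_eq0.
have dV : ((\det k)^-1 : L)%:A = ((\det k)%:A : E)^-1 by rewrite -!in_algE fmorphV.
split=> [i j|]; last first.
  by rewrite det_inv invr_neq0 // dV v_inv // kv oppr0.
rewrite /invmx (inK_unit kK) !mxE; apply: intLM.
  by rewrite dV /vge v_inv // kv oppr0 lexx orbT.
rewrite /cofactor; apply: intLM.
  by rewrite -signr_odd; case: odd; rewrite ?expr1 ?expr0 ?intLN ?intL1.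
by rewrite det_mx11 !mxE.
Qed.

Lemma decKZ_unit h k : decKZ D h k -> h \in unitmx.
Proof.
case=> kK [n ->]; rewrite unitmxE detZ unitrM -unitmxE (inK_unit kK) andbT.
by rewrite unitfE expf_neq0 // expfz_neq0 // pL_neq0.
Qed.

(** The determinant of p^n k has valuation 2 n, which recovers n and then k. *)
Lemma decKZ_uniq h k k' : decKZ D h k -> decKZ D h k' -> k' = k.
Proof.
have val_det k1 n : inK D k1 -> v (\det (p%:R ^ n *: k1))%:A = (n + n)%:~R.
  case=> _ [kd kv]; rewrite detZ expr2 -mulrA -!in_algE !rmorphM /=.
  have pn0 : (p%:R ^ n : L)%:A != 0 :> E by rewrite -in_algE fmorph_eq0 expfz_neq0 // pL_neq0.
  have d0 : (\det k1)%:A != 0 :> E by rewrite -in_algE fmorph_eq0.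
  by rewrite !Defs.valM ?mulf_neq0 // kv addr0 val_pz rmorphD.
case=> kK [n hn] [kK' [n' hn']].
have : (n + n)%:~R = (n' + n')%:~R :> rat by rewrite -(val_det k) // -(val_det k') // -hn hn'.
move=> /eqP; rewrite eqr_int => /eqP nn; have {nn} nn : n = n' by lia.
move: hn; rewrite hn' nn => /(congr1 (fun m => (p%:R ^ n')^-1 *: m)).
by rewrite !scalerA mulVf ?scale1r // expfz_neq0 // pL_neq0.
Qed.

Lemma KpartE h k : decKZ D h k -> Kpart D h = k.
Proof. by move=> hk; apply: xget_unique => // k' hk'; exact: decKZ_uniq hk hk'. Qed.

Lemma inK_dec k : inK D k -> decKZ D k k.
Proof. by move=> kK; split=> //; exists 0; rewrite expr0z scale1r. Qed.

Lemma inK_inKZ k : inK D k -> inKZ D k.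
Proof. by exists k; exact: inK_dec. Qed.

Lemma decKZM h k h' k' : decKZ D h k -> decKZ D h' k' -> decKZ D (h *m h') (k *m k').
Proof.
case=> kK [n ->] [kK' [n' ->]]; split; first exact: inKM.
by exists (n + n'); rewrite -scalemxAl -scalemxAr scalerA expfzDr // pL_neq0.
Qed.

Lemma decKZV h k : decKZ D h k -> decKZ D (invmx h) (invmx k).
Proof.
move=> hk; have hu := decKZ_unit hk; case: hk => kK [n hE]; split; first exact: inKV.
exists (- n); apply: (can_inj (mulKmx hu)); rewrite mulmxV // hE.
rewrite -scalemxAl -scalemxAr scalerA -expfzDr ?pL_neq0 // subrr expr0z scale1r.
by rewrite mulmxV // inK_unit.
Qed.

Lemma inKZM h h' : inKZ D h -> inKZ D h' -> inKZ D (h *m h').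
Proof. by case=> k hk [k' hk']; exists (k *m k'); exact: decKZM. Qed.

Lemma inKZV h : inKZ D h -> inKZ D (invmx h).
Proof. by case=> k hk; exists (invmx k); exact: decKZV. Qed.

Lemma inKZ_unit h : inKZ D h -> h \in unitmx.
Proof. by case=> k /decKZ_unit. Qed.

Lemma inKZ1 : inKZ D 1%:M.
Proof. exact/inK_inKZ/inK1. Qed.

Lemma inKZMl h g : inKZ D h -> inKZ D (h *m g) <-> inKZ D g.
Proof.
move=> hK; split=> [hg|]; last exact: inKZM.
by rewrite -(mulKmx (inKZ_unit hK) g); apply: inKZM => //; exact: inKZV.
Qed.

Lemma inKZMr h g : inKZ D h -> inKZ D (g *m h) <-> inKZ D g.
Proof.
move=> hK; split=> [hg|gK]; last exact: inKZM.
by rewrite -(mulmxK (inKZ_unit hK) g); apply: inKZM => //; exact: inKZV.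
Qed.

Section IntegralMorphism.
Variable R : comNzRingType.

(** The reduction O_L -> Fbar is encoded as a function on all of L that is a ring morphism only on
    O_L; the entries of elements of K lie there. Both coefficient rings E and Fbar are covered. *)
Definition omor (e : L -> R) :=
  [/\ e 0 = 0, e 1 = 1, forall x y, intL x -> intL y -> e (x + y) = e x + e y
    & forall x y, intL x -> intL y -> e (x * y) = e x * e y].

Lemma omor_sigma e : omor e -> omor (e \o sigma D).
Proof.
case=> e0 e1 eD eM; split=> [||x y hx hy|x y hx hy] /=.
- by rewrite rmorph0.
- by rewrite rmorph1.
- by rewrite rmorphD eD // sigma_int.
- by rewrite rmorphM eM // sigma_int.
Qed.

Lemma omor_mulmx e k k' : omor e -> inK D k -> inK D k' ->
  map_mx e (k *m k') = map_mx e k *m map_mx e k'.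
Proof.
case=> _ _ eD eM [ki _] [ki' _]; apply/matrixP => i j.
by rewrite [LHS]mxE !mulmx2E eD ?intLM // !eM // !mxE.
Qed.

Variable (e : L -> R) (eO : omor e).

Lemma KZact_dec h k P : decKZ D h k ->
  KZact D e h P = subst (map_mx e k) (map_mx (e \o sigma D) k) P.
Proof. by move=> hk; rewrite /KZact (KpartE hk). Qed.

Lemma KZactM h h' P : inKZ D h -> inKZ D h' ->
  KZact D e (h *m h') P = KZact D e h (KZact D e h' P).
Proof.
case=> k hk [k' hk']; rewrite (KZact_dec _ (decKZM hk hk')) (KZact_dec _ hk) (KZact_dec _ hk').
have [kK _] := hk; have [kK' _] := hk'.
by rewrite subst_comp !omor_mulmx //; exact: omor_sigma.
Qed.

Lemma KZactZD h a P Q : KZact D e h (a *: P + Q) = a *: KZact D e h P + KZact D e h Q.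
Proof. by rewrite /KZact substD substZ. Qed.

Lemma KZact_bihomog s0 s1 h P : bihomog s0 s1 P -> bihomog s0 s1 (KZact D e h P).
Proof. exact: subst_bihomog. Qed.

End IntegralMorphism.

Lemma omorE : omor (in_alg E).
Proof. by split=> [||x y _ _|x y _ _]; rewrite ?rmorph0 ?rmorph1 ?rmorphD ?rmorphM. Qed.

Lemma omorF : omor (red D \o in_alg E).
Proof.
split=> [||x y hx hy|x y hx hy] /=.
- by rewrite scale0r red0.
- by rewrite scale1r red1.
- by rewrite scalerDl redD.
- by rewrite -in_algE rmorphM /= redM.
Qed.

(** A representative of the coset KZ g. The set from which it is chosen depends on the coset only,
    and hence so does the choice. *)
Definition rep g : 'M[L]_2 := xget 0 [set x | exists2 h, inKZ D h & x = h *m g].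

Lemma repP g : exists2 h, inKZ D h & rep g = h *m g.
Proof.
rewrite /rep; case: xgetP => [x _ [h hK xE]|]; first by exists h.
by move=> /(_ g); case; exists 1%:M; [exact: inKZ1 | rewrite mul1mx].
Qed.

Lemma rep_mul h g : inKZ D h -> rep (h *m g) = rep g.
Proof.
move=> hK; rewrite /rep; congr xget; apply/seteqP; split=> x [h' h'K ->].
  by exists (h' *m h); [exact: inKZM | rewrite mulmxA].
exists (h' *m invmx h); first by apply: inKZM => //; exact: inKZV.
by rewrite -mulmxA mulKmx // inKZ_unit.
Qed.

Lemma rep_rep g : rep (rep g) = rep g.
Proof. by have [h hK rE] := repP g; rewrite {1}rE rep_mul. Qed.

Section Brackets.
Variables (R : nzRingType) (W : lmodType R) (act : 'M[L]_2 -> W -> W) (S : W -> Prop).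
Hypothesis act1 : forall w, act 1%:M w = w.
Hypothesis actM : forall h h' w, inKZ D h -> inKZ D h' -> act (h *m h') w = act h (act h' w).
Hypothesis actZD : forall h a w w', act h (a *: w + w') = a *: act h w + act h w'.
Hypothesis S0 : S 0.
Hypothesis SZD : forall a w w', S w -> S w' -> S (a *: w + w').
Hypothesis Sact : forall h w, inKZ D h -> S w -> S (act h w).
Local Notation br := (bracket D act).

Lemma act0 h : act h 0 = 0.
Proof. by have := actZD h (-1) 0 0; rewrite scaleN1r oppr0 addr0 scaleN1r addNr. Qed.

Lemma bracketZD g a w w' : br g (a *: w + w') = a *: br g w + br g w'.
Proof.
apply/funext => x; rewrite /bracket !fctE /=; case: ifP => _ //.
by rewrite scaler0 addr0.
Qed.

Lemma bracket0 g : br g 0 = 0.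
Proof. by apply/funext => x; rewrite /bracket act0 if_same. Qed.

Lemma bracket_act g h w : inKZ D h -> br (g *m h) w = br g (act h w).
Proof.
move=> hK; apply/funext => x; rewrite /bracket mulmxA.
have -> : `[< inKZ D (x *m g *m h) >] = `[< inKZ D (x *m g) >].
  by apply/asbool_equiv_eq/inKZMr.
by case: asboolP => // xgK; rewrite actM.
Qed.

Lemma ind_bracket g w : g \in unitmx -> S w -> ind D act S (br g w).
Proof.
move=> gu Sw; split=> [x|x xu|h x hK xu|].
- by rewrite /bracket; case: asboolP => // ?; exact: Sact.
- rewrite /bracket; case: asboolP => // /inKZ_unit.
  by rewrite unitmx_mul (negPf xu).
- rewrite /bracket -mulmxA; case: asboolP => [/(inKZMl _ hK) xgK|nK].
    by rewrite asboolT // actM.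
  by rewrite asboolF ?act0 // => xgK; apply: nK; exact/inKZMl.
- exists [:: invmx g] => x; rewrite /bracket; case: asboolP => [xgK _|]; last by rewrite eqxx.
  by exists (x *m g), (invmx g); rewrite inE eqxx mulmxK.
Qed.

Lemma indZD a f f' : ind D act S f -> ind D act S f' -> ind D act S (a *: f + f').
Proof.
case=> f1 f2 f3 [s f4] [f1' f2' f3' [s' f4']]; split=> [x|x xu|h x hK xu|].
- exact: SZD.
- by rewrite !fctE /= f2 // f2' // scaler0 addr0.
- by rewrite !fctE /= f3 // f3' // actZD.
- exists (s ++ s') => x; rewrite !fctE /=; have [fx|/f4] := eqVneq (f x) 0.
    rewrite fx scaler0 add0r => /f4' [h [y [? ? ?]]].
    by exists h, y; rewrite mem_cat orbC; split=> //; apply/orP; left.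
  by move=> [h [y [? ys ?]]] _; exists h, y; rewrite mem_cat ys.
Qed.

Lemma ind0 : ind D act S 0.
Proof.
split=> [x|x _|h x _ _|]; rewrite ?fctE ?act0 //.
by exists [::] => x; rewrite eqxx.
Qed.

Lemma ind_sum (I : Type) (r : seq I) (C : pred I) (F : I -> 'M[L]_2 -> W) :
  (forall i, C i -> ind D act S (F i)) -> ind D act S (\sum_(i <- r | C i) F i).
Proof.
move=> hF; elim/big_ind: _ => //; first exact: ind0.
by move=> f f' hf hf'; rewrite -[f]scale1r; exact: indZD.
Qed.

(** A finite list of coset representatives that meets every coset in the support of f. It may be
    larger than the support, so that two functions can share one list. *)
Definition covers (s : seq 'M[L]_2) (f : 'M[L]_2 -> W) :=
  [/\ uniq s, forall x, x \in s -> x \in unitmx /\ rep x = x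
    & forall x, x \in unitmx -> rep x = x -> f x != 0 -> x \in s].

Lemma coversP f : ind D act S f -> exists s, covers s f.
Proof.
case=> _ _ _ [s hs]; exists (undup (map rep (filter (mem unitmx) s))).
split=> [|x|x xu rx /hs [h [y [hK ys xE]]]]; first exact: undup_uniq.
  rewrite mem_undup => /mapP[y]; rewrite mem_filter => /andP[yu _] ->.
  split; last exact: rep_rep.
  by have [h hK ->] := repP y; rewrite unitmx_mul inKZ_unit.
rewrite mem_undup -rx xE rep_mul //; apply/map_f; rewrite mem_filter ys andbT.
by move: xu; rewrite xE unitmx_mul => /andP[].
Qed.

(** [x^-1, w] is supported on the coset KZ x and takes the value w at x. *)
Lemma ind_decomp s f : ind D act S f -> covers s f ->
  f = \sum_(x <- s) br (invmx x) (f x).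
Proof.
case=> _ f2 f3 _ [us sr cs]; apply/funext => g; rewrite fct_sumE.
have [gu|gu] := boolP (g \in unitmx); last first.
  rewrite f2 // big1_seq // => x /andP[_ xs]; rewrite /bracket; case: asboolP => //.
  by move=> /inKZ_unit; rewrite unitmx_mul (negPf gu).
have [h hK gE] := repP g; have hu := inKZ_unit hK.
have rgu : rep g \in unitmx by rewrite gE unitmx_mul hu.
have fE : f g = act (invmx h) (f (rep g)).
  by have hVK := inKZV hK; rewrite -f3 // gE mulKmx.
have brx x : x \in s -> x != rep g -> br (invmx x) (f x) g = 0.
  move=> /sr[xu rx]; rewrite /bracket => xr; case: asboolP => // gxK.
  by case/eqP: xr; rewrite -rx -[g in RHS](mulmxKV xu) rep_mul.
have [rs|rs] := boolP (rep g \in s); last first.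
  rewrite big1_seq => [|x /andP[_ xs]]; last first.
    by apply: brx => //; apply: contraNneq rs => <-.
  rewrite fE; have [->|/(cs _ rgu (rep_rep g))] := eqVneq (f (rep g)) 0; first exact: act0.
  by rewrite (negPf rs).
rewrite (bigD1_seq (rep g)) //= big1_seq ?addr0 => [|x /andP[xr xs]]; last exact: brx.
have ghE : g *m invmx (rep g) = invmx h.
  by rewrite {1}(_ : g = invmx h *m rep g) ?mulmxK // gE mulKmx.
by rewrite /bracket ghE asboolT //; exact: inKZV.
Qed.

Lemma covers_sum (V : zmodType) s s' f (G : 'M[L]_2 -> W -> V) :
  (forall x, G x 0 = 0) -> covers s f -> covers s' f ->
  \sum_(x <- s) G x (f x) = \sum_(x <- s') G x (f x).
Proof.
move=> G0 [us sr cs] [us' sr' cs'].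
rewrite (bigID (fun x => f x != 0)) /= [X in _ + X]big1 ?addr0; last first.
  by move=> x /negPn/eqP ->.
rewrite [RHS](bigID (fun x => f x != 0)) /= [X in _ = _ + X]big1 ?addr0; last first.
  by move=> x /negPn/eqP ->.
rewrite -!(big_filter _ (fun x => f x != 0)); apply/perm_big/uniq_perm; rewrite ?filter_uniq //.
move=> x; rewrite !mem_filter; case fx: (f x != 0) => //=.
by apply/idP/idP => [/sr|/sr'] [xu rx]; [exact: cs' | exact: cs].
Qed.

Lemma covers2 f f' : ind D act S f -> ind D act S f' ->
  exists s, covers s f /\ covers s f'.
Proof.
move=> /coversP[s [us sr cs]] /coversP[s' [us' sr' cs']].
exists (undup (s ++ s')); split; (split; first exact: undup_uniq).
- by move=> x; rewrite mem_undup mem_cat => /orP[/sr|/sr'].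
- by move=> x xu rx fx; rewrite mem_undup mem_cat cs.
- by move=> x; rewrite mem_undup mem_cat => /orP[/sr|/sr'].
- by move=> x xu rx fx; rewrite mem_undup mem_cat cs' ?orbT.
Qed.

End Brackets.
End Groups.

(** * The natural map to ThetaBar *)

Section NaturalMap.
Variables (p : nat) (Qp : fieldType) (L : fieldExtType Qp) (E : fieldExtType L).
Variables (Fq : finFieldType) (Fbar : closedFieldType).
Variable D : padic_setting p E Fq Fbar.
Hypothesis p_prime : prime p.
Variables (r0 r1 : nat) (ap : E).
Local Notation v := (v D).
Local Notation red := (red D).
Local Notation brE := (bracket D (KZactE D)).
Local Notation brF := (bracket D (KZactF D)).
Local Notation indVO := (indVO D r0 r1).
Local Notation indVE := (indVE D r0 r1).
Local Notation indVr := (indVr D r0 r1).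
Local Notation heckeE := (heckeE D r0 r1).
Implicit Types (g h : 'M[L]_2) (P : {mpoly E[4]}) (S : {mpoly Fbar[4]}).

Lemma actEM h h' P : inKZ D h -> inKZ D h' -> KZactE D (h *m h') P = KZactE D h (KZactE D h' P).
Proof. by apply: KZactM => //; exact: omorE. Qed.
Lemma actFM h h' S : inKZ D h -> inKZ D h' -> KZactF D (h *m h') S = KZactF D h (KZactF D h' S).
Proof. by apply: KZactM => //; exact: omorF. Qed.
Lemma actEZD h a P P' : KZactE D h (a *: P + P') = a *: KZactE D h P + KZactE D h P'.
Proof. exact: KZactZD. Qed.
Lemma actFZD h a S S' : KZactF D h (a *: S + S') = a *: KZactF D h S + KZactF D h S'.
Proof. exact: KZactZD. Qed.
Lemma actEhom h P : inKZ D h -> bihomog r0 r1 P -> bihomog r0 r1 (KZactE D h P).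
Proof. by move=> _; exact: KZact_bihomog. Qed.
Lemma actFhom h S : inKZ D h -> bihomog r0 r1 S -> bihomog r0 r1 (KZactF D h S).
Proof. by move=> _; exact: KZact_bihomog. Qed.

Definition homE0 := @bihomog0 E r0 r1.
Definition homF0 := @bihomog0 Fbar r0 r1.
Definition homEZD := @bihomogZD E r0 r1.
Definition homFZD := @bihomogZD Fbar r0 r1.

Lemma brEZD g a P P' : brE g (a *: P + P') = a *: brE g P + brE g P'.
Proof. exact: bracketZD actEZD g a P P'. Qed.
Lemma brFZD g a S S' : brF g (a *: S + S') = a *: brF g S + brF g S'.
Proof. exact: bracketZD actFZD g a S S'. Qed.
Lemma brE0 g : brE g 0 = 0. Proof. exact: bracket0 actEZD g. Qed.
Lemma brF0 g : brF g 0 = 0. Proof. exact: bracket0 actFZD g. Qed.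
Lemma brED g P P' : brE g (P + P') = brE g P + brE g P'.
Proof. by have := brEZD g 1 P P'; rewrite !scale1r. Qed.
Lemma brEZ g a P : brE g (a *: P) = a *: brE g P.
Proof. by have := brEZD g a P 0; rewrite brE0 !addr0. Qed.
Lemma brE_sum g (I : Type) (r : seq I) (C : pred I) (F : I -> {mpoly E[4]}) :
  brE g (\sum_(i <- r | C i) F i) = \sum_(i <- r | C i) brE g (F i).
Proof. by elim/big_rec2: _ => [|i y x _ <-]; rewrite ?brE0 ?brED. Qed.
Lemma brE_act g h P : inKZ D h -> brE (g *m h) P = brE g (KZactE D h P).
Proof. by move=> hK; apply: bracket_act => // *; exact: actEM. Qed.
Lemma brF_act g h S : inKZ D h -> brF (g *m h) S = brF g (KZactF D h S).
Proof. by move=> hK; apply: bracket_act => // *; exact: actFM. Qed.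

Lemma indVE_br g P : g \in unitmx -> bihomog r0 r1 P -> indVE (brE g P).
Proof.
move=> gu hP; apply: (ind_bracket p_prime) => //;
  [exact: actEM | exact: actEZD | exact: homE0 | exact: actEhom].
Qed.
Lemma indVr_br g S : g \in unitmx -> bihomog r0 r1 S -> indVr (brF g S).
Proof.
move=> gu hS; apply: (ind_bracket p_prime) => //;
  [exact: actFM | exact: actFZD | exact: homF0 | exact: actFhom].
Qed.
Lemma indVEZD a f f' : indVE f -> indVE f' -> indVE (a *: f + f').
Proof. exact: indZD actEZD homEZD a f f'. Qed.
Lemma indVrZD a f f' : indVr f -> indVr f' -> indVr (a *: f + f').
Proof. exact: indZD actFZD homFZD a f f'. Qed.
Lemma indVE0 : indVE 0. Proof. exact: ind0 actEZD homE0. Qed.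
Lemma indVr0 : indVr 0. Proof. exact: ind0 actFZD homF0. Qed.
Lemma indVr_sum (I : Type) (r : seq I) (C : pred I) (F : I -> 'M[L]_2 -> {mpoly Fbar[4]}) :
  (forall i, C i -> indVr (F i)) -> indVr (\sum_(i <- r | C i) F i).
Proof. exact: ind_sum actFZD homF0 homFZD I r C F. Qed.

Lemma KZact_rd s0 s1 h P S : inKZ D h -> bihomog s0 s1 P -> rd D P S ->
  rd D (KZactE D h P) (KZactF D h S).
Proof.
case=> k hk hP hPS; rewrite /KZactE /KZactF !(KZact_dec p_prime _ _ hk).
have [[ki _] _] := hk.
by apply: (rd_subst hP _ _ hPS) => i j; rewrite !mxE /=; split=> //; exact: sigma_int.
Qed.

Lemma brE_rd g P S x : bihomog r0 r1 P -> rd D P S -> rd D (brE g P x) (brF g S x).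
Proof.
move=> hP hPS; rewrite /bracket; case: asboolP => hK; last exact: rd0.
exact: KZact_rd hP hPS.
Qed.

Lemma indVO_br g P : g \in unitmx -> bihomog r0 r1 P -> pge D 0 P -> indVO (brE g P).
Proof.
move=> gu hP iP; split; first exact: indVE_br.
by move=> x u; case: (brE_rd g x hP (pge_rd iP) u).
Qed.

Lemma indVO0 : indVO 0.
Proof. by split=> [|g u]; [exact: indVE0 | rewrite mcoeff0 vge0]. Qed.

Lemma indVOZD c F F' : vge v 0 c -> indVO F -> indVO F' -> indVO (c *: F + F').
Proof.
move=> hc [F1 F2] [F1' F2']; split; first exact: indVEZD.
by move=> g u; rewrite !fctE /= mcoeffD mcoeffZ vgeD // intM.
Qed.

Lemma indVOD F F' : indVO F -> indVO F' -> indVO (F + F').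
Proof. by move=> hF hF'; rewrite -[F]scale1r; apply: indVOZD => //; exact: int1. Qed.

Lemma indVOZ c F : vge v 0 c -> indVO F -> indVO (c *: F).
Proof. by move=> hc hF; rewrite -[c *: F]addr0; apply: indVOZD => //; exact: indVO0. Qed.

Lemma indVO_sum (I : Type) (r : seq I) (C : pred I) (F : I -> 'M[L]_2 -> {mpoly E[4]}) :
  (forall i, C i -> indVO (F i)) -> indVO (\sum_(i <- r | C i) F i).
Proof. by move=> hF; elim/big_ind: _ => //; [exact: indVO0 | exact: indVOD]. Qed.

Local Notation Theta := (Theta D r0 r1 ap).
Local Notation ThetaBar := (ThetaBar D r0 r1 ap).
Local Notation to_coker := (to_coker D r0 r1 ap).

Lemma Theta_ex F : indVO F -> `[< inTheta (to_coker F) >].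
Proof. by move=> hF; apply/asboolP; exists F. Qed.

(** The class of an integral F in ThetaBar, made total by the value 0 at the other F. *)
Definition tau (F : 'M[L]_2 -> {mpoly E[4]}) : ThetaBar :=
  if pselect (indVO F) is left hF then tensor1 (exist _ (to_coker F) (Theta_ex hF) : Theta)
  else 0.

Lemma tauE F (x : Theta) : indVO F -> val x = to_coker F -> tau F = tensor1 x.
Proof.
move=> hF xF; rewrite /tau; case: pselect => // hF'; congr tensor1.
by apply: val_inj; rewrite xF.
Qed.

Definition toTheta F (hF : indVO F) : Theta := exist _ (to_coker F) (Theta_ex hF).

Lemma tau_toTheta F (hF : indVO F) : tau F = tensor1 (toTheta hF).
Proof. exact: tauE. Qed.

Lemma tau_coker F F' : indVO F -> indVO F' -> to_coker F = to_coker F' -> tau F = tau F'.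
Proof. by move=> hF hF' FF'; rewrite (tau_toTheta hF') (@tauE F (toTheta hF')). Qed.

Lemma tauD F F' : indVO F -> indVO F' -> tau (F + F') = tau F + tau F'.
Proof.
move=> hF hF'; have hS := indVOD hF hF'.
rewrite (tau_toTheta hF) (tau_toTheta hF') (tau_toTheta hS).
rewrite /tensor1 -linearD /=; apply/projP; apply: span_gen; left.
exists (toTheta hF), (toTheta hF'), (toTheta hS); split; last by rewrite opprD addrA.
by rewrite /= /Defs.to_coker linearD.
Qed.

Lemma tauZ c F : vge v 0 c -> indVO F -> tau (c *: F) = red c *: tau F.
Proof.
move=> hc hF; have hS := indVOZ hc hF.
rewrite (tau_toTheta hF) (tau_toTheta hS).
rewrite /tensor1 -linearZ /=; apply/projP; apply: span_gen; right.
exists c, (toTheta hF), (toTheta hS); split=> //.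
by rewrite /= /Defs.to_coker linearZ.
Qed.

Lemma tau0 : tau 0 = 0.
Proof. by rewrite -(scale0r 0) tauZ ?vge0 ?red0 ?scale0r //; exact: indVO0. Qed.

Lemma tau_sum (I : Type) (r : seq I) (C : pred I) (F : I -> 'M[L]_2 -> {mpoly E[4]}) :
  (forall i, C i -> indVO (F i)) ->
  tau (\sum_(i <- r | C i) F i) = \sum_(i <- r | C i) tau (F i).
Proof.
move=> hF; elim: r => [|i r IH]; rewrite ?big_nil ?tau0 // !big_cons.
by case: ifP => // Ci; rewrite tauD; [rewrite IH | exact: hF | exact: indVO_sum].
Qed.

Lemma heckeEZD a (f h f' h' : 'M[L]_2 -> {mpoly E[4]}) :
  heckeE f h -> heckeE f' h' -> heckeE (a *: f + f') (a *: h + h').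
Proof.
move=> H H'; rewrite /heckeE (_ : (_, _) = a *: (f, h) + (f', h')) //.
by apply: spanD H'; exact: spanZ.
Qed.

Lemma heckeE0 : heckeE 0 0. Proof. exact: span0. Qed.

Lemma heckeEZ a (f h : 'M[L]_2 -> {mpoly E[4]}) : heckeE f h -> heckeE (a *: f) (a *: h).
Proof. by move=> H; rewrite -[a *: f]addr0 -[a *: h]addr0; apply: heckeEZD => //; exact: heckeE0. Qed.

Lemma heckeE_sum (I : Type) (r : seq I) (C : pred I) (c : I -> E)
    (F G : I -> 'M[L]_2 -> {mpoly E[4]}) :
  (forall i, C i -> heckeE (F i) (G i)) ->
  heckeE (\sum_(i <- r | C i) c i *: F i) (\sum_(i <- r | C i) c i *: G i).
Proof.
move=> hF; elim/big_rec2: _ => [|i y x Ci H]; first exact: heckeE0.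
by apply: heckeEZD => //; exact: hF.
Qed.

(** Modulo the image of T - a_p the function F is c F', and c reduces to 0. Here f itself need not
    be integral, which allows denominators p and a_p. *)
Lemma tau_kill F (f h : 'M[L]_2 -> {mpoly E[4]}) c F' :
  indVO F -> heckeE f h -> F = h - ap *: f + c *: F' ->
  indVO F' -> vgt v 0 c -> tau F = 0.
Proof.
move=> hF hfh FE hF' hc; have ic := vgt_vge (lexx 0) hc.
rewrite (tau_coker (F' := c *: F')) //; last 2 first.
- exact: indVOZ.
- apply/projP; rewrite FE addrK; apply: span_gen; by exists f, h.
by rewrite tauZ // red_vgt // scale0r.
Qed.

(** Monomials have evident integral lifts, so defining the map through the monomial basis makes it
    linear by construction; [nu0_rd] shows that any other integral lift gives the same class. *)
Definition nu0 g S : ThetaBar :=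
  \sum_(i < r0.+1) \sum_(j < r1.+1) S@_(mnmY r0 r1 i j) *: tau (brE g (monY E r0 r1 i j)).

Lemma nu0ZD g a S S' : nu0 g (a *: S + S') = a *: nu0 g S + nu0 g S'.
Proof.
rewrite /nu0 scaler_sumr -big_split /=; apply: eq_bigr => i _.
rewrite scaler_sumr -big_split /=; apply: eq_bigr => j _.
by rewrite mcoeffD mcoeffZ scalerDl scalerA.
Qed.

Lemma nu00 g : nu0 g 0 = 0.
Proof. by rewrite /nu0 big1 // => i _; rewrite big1 // => j _; rewrite mcoeff0 scale0r. Qed.

Lemma nu0_rd g P S : g \in unitmx -> bihomog r0 r1 P -> rd D P S -> nu0 g S = tau (brE g P).
Proof.
move=> gu hP hPS; rewrite [in RHS](bihomog_decomp hP) brE_sum.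
have hm (i : 'I_r0.+1) (j : 'I_r1.+1) : indVO (brE g (monY E r0 r1 i j)).
  apply: indVO_br => //; first by apply: bihomog_monY; rewrite -ltnS.
  exact: rd_pge (rd_monY D r0 r1 i j).
have ic u : vge v 0 P@_u by case: (hPS u).
have hmZ (i : 'I_r0.+1) (j : 'I_r1.+1) u : indVO (brE g (P@_u *: monY E r0 r1 i j)).
  by rewrite brEZ; exact: indVOZ.
rewrite tau_sum => [|i _]; last by rewrite brE_sum; apply: indVO_sum.
apply: eq_bigr => i _; rewrite brE_sum tau_sum //; apply: eq_bigr => j _.
by rewrite brEZ tauZ //; case: (hPS (mnmY r0 r1 i j)) => _ ->.
Qed.

(** Apply [nu0] to each bracket [x^-1, f x] in the decomposition of f; by [nat_mapE] the choice of
    the cover does not matter. *)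
Definition nat_map (f : 'M[L]_2 -> {mpoly Fbar[4]}) : ThetaBar :=
  \sum_(x <- xget [::] [set s | covers D s f]) nu0 (invmx x) (f x).

Lemma nat_mapE s f : covers D s f -> nat_map f = \sum_(x <- s) nu0 (invmx x) (f x).
Proof.
move=> hs; rewrite /nat_map; case: xgetP => [s' _ hs'|/(_ s) //].
by apply: (covers_sum (G := fun x => nu0 (invmx x))) hs' hs => x; exact: nu00.
Qed.

Lemma nat_mapZD a f f' : indVr f -> indVr f' ->
  nat_map (a *: f + f') = a *: nat_map f + nat_map f'.
Proof.
move=> hf hf'; have [s [sf sf']] := covers2 p_prime hf hf'.
have sff : covers D s (a *: f + f').
  case: sf sf' => us sr cs [_ _ cs']; split=> // x xu rx; rewrite !fctE /=.
  have [fx|fx _] := eqVneq (f x) 0; last exact: cs.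
  by rewrite fx scaler0 add0r; exact: cs'.
rewrite (nat_mapE sf) (nat_mapE sf') (nat_mapE sff) scaler_sumr -big_split /=.
by apply: eq_bigr => x _; rewrite nu0ZD.
Qed.

Lemma nat_map_red F : indVO F -> nat_map (fun g => map_mpoly red (F g)) = tau F.
Proof.
move=> hF; have [hFE iF] := hF; have [s hs] := coversP p_prime hFE.
have hs' : covers D s (fun g => map_mpoly red (F g)).
  case: hs => us sr cs; split=> // x xu rx fx; apply: cs => //.
  apply: contraNneq fx => ->.
  by apply/eqP/mpolyP => u; rewrite mcoeff_map_red !mcoeff0 red0.
rewrite (nat_mapE hs') [in RHS](ind_decomp p_prime actEZD hFE hs).
have [_ sr _] := hs; have [hh _ _ _] := hFE.
have hx x : x \in s -> indVO (brE (invmx x) (F x)).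
  by move=> /sr[xu _]; apply: indVO_br; [rewrite unitmx_inv | exact: hh | exact: iF].
rewrite big_seq [in RHS]big_seq tau_sum //; apply: eq_bigr => x /sr[xu _].
by apply: nu0_rd; [rewrite unitmx_inv | exact: hh | exact/pge_rd/iF].
Qed.

Lemma natural_nat_map : natural_surjection nat_map.
Proof.
split=> [a f h|F x hF xF]; first exact: nat_mapZD.
by rewrite nat_map_red //; exact: tauE.
Qed.

Lemma nat_map0 : nat_map 0 = 0.
Proof.
have := nat_mapZD (-1) indVr0 indVr0.
by rewrite scaleN1r oppr0 addr0 scaleN1r addNr.
Qed.

Lemma nat_mapD f f' : indVr f -> indVr f' -> nat_map (f + f') = nat_map f + nat_map f'.
Proof. by move=> hf hf'; have := nat_mapZD 1 hf hf'; rewrite !scale1r. Qed.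

Lemma nat_map_sum (I : Type) (r : seq I) (C : pred I) (F : I -> 'M[L]_2 -> {mpoly Fbar[4]}) :
  (forall i, C i -> indVr (F i)) ->
  nat_map (\sum_(i <- r | C i) F i) = \sum_(i <- r | C i) nat_map (F i).
Proof.
move=> hF; elim: r => [|i r IH]; rewrite ?big_nil ?nat_map0 // !big_cons.
by case: ifP => // Ci; rewrite nat_mapD; [rewrite IH | exact: hF | exact: indVr_sum].
Qed.

Definition nu g S := nat_map (brF g S).

Lemma nuZD g a S S' : g \in unitmx -> bihomog r0 r1 S -> bihomog r0 r1 S' ->
  nu g (a *: S + S') = a *: nu g S + nu g S'.
Proof. by move=> gu hS hS'; rewrite /nu brFZD nat_mapZD //; exact: indVr_br. Qed.

Lemma nu_0 g : nu g 0 = 0. Proof. by rewrite /nu brF0 nat_map0. Qed.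

Lemma nuZ g a S : g \in unitmx -> bihomog r0 r1 S -> nu g (a *: S) = a *: nu g S.
Proof.
by move=> gu hS; have := nuZD a gu hS (@bihomog0 Fbar r0 r1); rewrite nu_0 !addr0.
Qed.

Lemma nuD g S S' : g \in unitmx -> bihomog r0 r1 S -> bihomog r0 r1 S' ->
  nu g (S + S') = nu g S + nu g S'.
Proof. by move=> gu hS hS'; have := nuZD 1 gu hS hS'; rewrite !scale1r. Qed.

Lemma nu_act g h S : inKZ D h -> nu g (KZactF D h S) = nu (g *m h) S.
Proof. by move=> hK; rewrite /nu brF_act. Qed.

Lemma nu_rd g P S : g \in unitmx -> bihomog r0 r1 P -> rd D P S -> nu g S = tau (brE g P).
Proof.
move=> gu hP hPS; rewrite -nat_map_red; last exact: indVO_br gu hP (rd_pge hPS).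
congr nat_map; apply/funext => x; apply/esym/(@rd_map _ _ _ _ _ _ D); exact: brE_rd.
Qed.

End NaturalMap.

(** * Relations in ThetaBar coming from T *)

Section TwoByTwo.
Variable R : comNzRingType.
Implicit Types a b c d : R.

Lemma mx2E a b c d : (mx2 a b c d 0 0 = a) * (mx2 a b c d 0 1 = b) *
  (mx2 a b c d 1 0 = c) * (mx2 a b c d 1 1 = d).
Proof. by rewrite !mxE. Qed.

Lemma mx2P (m m' : 'M[R]_2) : m 0 0 = m' 0 0 -> m 0 1 = m' 0 1 ->
  m 1 0 = m' 1 0 -> m 1 1 = m' 1 1 -> m = m'.
Proof.
move=> h00 h01 h10 h11; apply/matrixP => i j.
have ordE (k : 'I_2) : k = 0 \/ k = 1.
  by case: k => [[|[|//]] hk]; [left | right]; apply: val_inj.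
by case: (ordE i) => ->; case: (ordE j) => ->.
Qed.

Lemma mx2M a b c d a' b' c' d' : mx2 a b c d *m mx2 a' b' c' d' =
  mx2 (a * a' + b * c') (a * b' + b * d') (c * a' + d * c') (c * b' + d * d').
Proof. by apply: mx2P; rewrite mulmx2E !mx2E. Qed.

Lemma det_mx2 a b c d : \det (mx2 a b c d) = a * d - b * c.
Proof.
rewrite (expand_det_row _ 0) !big_ord_recl big_ord0 addr0 /cofactor !det_mx11 !mxE /=.
by rewrite expr0 expr1 !mul1r; ring.
Qed.

Lemma map_mx2 (S : nzRingType) (f : R -> S) a b c d :
  map_mx f (mx2 a b c d) = mx2 (f a) (f b) (f c) (f d).
Proof. by apply/matrixP => i j; rewrite !mxE; do 2!case: ifP. Qed.

Lemma frobD p (x y : R) : p \in [pchar R] -> (x + y) ^+ p = x ^+ p + y ^+ p.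
Proof. by move=> chp; exact: (pFrobenius_autD_comm chp (mulrC x y)). Qed.

End TwoByTwo.

(** * Congruences modulo p and p^2 for products of powers of linear forms *)

Section Congruences.
Variables (p : nat) (Qp : fieldType) (L : fieldExtType Qp) (E : fieldExtType L).
Variables (Fq : finFieldType) (Fbar : closedFieldType).
Variable D : padic_setting p E Fq Fbar.
Hypothesis p_prime : prime p.
Local Notation v := (v D).
Local Notation red := (red D).
Local Notation pge := (pge D).
Local Notation pi := (p%:R : E).
Implicit Types (P Q a c : {mpoly E[4]}).

Lemma pge_le e e' P : e <= e' -> pge e' P -> pge e P.
Proof. by move=> ee' hP u; apply: vge_le ee' (hP u). Qed.
Lemma pgeN e P : pge e P -> pge e (- P).
Proof. by move=> hP u; rewrite mcoeffN vgeN. Qed.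
Lemma pgeMl e P Q : pge 0 P -> pge e Q -> pge e (P * Q).
Proof. by move=> hP hQ; rewrite -[e]add0r; exact: pgeM. Qed.
Lemma pgeZ0 e (k : E) P : vge v 0 k -> pge e P -> pge e (k *: P).
Proof. by move=> hk hP; rewrite -[e]add0r; exact: pgeZ. Qed.
Lemma pge_int n : pge 0 n%:R.
Proof.
elim: n => [|n IH]; first exact: pge0.
by rewrite mulrS; apply: pgeD => //; exact: rd_pge (rd1 D).
Qed.
Lemma pgeX0 P n : pge 0 P -> pge 0 (P ^+ n).
Proof. by move=> hP; apply: rd_pge (rdXn n (pge_rd hP)). Qed.
Lemma pge_var i : pge 0 'X_i. Proof. exact: rd_pge (rdX D i). Qed.
Lemma pge_pi e P : pge e P -> pge (1 + e) (pi *: P).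
Proof. by apply: pgeZ; exact: vgep. Qed.
Lemma pge_div P : pge 1 P -> pge 0 (pi^-1 *: P).
Proof.
move=> hP; have -> : 0 = -1 + 1 :> rat by rewrite addNr.
by apply: pgeZ => //; rewrite /vge v_inv ?val_p ?lexx ?orbT // (pE_neq0 D p_prime).
Qed.

(** The binomial expansion to first order in c, by induction on n. For n = 0 the truncated [n.-1] is
    harmless because of the factor n. *)
Lemma pge_exp2 a c n : pge 0 a -> pge 1 c ->
  pge 2 ((a + c) ^+ n - (a ^+ n + n%:R * (a ^+ n.-1 * c))).
Proof.
move=> ha hc; have hc0 : pge 0 c by apply: pge_le hc.
elim: n => [|n IH]; first by rewrite !expr0 mul0r addr0 subrr; exact: pge0.
rewrite (_ : _ - _ = (a + c) * ((a + c) ^+ n - (a ^+ n + n%:R * (a ^+ n.-1 * c)))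
   + n%:R * a ^+ n.-1 * (c * c)); last first.
  case: n {IH} => [|n] /=; rewrite !exprS ?expr0; ring.
apply: pgeD; first by apply: pgeMl IH; exact: pgeD.
apply: pgeMl; first by apply: (pgeMl (pge_int n)); exact: pgeX0.
exact: (@pgeM _ _ _ _ _ _ D 1 1).
Qed.

Lemma pge_exp1 a c n : pge 0 a -> pge 1 c -> pge 1 ((a + c) ^+ n - a ^+ n).
Proof.
move=> ha hc; rewrite (_ : _ - _ = ((a + c) ^+ n - (a ^+ n + n%:R * (a ^+ n.-1 * c)))
  + n%:R * (a ^+ n.-1 * c)); last by ring.
apply: pgeD; first by apply: (@pge_le 1 2) => //; exact: pge_exp2.
by apply: (pgeMl (pge_int n)); apply: pgeMl => //; exact: pgeX0.
Qed.

Lemma pge_congrM e P P' Q Q' : pge 0 P -> pge 0 Q' -> pge e (P - P') -> pge e (Q - Q') ->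
  pge e (P * Q - P' * Q').
Proof.
move=> hP hQ' hPP hQQ; rewrite (_ : _ - _ = P * (Q - Q') + Q' * (P - P')); last by ring.
by apply: pgeD; exact: pgeMl.
Qed.

Lemma pge_lin2 (x y x' y' : {mpoly E[4]}) (d d' e e' : E) m n :
  pge 0 x -> pge 0 y -> pge 0 x' -> pge 0 y' ->
  vge v 0 d -> vge v 0 d' -> vge v 0 e -> vge v 0 e' ->
  pge 2 ((d *: x + (pi * e) *: y) ^+ m * (d' *: x' + (pi * e') *: y') ^+ n -
    ((d ^+ m * d' ^+ n) *: (x ^+ m * x' ^+ n) +
     pi *: ((m%:R * (d ^+ m.-1 * d' ^+ n * e)) *: (x ^+ m.-1 * y * x' ^+ n) +
            (n%:R * (d ^+ m * d' ^+ n.-1 * e')) *: (x ^+ m * (x' ^+ n.-1 * y'))))).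
Proof.
move=> hx hy hx' hy' hd hd' he he'.
have ha := pgeZ0 hd hx; have ha' := pgeZ0 hd' hx'.
have hc : pge 1 ((pi * e) *: y).
  by rewrite -scalerA -[1 : rat]addr0; apply/pge_pi/pgeZ0.
have hc' : pge 1 ((pi * e') *: y').
  by rewrite -scalerA -[1 : rat]addr0; apply/pge_pi/pgeZ0.
set a := d *: x in ha *; set a' := d' *: x' in ha' *.
set c := _ *: y in hc *; set c' := _ *: y' in hc' *.
rewrite (_ : _ - _ =
  ((a + c) ^+ m * (a' + c') ^+ n -
   (a ^+ m + m%:R * (a ^+ m.-1 * c)) * (a' ^+ n + n%:R * (a' ^+ n.-1 * c')))
  + (m%:R * a ^+ m.-1 * (n%:R * a' ^+ n.-1)) * (c * c')); last first.
  rewrite /a /a' /c /c' !exprZn -!mul_mpolyC !(rmorphM, rmorphXn, rmorphD, rmorph_nat) /=.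
  ring.
apply: pgeD.
  apply: pge_congrM; [| |exact: pge_exp2|exact: pge_exp2].
    by apply/pgeX0/pgeD => //; apply: pge_le hc.
  apply: pgeD; first exact: pgeX0.
  by apply: (pgeMl (pge_int n)); apply: pgeMl; [exact: pgeX0 | apply: pge_le hc'].
apply: pgeMl; last exact: (@pgeM _ _ _ _ _ _ D 1 1).
by apply: pgeMl; apply: pgeMl; rewrite ?pge_int //; apply: pgeX0 || exact: pge_int.
Qed.

(** Each product is expanded to first order in p and divided by p. The part of order 0 leaves A / p,
    whence the condition on A; the part of order 1 leaves the terms with B and C. The variables are
    arbitrary because X and Y exchange roles between [subA] and [subB]. *)
Lemma rd_sum_lin2 (i j k l : 'I_4) m n (c d d' e e' : Fq -> E) :
  (forall t, vge v 0 (c t)) -> (forall t, vge v 0 (d t)) -> (forall t, vge v 0 (d' t)) ->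
  (forall t, vge v 0 (e t)) -> (forall t, vge v 0 (e' t)) ->
  let A := \sum_t c t * (d t ^+ m * d' t ^+ n) in
  let B := \sum_t c t * (d t ^+ m.-1 * d' t ^+ n * e t) in
  let C := \sum_t c t * (d t ^+ m * d' t ^+ n.-1 * e' t) in
  vge v 1 A ->
  rd D (pi^-1 *: \sum_t c t *: ((d t *: 'X_i + (pi * e t) *: 'X_j) ^+ m *
                                (d' t *: 'X_k + (pi * e' t) *: 'X_l) ^+ n))
    (red (pi^-1 * A) *: ('X_i ^+ m * 'X_k ^+ n) +
     ((m%:R * red B) *: ('X_i ^+ m.-1 * 'X_j * 'X_k ^+ n) +
      (n%:R * red C) *: ('X_i ^+ m * ('X_k ^+ n.-1 * 'X_l)))).
Proof.
move=> hc hd hd' he he' A B C hA.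
have p0 := pE_neq0 D p_prime.
set M := _ *: \sum_t _.
pose N : {mpoly E[4]} := (pi^-1 * A) *: ('X_i ^+ m * 'X_k ^+ n) +
     ((m%:R * B) *: ('X_i ^+ m.-1 * 'X_j * 'X_k ^+ n) +
      (n%:R * C) *: ('X_i ^+ m * ('X_k ^+ n.-1 * 'X_l))).
have hMN : pge 1 (M - N).
  (* A congruence modulo p^2 becomes one modulo p after division by p. *)
  have -> : 1 = -1 + 2 :> rat by [].
  rewrite (_ : M - N = pi^-1 *: (\sum_t c t *: (
     ((d t *: 'X_i + (pi * e t) *: 'X_j) ^+ m *
      (d' t *: 'X_k + (pi * e' t) *: 'X_l) ^+ n) -
     ((d t ^+ m * d' t ^+ n) *: ('X_i ^+ m * 'X_k ^+ n) +
      pi *: ((m%:R * (d t ^+ m.-1 * d' t ^+ n * e t)) *: ('X_i ^+ m.-1 * 'X_j * 'X_k ^+ n) +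
            (n%:R * (d t ^+ m * d' t ^+ n.-1 * e' t)) *: ('X_i ^+ m * ('X_k ^+ n.-1 * 'X_l))))))).
    apply: pgeZ; first by rewrite /vge v_inv ?val_p ?lexx ?orbT.
    by apply: pge_sum => t _; apply: pgeZ0 => //; apply: pge_lin2 => //; exact: pge_var.
  under [in RHS]eq_bigr do rewrite scalerBr.
  rewrite sumrB scalerBr; congr (_ - _); rewrite /N.
  under [in RHS]eq_bigr do rewrite !scalerDr !scalerA.
  rewrite !big_split /= -!scaler_suml !scalerDr !scalerA.
  by congr (_ *: _ + (_ *: _ + _ *: _)); rewrite !mulr_sumr; apply: eq_bigr => t _;
    rewrite [in RHS](mulrCA (c t)) mulKf // mulrCA.
have iB : vge v 0 B by apply: vge_sum => t _; rewrite !(intM, intX).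
have iC : vge v 0 C by apply: vge_sum => t _; rewrite !(intM, intX).
have iA : vge v 0 (pi^-1 * A).
  have -> : 0 = -1 + 1 :> rat by [].
  by apply: vgeM => //; rewrite /vge v_inv ?val_p ?lexx ?orbT.
rewrite -[M](subrK N) -[X in rd D _ X]add0r; apply: rdD; first exact: rd_pge1.
rewrite -!(red_nat D) -!redM ?int_nat //.
have imB : vge v 0 (m%:R * B) by apply: intM => //; exact: int_nat.
have inC : vge v 0 (n%:R * C) by apply: intM => //; exact: int_nat.
by apply: rdD; [apply: rdZ iA _ | apply: rdD; [apply: rdZ imB _ | apply: rdZ inC _]];
  repeat first [exact: rdX | apply: rdM | apply: rdXn].
Qed.

End Congruences.

Lemma add_congr (V : zmodType) (a b c d : V) : a = c -> b = d -> a + b = c + d.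
Proof. by move=> -> ->. Qed.

(** * The Hecke operator on brackets and the classes that it kills *)

Section Hecke.
Variables (p : nat) (Qp : fieldType) (L : fieldExtType Qp) (E : fieldExtType L).
Variables (Fq : finFieldType) (Fbar : closedFieldType).
Variable D : padic_setting p E Fq Fbar.
Hypotheses (p_prime : prime p) (p_gt2 : (2 < p)%N).
Variables (r0 r1 : nat) (ap : E).
Hypotheses (ap_neq0 : ap != 0) (ap_val : 2%:R^-1 < v D ap < 1).
Local Notation v := (v D).
Local Notation brE := (bracket D (KZactE D)).
Local Notation indVO := (indVO D r0 r1).
Local Notation heckeE := (heckeE D r0 r1).
Local Notation tau := (tau D r0 r1 ap).
Local Notation pge := (pge D).
Local Notation pi := (p%:R : E).
Local Notation TE := (TE D).
Implicit Types (g h : 'M[L]_2) (P Q : {mpoly E[4]}) (S : {mpoly Fbar[4]}) (l : Fq).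

(* hA, hB, subA and subB are sealed, so that unification never compares their bodies. *)
Fact hA_key : {f : Fq -> 'M[L]_2 | forall l, f l = mx2 p%:R (teich D l) 0 1}.
Proof. by exists (fun l => mx2 p%:R (teich D l) 0 1). Qed.
Definition hA := sval hA_key.
Lemma hAE l : hA l = mx2 p%:R (teich D l) 0 1. Proof. exact: (svalP hA_key). Qed.

Fact hB_key : {f : 'M[L]_2 | f = mx2 1 0 0 p%:R}.
Proof. by exists (mx2 1 0 0 p%:R). Qed.
Definition hB := sval hB_key.
Lemma hBE : hB = mx2 1 0 0 p%:R. Proof. exact: (svalP hB_key). Qed.

Fact subA_key : {f : Fq -> {mpoly E[4]} -> {mpoly E[4]} |
  forall l, f l = subst (mx2 1 (- TE l) 0 pi) (mx2 1 ((- TE l) ^+ p) 0 pi)}.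
Proof. by exists (fun l => subst (mx2 1 (- TE l) 0 pi) (mx2 1 ((- TE l) ^+ p) 0 pi)). Qed.
Definition subA := sval subA_key.
Lemma subAE l : subA l = subst (mx2 1 (- TE l) 0 pi) (mx2 1 ((- TE l) ^+ p) 0 pi).
Proof. exact: (svalP subA_key). Qed.

Fact subB_key : {f : {mpoly E[4]} -> {mpoly E[4]} | f = subst (mx2 pi 0 0 1) (mx2 pi 0 0 1)}.
Proof. by exists (subst (mx2 pi 0 0 1) (mx2 pi 0 0 1)). Qed.
Definition subB := sval subB_key.
Lemma subBE : subB = subst (mx2 pi 0 0 1) (mx2 pi 0 0 1).
Proof. exact: (svalP subB_key). Qed.

Lemma hA_unit l : hA l \in unitmx.
Proof. by rewrite hAE unitmxE det_mx2 mulr1 mulr0 subr0 unitfE (pL_neq0 D). Qed.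
Lemma hB_unit : hB \in unitmx.
Proof. by rewrite hBE unitmxE det_mx2 mul1r mulr0 subr0 unitfE (pL_neq0 D). Qed.

Lemma heckeE_br g P : g \in unitmx -> bihomog r0 r1 P ->
  heckeE (brE g P) (\sum_l brE (g *m hA l) (subA l P) + brE (g *m hB) (subB P)).
Proof.
move=> gu hP.
have -> : \sum_l brE (g *m hA l) (subA l P) + brE (g *m hB) (subB P) =
    hecke_formula D (KZactE D) pi (fun l => (teich D l)%:A) id g P.
  rewrite /hecke_formula hBE subBE; apply: add_congr; last by [].
  by apply: eq_bigr => l _; rewrite hAE subAE.
by apply: span_gen; exists g, P; split; [exact: gu | exact: hP | reflexivity].
Qed.

Lemma p0 : pi != 0. Proof. exact: pE_neq0 D p_prime. Qed.

Lemma vgt_ap : vgt v 0 ap.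
Proof.
by move: ap_val => /andP[h1 _]; rewrite /vgt (lt_trans _ h1) ?orbT // invr_gt0 ltr0n.
Qed.

Lemma vgt_p_ap : vgt v 0 (pi / ap).
Proof.
move: ap_val => /andP[_ h1]; rewrite /vgt Defs.valM ?invr_neq0 ?p0 // v_inv // val_p.
by rewrite subr_gt0 h1 orbT.
Qed.

Lemma vgt_ap2_p : vgt v 0 (ap ^+ 2 / pi).
Proof.
move: ap_val => /andP[h1 _]; rewrite /vgt !(Defs.valM, mulf_neq0, invr_neq0, p0, expf_neq0) //.
rewrite v_inv ?p0 // val_p; apply/orP; right.
by move: h1; set x := v ap; lra.
Qed.

Lemma subA_hom l P : bihomog r0 r1 P -> bihomog r0 r1 (subA l P).
Proof. by rewrite subAE; exact: subst_bihomog. Qed.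
Lemma subB_hom P : bihomog r0 r1 P -> bihomog r0 r1 (subB P).
Proof. by rewrite subBE; exact: subst_bihomog. Qed.

Lemma gA_unit g l : g \in unitmx -> g *m hA l \in unitmx.
Proof. by rewrite unitmx_mul hA_unit andbT. Qed.
Lemma gB_unit g : g \in unitmx -> g *m hB \in unitmx.
Proof. by rewrite unitmx_mul hB_unit andbT. Qed.

(* If T [g, P] = p H with H integral, then (T - a_p) ([g, P] / a_p) = (p / a_p) H - [g, P]. *)
Lemma tau_divp g P : g \in unitmx -> bihomog r0 r1 P -> pge 0 P ->
  (forall l, pge 1 (subA l P)) -> pge 1 (subB P) -> tau (brE g P) = 0.
Proof.
move=> gu hP iP iA iB.
pose H := \sum_l brE (g *m hA l) (pi^-1 *: subA l P) + brE (g *m hB) (pi^-1 *: subB P).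
have hH : indVO H.
  apply: indVOD.
    apply: indVO_sum => l _; apply: indVO_br;
      [by [] | exact: gA_unit | exact/bihomogZ/subA_hom | exact/pge_div].
  by apply: indVO_br; [by [] | exact: gB_unit | exact/bihomogZ/subB_hom | exact/pge_div].
have HE : pi *: H = \sum_l brE (g *m hA l) (subA l P) + brE (g *m hB) (subB P).
  rewrite /H scalerDr scaler_sumr; apply: add_congr; first (apply: eq_bigr => l _);
    by rewrite -brEZ scalerA (mulfV p0) scale1r.
have hH' := heckeEZ (- ap^-1) (heckeE_br gu hP).
apply: (tau_kill (c := pi / ap) (F' := H) _ hH') => //; first exact: indVO_br.
  rewrite -HE !scalerA !mulrN mulfV // scaleN1r opprK.
  by rewrite mulNr [ap^-1 * _]mulrC scaleNr addrAC addNr add0r.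
exact: vgt_p_ap.
Qed.

Lemma hecke_congr g P Y : g \in unitmx -> bihomog r0 r1 P ->
  (forall l, pge 1 (subA l P)) -> bihomog r0 r1 Y -> pge 1 (subB P - Y) ->
  exists2 H, indVO H & heckeE (brE g P) (brE (g *m hB) Y + pi *: H).
Proof.
move=> gu hP iA hY iB.
exists (\sum_l brE (g *m hA l) (pi^-1 *: subA l P) + brE (g *m hB) (pi^-1 *: (subB P - Y))).
  apply: indVOD.
    apply: indVO_sum => l _; apply: indVO_br;
      [by [] | exact: gA_unit | exact/bihomogZ/subA_hom | exact/pge_div].
  apply: indVO_br; [by [] | exact: gB_unit | | exact/pge_div].
  by apply: bihomogZ; apply: bihomogB => //; exact: subB_hom.
set F := brE _ Y + _.
suff -> : F = \sum_l brE (g *m hA l) (subA l P) + brE (g *m hB) (subB P).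
  exact: heckeE_br.
rewrite /F scalerDr scaler_sumr addrCA; apply: add_congr.
  by apply: eq_bigr => l _; rewrite -brEZ scalerA (mulfV p0) scale1r.
by rewrite -brEZ scalerA (mulfV p0) scale1r -brED addrCA subrr addr0.
Qed.

(* (T - a_p) ([g, P]) = [g hB, Y] up to terms of positive valuation. *)
Lemma tau_hecke g P Y : g \in unitmx -> bihomog r0 r1 P -> pge 0 P ->
  (forall l, pge 1 (subA l P)) -> bihomog r0 r1 Y -> pge 0 Y -> pge 1 (subB P - Y) ->
  tau (brE (g *m hB) Y) = 0.
Proof.
move=> gu hP iP iA hY iY iB; have [H hH hHe] := hecke_congr gu hP iA hY iB.
have iF : indVO (brE g P) by exact: indVO_br.
have ipa := vgt_vge (lexx 0) vgt_p_ap.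
apply: (tau_kill (c := ap) (F' := - (pi / ap) *: H + brE g P) _ hHe).
- by apply: indVO_br => //; exact: gB_unit.
- rewrite scalerDr scalerA mulrN mulrCA mulfV // mulr1 scaleNr.
  by rewrite addrACA addrK addNr addr0.
- by apply: indVOZD => //; rewrite vgeN.
- exact: vgt_ap.
Qed.

End Hecke.

Lemma bihomog_cast (R : comNzRingType) s0 s1 t0 t1 (P : {mpoly R[4]}) :
  bihomog s0 s1 P -> s0 = t0 -> s1 = t1 -> bihomog t0 t1 P.
Proof. by move=> hP <- <-. Qed.

Ltac bihom_step := lazymatch goal with
  | |- bihomog _ _ (_ * _) => apply: bihomogM
  | |- bihomog _ _ (_ ^+ _) => apply: bihomogX
  | |- bihomog _ _ 'X_iX0 => exact: bihomogX0
  | |- bihomog _ _ 'X_iY0 => exact: bihomogY0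
  | |- bihomog _ _ 'X_iX1 => exact: bihomogX1
  | |- bihomog _ _ 'X_iY1 => exact: bihomogY1
  end.

Ltac bihom := eapply bihomog_cast; [repeat bihom_step | lia | lia].

Ltac rd_step := lazymatch goal with
  | |- rd _ (_ * _) _ => apply: rdM
  | |- rd _ (_ ^+ _) _ => apply: rdXn
  | |- rd _ 'X__ _ => exact: rdX
  end.

Lemma subst_congr (R : comNzRingType) (m n m' n' : 'M[R]_2) P :
  m = m' -> n = n' -> subst m n P = subst m' n' P.
Proof. by move=> -> ->. Qed.

(** * The action of Gamma, and the vanishing of the natural map on V_r^* *)

Section Killing.
Variables (p : nat) (Qp : fieldType) (L : fieldExtType Qp) (E : fieldExtType L).
Variables (Fq : finFieldType) (Fbar : closedFieldType).
Variable D : padic_setting p E Fq Fbar.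
Hypotheses (p_prime : prime p) (p_gt2 : (2 < p)%N).
Variables (r0 r1 : nat) (ap : E).
Hypotheses (ap_neq0 : ap != 0) (ap_val : 2%:R^-1 < v D ap < 1).
Local Notation v := (v D).
Local Notation red := (red D).
Local Notation brE := (bracket D (KZactE D)).
Local Notation indVO := (indVO D r0 r1).
Local Notation heckeE := (heckeE D r0 r1).
Local Notation tau := (tau D r0 r1 ap).
Local Notation nu := (nu D r0 r1 ap).
Local Notation nu0 := (nu0 D r0 r1 ap).
Local Notation pge := (pge D).
Local Notation pi := (p%:R : E).
Local Notation TE := (TE D).
Local Notation hA := (hA D).
Local Notation hB := (@hB p Qp L).
Local Notation subA := (subA D).
Local Notation subB := (@subB p Qp L E).
Local Notation iota := (Defs.iota D).
Implicit Types (g h : 'M[L]_2) (P Q V : {mpoly E[4]}) (S : {mpoly Fbar[4]}) (l : Fq).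

(* With T [g, V] = p U and T F = [g, V] + p H, applying T - a_p to
   [g, V] / p + (a_p / p) F leaves U, up to terms of positive valuation: this needs
   v(a_p^2 / p) > 0. *)
Lemma nu_second g V H F SA SB : g \in unitmx -> bihomog r0 r1 V ->
  (forall l, rd D (pi^-1 *: subA l V) (SA l)) -> rd D (pi^-1 *: subB V) SB ->
  indVO F -> indVO H -> heckeE F (brE g V + pi *: H) ->
  \sum_l nu (g *m hA l) (SA l) + nu (g *m hB) SB = 0.
Proof.
move=> gu hV iA iB hF hH hFe; have pN0 := p0 D p_prime.
have hAV l : bihomog r0 r1 (pi^-1 *: subA l V) by exact/bihomogZ/subA_hom.
have hBV : bihomog r0 r1 (pi^-1 *: subB V) by exact/bihomogZ/subB_hom.
have guA l := gA_unit D p_prime l gu; have guB := gB_unit D p_prime gu.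
have oA l : indVO (brE (g *m hA l) (pi^-1 *: subA l V)).
  by apply: indVO_br; [by [] | exact: guA | exact: hAV | exact: rd_pge (iA l)].
have oB : indVO (brE (g *m hB) (pi^-1 *: subB V)).
  by apply: indVO_br; [by [] | exact: guB | exact: hBV | exact: rd_pge iB].
set U := \sum_l brE (g *m hA l) (pi^-1 *: subA l V) + brE (g *m hB) (pi^-1 *: subB V).
have oS : indVO (\sum_l brE (g *m hA l) (pi^-1 *: subA l V)).
  by apply: indVO_sum => l _; exact: oA.
have oU : indVO U := indVOD oS oB.
have -> : \sum_l nu (g *m hA l) (SA l) + nu (g *m hB) SB = tau U.
  rewrite /U (tauD ap oS oB) tau_sum; last by move=> l _; exact: oA.
  apply: add_congr; last exact: nu_rd guB hBV iB.
  by apply: eq_bigr => l _; exact: nu_rd (guA l) (hAV l) (iA l).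
have UE : U = pi^-1 *: (\sum_l brE (g *m hA l) (subA l V) + brE (g *m hB) (subB V)).
  rewrite scalerDr scaler_sumr; apply: add_congr; last exact: brEZ.
  by apply: eq_bigr => l _; exact: brEZ.
have T1 := heckeEZ pi^-1 (heckeE_br D gu hV); rewrite -UE in T1.
have T2 := heckeEZ (ap / pi) hFe.
have T3 := heckeEZD 1 T1 T2; rewrite !scale1r in T3.
have ipa := vgt_vge (lexx 0) (vgt_p_ap p_prime ap_neq0 ap_val).
apply: (tau_kill (c := ap ^+ 2 / pi) (F' := - (pi / ap) *: H + F) oU T3).
- have key (W : zmodType) (u x y z : W) : u = u + (x + y) - (x + z) + (- y + z).
    rewrite -addrA (_ : - (x + z) + (- y + z) = - (x + y)) ?addrK //.
    by rewrite opprD addrACA addNr addr0 opprD.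
  rewrite !scalerDr !scalerA (mulfVK pN0) (_ : ap * (ap / pi) = ap ^+ 2 / pi) ?mulrA //.
  rewrite (_ : ap ^+ 2 / pi * - (pi / ap) = - ap); last by field; rewrite pN0 ap_neq0.
  by rewrite scaleNr; exact: key.
- by apply: indVOZD => //; rewrite vgeN.
- exact: vgt_ap2_p.
Qed.

Lemma val_unit (x : E) : vge v 0 x -> red x != 0 -> v x = 0.
Proof.
move=> hx rx; have := rx; rewrite -[red x == 0]/(red x == 0).
have x0 : x != 0 by apply: contraNneq rx => ->; rewrite red0.
have : ~ vgt v 0 x by move=> /red_vgt rx0; rewrite rx0 eqxx in rx.
move: hx; rewrite /vge /vgt (negPf x0) /= => h /negP; rewrite -leNgt => h' _.
by apply/eqP; rewrite eq_le h' h.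
Qed.

(** This lift is not multiplicative, but for invertible m it lies in K and reduces to m, which is
    all that the action on V_r sees. *)
Definition liftK (m : 'M[Fq]_2) : 'M[L]_2 := map_mx (teich D) m.

Lemma liftK_inK m : m \in unitmx -> inK D (liftK m).
Proof.
rewrite unitmxE unitfE => dm.
have dE (K : comNzRingType) (k : 'M[K]_2) : \det k = k 0 0 * k 1 1 - k 0 1 * k 1 0.
  by rewrite -det_mx2; congr (\det _); apply: mx2P; rewrite mx2E.
have hi i j : vge v 0 (liftK m i j)%:A by rewrite mxE; exact: teich_int.
have hd : vge v 0 (\det (liftK m))%:A.
  by rewrite dE; apply: intLD; rewrite ?intLN //; apply: intLM.
have rd : red (\det (liftK m))%:A = iota (\det m).
  rewrite !dE -in_algE rmorphB !rmorphM /= redB ?intM // !redM //.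
  by rewrite !mxE !teich_red rmorphB !rmorphM.
have rn0 : red (\det (liftK m))%:A != 0 by rewrite rd fmorph_eq0.
split=> //; split; last exact: val_unit.
by apply: contraNneq rn0 => ->; rewrite scale0r red0.
Qed.

Lemma KZactF_lift m S : m \in unitmx -> KZactF D (liftK m) S = Gact D m S.
Proof.
move=> mu; rewrite /KZactF (KZact_dec p_prime _ _ (inK_dec (liftK_inK mu))) /Gact.
apply: subst_congr; apply/matrixP => i j; rewrite !mxE /=; first exact: teich_red.
by rewrite red_sigma ?teich_red //; exact: teich_int.
Qed.

Lemma nu_Gact g m S : m \in unitmx -> nu g (Gact D m S) = nu (g *m liftK m) S.
Proof.
move=> mu; rewrite -(KZactF_lift S mu).
exact: (nu_act p_prime r0 r1 ap g S (inK_inKZ (liftK_inK mu))).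
Qed.

(** F_q is the residue field of L, so the entries of the K-part reduce into F_q, and [sigma] reduces
    to the p-th power. *)
Lemma KZactF_Gact h : inKZ D h -> exists2 m : 'M[Fq]_2, m \in unitmx &
  forall S, KZactF D h S = Gact D m S.
Proof.
case=> k hk; have [[ki [kd kv]] _] := hk.
have /choice[f hf] : forall ij : 'I_2 * 'I_2, exists l, red (k ij.1 ij.2)%:A = iota l.
  by move=> ij; exact: (Fq_residue (ki ij.1 ij.2)).
pose m : 'M[Fq]_2 := \matrix_(i, j) f (i, j).
have dE (K : comNzRingType) (k' : 'M[K]_2) : \det k' = k' 0 0 * k' 1 1 - k' 0 1 * k' 1 0.
  by rewrite -det_mx2; congr (\det _); apply: mx2P; rewrite mx2E.
exists m.
  rewrite unitmxE unitfE -(fmorph_eq0 iota).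
  have <- : red (\det k)%:A = iota (\det m).
    rewrite !dE -in_algE rmorphB !rmorphM /= redB ?intM // !redM //.
    by rewrite !mxE rmorphB !rmorphM /= -!hf.
  have ik : vge v 0 (\det k)%:A by rewrite /vge kv lexx orbT.
  apply/eqP => /(red_eq0 ik).
  by rewrite /vgt kv ltxx orbF -in_algE fmorph_eq0 (negPf kd).
move=> S; rewrite /KZactF (KZact_dec p_prime _ _ hk) /Gact.
apply: subst_congr; apply/matrixP => i j; rewrite !mxE /=; first exact: hf (i, j).
by rewrite red_sigma // -(hf (i, j)).
Qed.

Lemma nu_nu0 g S : g \in unitmx -> bihomog r0 r1 S -> nu g S = nu0 g S.
Proof.
move=> gu hS; rewrite {1}(bihomog_decomp hS) /nu0.
have hm (i : 'I_r0.+1) (j : 'I_r1.+1) : bihomog r0 r1 (monY Fbar r0 r1 i j).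
  by apply: bihomog_monY; rewrite -ltnS.
have hmE (i : 'I_r0.+1) (j : 'I_r1.+1) : bihomog r0 r1 (monY E r0 r1 i j).
  by apply: bihomog_monY; rewrite -ltnS.
have nuS (I : Type) (r : seq I) (F : I -> {mpoly Fbar[4]}) :
    (forall i, bihomog r0 r1 (F i)) -> nu g (\sum_(i <- r) F i) = \sum_(i <- r) nu g (F i).
  move=> hF; elim: r => [|i r IH]; rewrite ?big_nil ?nu_0 // !big_cons nuD ?IH //.
  by apply: bihomog_sum.
rewrite nuS => [|i]; last by apply: bihomog_sum => j _; exact: bihomogZ.
apply: eq_bigr => i _; rewrite nuS => [|j]; last exact: bihomogZ.
apply: eq_bigr => j _; rewrite nuZ //; congr (_ *: _).
by apply: nu_rd => //; exact: rd_monY.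
Qed.

Lemma TE_opp_q l : (- TE l) ^+ (p ^ 2) = - TE l.
Proof. by rewrite -TEN // TE_root. Qed.

Lemma pge1_pi P : pge 0 P -> pge 1 (pi *: P).
Proof. by move=> hP; rewrite -[1 : rat]addr0; exact: pge_pi. Qed.

Lemma subA_vars l : (subA l 'X_iX0 = 'X_iX0) * (subA l 'X_iX1 = 'X_iX1) *
  (subA l 'X_iY0 = (- TE l) *: 'X_iX0 + pi *: 'X_iY0) *
  (subA l 'X_iY1 = (- TE l) ^+ p *: 'X_iX1 + pi *: 'X_iY1).
Proof. by rewrite !subAE !substE !mx2E !scale1r !scale0r !addr0. Qed.

Lemma subB_vars : (subB 'X_iX0 = pi *: 'X_iX0) * (subB 'X_iX1 = pi *: 'X_iX1) *
  (subB 'X_iY0 = 'X_iY0) * (subB 'X_iY1 = 'X_iY1).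
Proof. by rewrite !subBE !substE !mx2E !scale1r !scale0r !addr0 !add0r. Qed.

Lemma subAM l P Q : subA l (P * Q) = subA l P * subA l Q.
Proof. by rewrite !subAE substM. Qed.
Lemma subAB l P Q : subA l (P - Q) = subA l P - subA l Q.
Proof. by rewrite !subAE substB. Qed.
Lemma subAX l P n : subA l (P ^+ n) = subA l P ^+ n.
Proof. by rewrite !subAE substXn. Qed.
Lemma subBM P Q : subB (P * Q) = subB P * subB Q.
Proof. by rewrite !subBE substM. Qed.
Lemma subBB P Q : subB (P - Q) = subB P - subB Q.
Proof. by rewrite !subBE substB. Qed.
Lemma subBX P n : subB (P ^+ n) = subB P ^+ n.
Proof. by rewrite !subBE substXn. Qed.

Lemma TEN_int l : vge v 0 (- TE l). Proof. by rewrite vgeN; exact: TE_int. Qed.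

Lemma pge_subst s0 s1 (k0 k1 : 'M[E]_2) P :
  (forall i j, vge v 0 (k0 i j)) -> (forall i j, vge v 0 (k1 i j)) ->
  bihomog s0 s1 P -> pge 0 P -> pge 0 (subst k0 k1 P).
Proof.
move=> h0 h1 hP iP; apply: rd_pge (rd_subst hP _ _ (pge_rd iP)).
  by instantiate (1 := map_mx red k0) => i j; rewrite mxE.
by instantiate (1 := map_mx red k1) => i j; rewrite mxE.
Qed.

Lemma mx2_int (a b c d : E) : vge v 0 a -> vge v 0 b -> vge v 0 c -> vge v 0 d ->
  forall i j, vge v 0 (mx2 a b c d i j).
Proof. by move=> *; rewrite mxE; do 2!case: ifP. Qed.

Lemma pge_subA s0 s1 l P : bihomog s0 s1 P -> pge 0 P -> pge 0 (subA l P).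
Proof.
have it := TEN_int l.
by move=> hP iP; rewrite subAE; apply: pge_subst hP iP; apply: mx2_int;
  rewrite ?int1 ?vge0 ?int_nat //; exact: intX.
Qed.

Lemma pge_subB s0 s1 P : bihomog s0 s1 P -> pge 0 P -> pge 0 (subB P).
Proof.
by move=> hP iP; rewrite subBE; apply: pge_subst hP iP; apply: mx2_int;
  rewrite ?int1 ?vge0 ?int_nat.
Qed.

(** Modulo p the substitution puts Y_0 = -l X_0 and Y_1 = (-l)^p X_1, and theta_0 becomes ((-l)^q +
    l) X_0 X_1^p = 0. *)
Lemma subA_theta0 l : pge 1 (subA l (theta0 E p)).
Proof.
rewrite /theta0 subAB (subAM l 'X_iX0) (subAM l 'X_iY0) !subAX !subA_vars; set a := (- TE l) ^+ p.
have ia : vge v 0 a by exact/intX/TEN_int.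
have hx := pge_var D.
rewrite (_ : _ - _ = 'X_iX0 * ((a *: 'X_iX1 + pi *: 'X_iY1) ^+ p - (a *: 'X_iX1) ^+ p)
   - pi *: ('X_iY0 * 'X_iX1 ^+ p)).
  apply: pgeB; last by apply: pge1_pi; apply: pgeMl => //; exact: pgeX0.
  by apply: pgeMl => //; apply: pge_exp1; [exact: pgeZ0 | exact: pge1_pi].
rewrite exprZn /a -exprM mulnn TE_opp_q -!mul_mpolyC rmorphN /=; ring.
Qed.

Lemma subA_theta1 l : pge 1 (subA l (theta1 E p)).
Proof.
rewrite /theta1 subAB (subAM l 'X_iX1) (subAM l 'X_iY1) !subAX !subA_vars.
have hx := pge_var D.
rewrite (_ : _ - _ =
   'X_iX1 * (((- TE l) *: 'X_iX0 + pi *: 'X_iY0) ^+ p - ((- TE l) *: 'X_iX0) ^+ p)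
   - pi *: ('X_iY1 * 'X_iX0 ^+ p)).
  apply: pgeB; last by apply: pge1_pi; apply: pgeMl => //; exact: pgeX0.
  by apply: pgeMl => //; apply: pge_exp1; [apply: pgeZ0 => //; exact: TEN_int | exact: pge1_pi].
rewrite exprZn -!mul_mpolyC; ring.
Qed.

Lemma pge1_exp P n : (0 < n)%N -> pge 0 P -> pge 1 ((pi *: P) ^+ n).
Proof.
move=> n0 hP; have := pge_exp1 (D := D) n (pge0 D 0) (pge1_pi hP).
by rewrite add0r expr0n gtn_eqF // subr0.
Qed.

(** Each monomial of theta_0 contains X_0 or X_1, which [subB] multiplies by p. *)
Lemma subB_theta0 : pge 1 (subB (theta0 E p)).
Proof.
have hx := pge_var D.
rewrite /theta0 subBB (subBM 'X_iX0) (subBM 'X_iY0) !subBX !subB_vars -scalerAl; apply: pgeB.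
  by apply/pge1_pi/pgeMl => //; exact: pgeX0.
by apply: pgeMl => //; apply: pge1_exp => //; exact: prime_gt0.
Qed.

Lemma subB_theta1 : pge 1 (subB (theta1 E p)).
Proof.
have hx := pge_var D.
rewrite /theta1 subBB (subBM 'X_iX1) (subBM 'X_iY1) !subBX !subB_vars -scalerAl; apply: pgeB.
  by apply/pge1_pi/pgeMl => //; exact: pgeX0.
by apply: pgeMl => //; apply: pge1_exp => //; exact: prime_gt0.
Qed.

Lemma theta0_hom (R : comNzRingType) : bihomog 1 p (theta0 R p).
Proof. by apply: bihomogB; bihom. Qed.
Lemma theta1_hom (R : comNzRingType) : bihomog p 1 (theta1 R p).
Proof. by apply: bihomogB; bihom. Qed.

Lemma rd_theta0 : rd D (theta0 E p) (theta0 Fbar p).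
Proof. by apply: rdB; repeat rd_step. Qed.
Lemma rd_theta1 : rd D (theta1 E p) (theta1 Fbar p).
Proof. by apply: rdB; repeat rd_step. Qed.

Lemma nu0_hom_neq g S s0 s1 : bihomog s0 s1 S -> (s0 <> r0 \/ s1 <> r1) -> nu0 g S = 0.
Proof.
move=> /bihomogP hS neq; rewrite /nu0 big1 // => i _; rewrite big1 // => j _.
have [->|/hS] := eqVneq S@_(mnmY r0 r1 i j) 0; first by rewrite scale0r.
have := ltn_ord i; have := ltn_ord j; rewrite !mnmYE !ltnS => hi hj [h0 h1].
by case: neq; lia.
Qed.

(* nu0 is linear on all polynomials, not just the bihomogeneous ones, so S' may be taken
   to be a monomial. *)
Lemma nu0_theta g (t : {mpoly E[4]}) (t' : {mpoly Fbar[4]}) s0 s1 S' : g \in unitmx ->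
  bihomog s0 s1 t -> rd D t t' -> (forall l, pge 1 (subA l t)) -> pge 1 (subB t) ->
  nu0 g (t' * S') = 0.
Proof.
move=> gu ht htt iA iB; rewrite [S']mpolyE mulr_sumr.
elim/big_rec: _ => [|u S _ IH]; first exact: nu00.
rewrite -scalerAr nu0ZD IH addr0; set M := 'X_[u].
suff -> : nu0 g (t' * M) = 0 by rewrite scaler0.
pose ME : {mpoly E[4]} := 'X_[u].
have hME : bihomog (u iX0 + u iY0) (u iX1 + u iY1) ME.
  by move=> m; rewrite msuppX inE => /eqP ->.
have rM : rd D ME M.
  by move=> m; rewrite !mcoeffX; case: eqP => _; rewrite ?red0 ?vge0 ?red1 ?int1.
have hP := bihomogM ht hME.
have [e0|ne] := eqVneq (s0 + (u iX0 + u iY0))%N r0; last first.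
  by apply: nu0_hom_neq (rd_bihomog (rdM htt rM) hP) _; left; apply/eqP.
have [e1|ne] := eqVneq (s1 + (u iX1 + u iY1))%N r1; last first.
  by apply: nu0_hom_neq (rd_bihomog (rdM htt rM) hP) _; right; apply/eqP.
rewrite e0 e1 in hP.
rewrite (nu0_rd p_prime ap gu hP (rdM htt rM)).
apply: tau_divp => //; first exact: rd_pge (rdM htt rM).
  move=> l; rewrite subAM mulrC; apply: pgeMl; last exact: iA.
  exact: pge_subA hME (rd_pge rM).
rewrite subBM mulrC; apply: pgeMl => //.
exact: pge_subB hME (rd_pge rM).
Qed.

Lemma nu_Vstar g S : g \in unitmx -> Vstar p r0 r1 S -> nu g S = 0.
Proof.
move=> gu [hS [P0 [P1 SE]]]; rewrite (nu_nu0 gu hS) SE -[X in X + _]scale1r nu0ZD.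
rewrite (nu0_theta _ gu (@theta0_hom E) rd_theta0 subA_theta0 subB_theta0).
rewrite (nu0_theta _ gu (@theta1_hom E) rd_theta1 subA_theta1 subB_theta1).
by rewrite scaler0 addr0.
Qed.

End Killing.

(** * The relation between w and w' *)

Lemma modn_sub_congr m n k d : (k <= m)%N -> (k <= n)%N ->
  m = n %[mod d] -> (m - k)%N = (n - k)%N %[mod d].
Proof. by move=> km kn mn; apply/eqP; rewrite -(eqn_modDr k) !subnK //; apply/eqP. Qed.

Lemma pa1_bounds p a1 : prime p -> (1 <= a1 <= p - 1)%N -> (p <= p * a1 <= p ^ 2 - p)%N.
Proof.
move=> /prime_gt0 p0 /andP[h1 h2]; rewrite leq_pmulr //=.
by rewrite (_ : p ^ 2 - p = p * (p - 1))%N ?leq_pmul2l // mulnBr mulnn muln1.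
Qed.

Lemma modn_eq_small u w d : u = w %[mod d] -> (u < w + d)%N -> (w < u + d)%N -> u = w.
Proof.
wlog uw : u w / (u <= w)%N => [W e h1 h2|].
  by case: (leqP u w) => [|/ltnW] h; [exact: W | apply/esym; apply: W].
move=> /esym/eqP; rewrite eqn_mod_dvd // => dv _ h; apply/eqP; rewrite eqn_leq uw /=.
by case: (posnP (w - u)%N) => [|/dvdn_leq/(_ dv)]; move: uw h; clear; lia.
Qed.

Section HeckeRelation.
Variables (p : nat) (Qp : fieldType) (L : fieldExtType Qp) (E : fieldExtType L).
Variables (Fq : finFieldType) (Fbar : closedFieldType).
Variable D : padic_setting p E Fq Fbar.
Hypotheses (p_prime : prime p) (p_gt2 : (2 < p)%N).
Variables (r0 r1 a1 : nat) (ap : E).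
Hypotheses (r0_ge : (p ^ 2 <= r0)%N) (r1_ge : (p ^ 2 <= r1)%N).
Hypotheses (a1_bounds : (1 <= a1 <= p - 1)%N).
Hypotheses (ap_neq0 : ap != 0) (ap_val : 2%:R^-1 < v D ap < 1).
Local Notation v := (v D).
Local Notation red := (red D).
Local Notation brE := (bracket D (KZactE D)).
Local Notation indVO := (indVO D r0 r1).
Local Notation heckeE := (heckeE D r0 r1).
Local Notation nu := (nu D r0 r1 ap).
Local Notation pge := (pge D).
Local Notation pi := (p%:R : E).
Local Notation TE := (TE D).
Local Notation hA := (hA D).
Local Notation hB := (@hB p Qp L).
Local Notation subA := (subA D).
Local Notation subB := (@subB p Qp L E).
Local Notation iota := (Defs.iota D).
Implicit Types (g h : 'M[L]_2) (P Q V : {mpoly E[4]}) (S : {mpoly Fbar[4]}) (l : Fq).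

Definition YY (R : comNzRingType) : {mpoly R[4]} := 'X_iY0 ^+ r0 * 'X_iY1 ^+ r1.
Definition XX (R : comNzRingType) : {mpoly R[4]} := 'X_iX0 ^+ r0 * 'X_iX1 ^+ r1.
(* Chosen so that T [g, Pk] is congruent to [g hB, YY] modulo p. *)
Definition Pk : {mpoly E[4]} :=
  ('X_iY0 ^+ r0 - 'X_iX0 ^+ (p ^ 2 - 1) * 'X_iY0 ^+ (r0 - (p ^ 2 - 1))) * 'X_iY1 ^+ r1.

Lemma YY_hom R : bihomog r0 r1 (YY R). Proof. by clear; rewrite /YY; bihom. Qed.
Lemma XX_hom R : bihomog r0 r1 (XX R). Proof. by clear; rewrite /XX; bihom. Qed.
Lemma rd_YY : rd D (YY E) (YY Fbar). Proof. by rewrite /YY; repeat rd_step. Qed.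

Lemma rd_Pk : pge 0 Pk.
Proof.
have hx := pge_var D; rewrite /Pk; apply: pgeMl; last exact: pgeX0.
by apply: pgeB; [exact: pgeX0 | apply: pgeMl; exact: pgeX0].
Qed.

Lemma Pk_hom : bihomog r0 r1 Pk.
Proof.
have q1 := q_gt1 p_prime; move: r0_ge q1; clear => r0q q1.
rewrite /Pk; eapply bihomog_cast.
  apply: (@bihomogM _ r0 0); last by bihom_step; bihom_step.
  by apply: bihomogB; [bihom | bihom].
- by lia.
- by lia.
Qed.

(** Modulo p the substitution puts Y_0 = x X_0 with x^q = x, and the two terms in the first factor
    of [Pk] cancel. *)
Lemma subA_Pk l : pge 1 (subA l Pk).
Proof.
have hx := pge_var D; have q1 := q_gt1 p_prime; have iT := TEN_int D l.
have [k r0E] : exists k, r0 = (p ^ 2 + k)%N by exists (r0 - p ^ 2)%N; rewrite subnKC.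
(* The exponent left after removing q - 1 is positive, by r0 >= q; this is what makes the two powers
   of x agree at x = 0 as well. *)
have mE : (r0 - (p ^ 2 - 1) = k.+1)%N by clear -r0E q1; lia.
have nE : r0 = (p ^ 2 - 1 + k.+1)%N by clear -r0E q1; lia.
rewrite /Pk (subAM D l (_ - _)) subAX subAB subAX (subAM D l ('X_iX0 ^+ _)) !subAX !subA_vars mE.
set x := - TE l in iT *.
have xE : x ^+ r0 = x ^+ k.+1.
  by rewrite r0E exprD (TE_opp_q D p_prime p_gt2) -exprS.
rewrite mulrC; apply: pgeMl.
  apply/pgeX0/pgeD; first by apply: pgeZ0; [exact: intX | exact: hx].
  by apply: pge_le (pge1_pi (hx iY1)).
rewrite (_ : _ - _ = ((x *: 'X_iX0 + pi *: 'X_iY0) ^+ r0 - (x *: 'X_iX0) ^+ r0)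
  - 'X_iX0 ^+ (p ^ 2 - 1) * ((x *: 'X_iX0 + pi *: 'X_iY0) ^+ k.+1 - (x *: 'X_iX0) ^+ k.+1)).
  have h1 n : pge 1 ((x *: 'X_iX0 + pi *: 'X_iY0) ^+ n - (x *: 'X_iX0) ^+ n).
    by apply: pge_exp1; [apply: pgeZ0; [exact: iT | exact: hx] | apply: pge1_pi; exact: hx].
  by apply: pgeB; [exact: h1 | apply: pgeMl; [exact/pgeX0/hx | exact: h1]].
have key (W : zmodType) (u w z : W) : u - w = u - z - (w - z) by rewrite opprB addrA subrK.
by rewrite [in RHS]mulrBr !exprZn xE -scalerAr -exprD -nE; exact: key.
Qed.

Lemma subB_Pk : pge 1 (subB Pk - YY E).
Proof.
have hx := pge_var D; have q1 := q_gt1 p_prime.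
rewrite /Pk /YY (@subBM _ _ _ _ (_ - _)) subBX subBB subBX (@subBM _ _ _ _ ('X_iX0 ^+ _)).
rewrite !subBX !subB_vars -mulrBl addrAC subrr add0r mulNr; apply: pgeN.
rewrite mulrC; apply: pgeMl; first exact: pgeX0.
rewrite mulrC; apply: pgeMl; first exact: pgeX0.
by apply: pge1_exp => //; clear -q1; lia.
Qed.

Lemma nu_YY g : g \in unitmx -> nu g (YY Fbar) = 0.
Proof.
move=> gu; have Bu := hB_unit D p_prime.
rewrite (nu_rd p_prime ap gu (@YY_hom E) rd_YY) -[g](mulmxKV Bu).
apply: (tau_hecke p_prime ap_neq0 ap_val _ Pk_hom rd_Pk subA_Pk (@YY_hom E) (rd_pge rd_YY) subB_Pk).
by rewrite unitmx_mul gu unitmx_inv.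
Qed.

Definition w0 : 'M[Fq]_2 := mx2 0 1 1 0.
Lemma w0_unit : w0 \in unitmx.
Proof. by rewrite unitmxE det_mx2 mul0r mul1r sub0r unitfE oppr_eq0 oner_eq0. Qed.

Lemma Gact_w0_vars : (Gact D w0 'X_iX0 = 'X_iY0) * (Gact D w0 'X_iX1 = 'X_iY1) *
  (Gact D w0 'X_iY0 = 'X_iX0) * (Gact D w0 'X_iY1 = 'X_iX1).
Proof.
have p0' : (p == 0)%N = false by apply/negbTE; rewrite -lt0n prime_gt0.
rewrite /Gact !map_mx2 !rmorph0 !rmorph1 expr1n expr0n p0' /=.
by rewrite !substE !mx2E !scale1r !scale0r !addr0 !add0r.
Qed.

Lemma nu_XX g : g \in unitmx -> nu g (XX Fbar) = 0.
Proof.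
move=> gu.
have -> : XX Fbar = Gact D w0 (YY Fbar).
  rewrite /XX /YY /Gact substM !substXn -!/(Gact D w0 _) !Gact_w0_vars //.
rewrite (nu_Gact D p_prime r0 r1 ap g (YY Fbar) w0_unit); apply: nu_YY.
by rewrite unitmx_mul gu (inK_unit (liftK_inK D w0_unit)).
Qed.

Lemma Gact_hom s0 s1 m S : bihomog s0 s1 S -> bihomog s0 s1 (Gact D m S).
Proof. exact: subst_bihomog. Qed.

Lemma nu_Xr g S : g \in unitmx -> Xr D r0 r1 S -> bihomog r0 r1 S /\ nu g S = 0.
Proof.
move=> gu; elim=> [|a x y [m mu ->] _ [hy nuy]]; first by split; [exact: bihomog0 | exact: nu_0].
have hx : bihomog r0 r1 (Gact D m (XX Fbar)) by apply: Gact_hom; exact: XX_hom.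
split; first exact: bihomogZD.
rewrite (nuZD D p_prime ap a gu hx hy) nuy addr0 (nu_Gact D p_prime r0 r1 ap g _ mu) nu_XX ?scaler0 //.
by rewrite unitmx_mul gu (inK_unit (liftK_inK D mu)).
Qed.

Lemma nu_kill g S : g \in unitmx -> lspan (fun S' => Vstar p r0 r1 S' \/ Xr D r0 r1 S') S ->
  bihomog r0 r1 S /\ nu g S = 0.
Proof.
move=> gu; elim=> [|a x y hx _ [hy nuy]]; first by split; [exact: bihomog0 | exact: nu_0].
have [hhx nux] : bihomog r0 r1 x /\ nu g x = 0.
  case: hx => [hV|hX]; last exact: nu_Xr.
  by split; [case: hV | exact: (nu_Vstar p_prime p_gt2 ap_neq0 ap_val gu hV)].
by split; [exact: bihomogZD | rewrite (nuZD D p_prime ap a gu hhx hy) nux nuy scaler0 addr0].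
Qed.

Lemma q1E : #|Fq|.-1 = (p ^ 2 - 1)%N.
Proof. by rewrite (Fq_card D) subn1. Qed.

(* The sum is minus the coefficient of t in (t - l)^e. *)
Lemma sumFq e e' l : (0 < e)%N -> (0 < e' < p ^ 2 - 1)%N -> e = e' %[mod p ^ 2 - 1] ->
  \sum_(t : Fq) t ^+ (p ^ 2 - 2) * (t - l) ^+ e = - (e'%:R * (- l) ^+ e'.-1).
Proof.
move=> e0 /andP[e0' e1'] ee.
under eq_bigr do rewrite (expf_congr _ e0 e0') ?q1E //.
have := @sum_extract Fq Fq idfun (('X - l%:P) ^+ e') 1.
rewrite q1E size_exp_XsubC => /(_ e1'); rewrite -subnDA => H.
transitivity (- (('X - l%:P) ^+ e')`_1).
  rewrite -H; last by lia.
  by apply: eq_bigr => t _; rewrite !hornerE.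
congr (- _); rewrite -[RHS]/(_ * _).
have -> : (('X - l%:P) ^+ e')`_1 = (('X - l%:P) ^+ e')^`().[0].
  by rewrite horner_coef0 coef_deriv.
by rewrite deriv_exp derivXsubC mul1r hornerMn horner_exp hornerXsubC sub0r mulr_natl.
Qed.

(** With the exponent q - 2 = (q - 1) - 1, sums over t pick out the coefficient of t^1. *)
Definition ct t := TE t ^+ (p ^ 2 - 2).

Lemma ct_int t : vge v 0 (ct t). Proof. exact/intX/TE_int. Qed.

Lemma dt_int l t : vge v 0 (TE t - TE l). Proof. by apply: vgeB; exact: TE_int. Qed.
Lemma dt'_int l t : vge v 0 (TE t ^+ p + (- TE l) ^+ p).
Proof. by apply: vgeD; apply: intX; rewrite ?vgeN; exact: TE_int. Qed.

(** The factor [t]^p + (-[l])^p reduces to (t - l)^p, which merges the two powers into one of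
    exponent m + p n. *)
Lemma red_sumA l m n :
  let A := \sum_t ct t * ((TE t - TE l) ^+ m * (TE t ^+ p + (- TE l) ^+ p) ^+ n) in
  vge v 0 A /\ red A = iota (\sum_t t ^+ (p ^ 2 - 2) * (t - l) ^+ (m + p * n)).
Proof.
have chp := pFq D p_prime.
have hi t : vge v 0 (ct t * ((TE t - TE l) ^+ m * (TE t ^+ p + (- TE l) ^+ p) ^+ n)).
  apply: intM; first exact: ct_int.
  by apply: intM; apply: intX; [exact: dt_int | exact: dt'_int].
split; first by apply: vge_sum.
rewrite red_sum // rmorph_sum; apply: eq_bigr => t _.
have iT k := TE_int D k; have iTN : vge v 0 (- TE l) by rewrite vgeN.
rewrite redM ?ct_int //; last by apply: intM; apply: intX; [exact: dt_int | exact: dt'_int].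
rewrite redM; [|by apply: intX; exact: dt_int|by apply: intX; exact: dt'_int].
rewrite !redXn ?dt_int ?dt'_int // redB // redD ?intX // !redXn // redN // !TE_red.
rewrite rmorphM !rmorphXn rmorphB exprD [in RHS]exprM; congr (_ * (_ * _ ^+ _)).
exact/esym/frobD/(pFbar D p_prime).
Qed.

(** Both sides are roots of X^q - X with reduction l^p. *)
Lemma TE_sigma l : (sigma D (teich D l))%:A = TE l ^+ p.
Proof.
have r1' : red (sigma D (teich D l))%:A = iota (l ^+ p).
  by rewrite red_sigma ?teich_red ?rmorphXn //; exact: teich_int.
have r2 : red (TE l ^+ p) = iota (l ^+ p).
  by rewrite redXn ?TE_red ?rmorphXn //; exact: TE_int.
have q1 : (sigma D (teich D l))%:A ^+ (p ^ 2) = (sigma D (teich D l))%:A :> E.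
  rewrite -[LHS](rmorphXn (in_alg E)) -[in LHS](rmorphXn (sigma D)) teich_root.
  reflexivity.
have q2 : (TE l ^+ p) ^+ (p ^ 2) = TE l ^+ p by rewrite -exprM mulnC exprM TE_root.
exact: etrans (TE_uniq p_prime q1 r1') (esym (TE_uniq p_prime q2 r2)).
Qed.

Definition kU (x : L) : 'M[L]_2 := mx2 1 x 0 1.

Lemma kU_inK x : vge v 0 x%:A -> inK D (kU x).
Proof.
move=> hx; have dE : \det (kU x) = 1 by rewrite det_mx2 mulr1 mulr0 subr0.
split; last by rewrite dE oner_neq0 scale1r v_one.
by move=> i j; rewrite mxE; do 2!case: ifP => _; rewrite ?scale0r ?scale1r ?vge0 ?int1.
Qed.

(** The translate of [YY] by the unipotent element with entry [t]. *)
Definition Vt t : {mpoly E[4]} :=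
  (TE t *: 'X_iX0 + 'X_iY0) ^+ r0 * (TE t ^+ p *: 'X_iX1 + 'X_iY1) ^+ r1.
Definition VV : {mpoly E[4]} := \sum_t ct t *: Vt t.

Lemma brE_kU g t : brE (g *m kU (teich D t)) (YY E) = brE g (Vt t).
Proof.
have kK := kU_inK (teich_int D t).
rewrite (brE_act p_prime g (YY E) (inK_inKZ kK)); congr (bracket _ _ g _).
rewrite /KZactE (KZact_dec p_prime _ _ (inK_dec kK)) /YY !substM !substXn !substE /kU !map_mx2 !mx2E.
by rewrite /= !rmorph1 !scale1r TE_sigma.
Qed.

Lemma Vt_hom t : bihomog r0 r1 (Vt t).
Proof.
have H0 (a : E) : bihomog 1 0 (a *: 'X_iX0 + 'X_iY0 : {mpoly E[4]}).
  by apply/bihomogZD; [exact: bihomogX0 | exact: bihomogY0].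
have H1 (a : E) : bihomog 0 1 (a *: 'X_iX1 + 'X_iY1 : {mpoly E[4]}).
  by apply/bihomogZD; [exact: bihomogX1 | exact: bihomogY1].
rewrite /Vt; eapply bihomog_cast.
- by apply: bihomogM; apply: bihomogX; [exact: H0 | exact: H1].
- by rewrite muln1 muln0 addn0.
- by rewrite muln1 muln0 add0n.
Qed.

Lemma VV_hom : bihomog r0 r1 VV.
Proof. by apply: bihomog_sum => t _; apply: bihomogZ; exact: Vt_hom. Qed.

Lemma VV_hecke g : g \in unitmx ->
  exists F H, [/\ indVO F, indVO H & heckeE F (brE g VV + pi *: H)].
Proof.
move=> gu; have Bu := hB_unit D p_prime.
(* T sends [gt t, Pk] to [gt t hB, YY] modulo p, and gt t hB is g times a unipotent, so that the
   result is [g, Vt t]. *)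
pose gt t := g *m kU (teich D t) *m invmx hB.
have gtu t : gt t \in unitmx.
  by rewrite !unitmx_mul gu (inK_unit (kU_inK (teich_int D t))) unitmx_inv.
have /choice[H hH] : forall t, exists H, indVO H /\
    heckeE (brE (gt t) Pk) (brE g (Vt t) + pi *: H).
  move=> t; have [H h1 h2] := hecke_congr p_prime (gtu t) Pk_hom subA_Pk (@YY_hom E) subB_Pk.
  have gE : gt t *m hB = g *m kU (teich D t) by exact: (mulmxKV Bu).
  by exists H; split; [exact: h1 | rewrite gE brE_kU in h2; exact: h2].
exists (\sum_t ct t *: brE (gt t) Pk), (\sum_t ct t *: H t); split.
- apply: indVO_sum => t _; apply: indVOZ; first exact: ct_int.
  by apply: indVO_br; [by [] | exact: gtu | exact: Pk_hom | exact: rd_Pk].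
- by apply: indVO_sum => t _; apply: indVOZ; [exact: ct_int | case: (hH t)].
have -> : brE g VV + pi *: (\sum_t ct t *: H t) =
    \sum_t ct t *: (brE g (Vt t) + pi *: H t).
  rewrite /VV brE_sum scaler_sumr -big_split /=; apply: eq_bigr => t _.
  by rewrite brEZ scalerDr !scalerA [pi * _]mulrC.
by apply: heckeE_sum => t _; case: (hH t).
Qed.

Definition ww : {mpoly Fbar[4]} := 'X_iX0 ^+ r0.-1 * 'X_iY0 * 'X_iX1 ^+ r1.
Definition ww' : {mpoly Fbar[4]} := 'X_iY0 ^+ r0.-1 * 'X_iX0 * 'X_iY1 ^+ r1.

Lemma r0_gt1 : (1 < r0)%N. Proof. exact: leq_trans (q_gt1 p_prime) r0_ge. Qed.
Lemma r1_gt1 : (1 < r1)%N. Proof. exact: leq_trans (q_gt1 p_prime) r1_ge. Qed.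

Lemma ww_hom : bihomog r0 r1 ww. Proof. by have := r0_gt1; clear; rewrite /ww => ?; bihom. Qed.
Lemma ww'_hom : bihomog r0 r1 ww'. Proof. by have := r0_gt1; clear; rewrite /ww' => ?; bihom. Qed.

Hypotheses (r_mod : (r0 + p * r1 = p * a1 %[mod p ^ 2 - 1])%N).
Hypotheses (r0_ndiv : ~~ (p %| r0)%N) (r1_div : a1 = 1%N -> (p %| r1)%N).

(** The three sums are coefficients of t in powers of t - l with exponents congruent to p a1, p a1 -
    1 and p (a1 - 1); only the second survives. The coefficient c is the reduction of A / p and is
    left unevaluated, because [nu] kills [XX]. *)
Lemma rd_subA_VV l : exists c : Fbar,
  rd D (pi^-1 *: subA l VV)
    (c *: XX Fbar + (r0%:R * (- iota l) ^+ (p * a1 - 2)) *: ww).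
Proof.
have [pa1 pa2] := andP (pa1_bounds p_prime a1_bounds); have p1 := prime_gt1 p_prime.
have q1 : (p ^ 2 - p < p ^ 2 - 1)%N by clear -p1; nia.
have h0 := r0_gt1; have h1 := r1_gt1; have chp := pFbar D p_prime.
have b1 : (0 < p * a1 < p ^ 2 - 1)%N by clear -pa1 pa2 q1 p1; lia.
have b2 : (0 < r0 + p * r1)%N by clear -h0; lia.
have b3 : (0 < r0.-1 + p * r1)%N by clear -h0; lia.
have b4 : (0 < p * a1 - 1 < p ^ 2 - 1)%N by clear -pa1 pa2 q1 p1; lia.
have b5 : r0.-1 + p * r1 = p * a1 - 1 %[mod p ^ 2 - 1].
  have -> : (r0.-1 + p * r1 = r0 + p * r1 - 1)%N by clear -h0; lia.
  by apply: modn_sub_congr r_mod; [exact: b2 | case/andP: b1].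
have e1 : (p * a1 - 1).-1 = (p * a1 - 2)%N by clear; lia.
have b6 : (0 < r0 + p * r1.-1)%N by apply: leq_trans (leq_addr _ _); exact: ltnW.
have subV : subA l VV = \sum_t ct t *: (((TE t - TE l) *: 'X_iX0 + (pi * 1) *: 'X_iY0) ^+ r0 *
     ((TE t ^+ p + (- TE l) ^+ p) *: 'X_iX1 + (pi * 1) *: 'X_iY1) ^+ r1).
  rewrite /VV subAE subst_sum; apply: eq_bigr => t _; rewrite -subAE.
  rewrite subAE substZ /Vt substM !substXn !substD !substZ -!subAE !subA_vars !mulr1.
  by rewrite !addrA -!scalerDl.
have [iA rA] := red_sumA l r0 r1.
set A := \sum_t _ in iA rA.
have rA0 : red A = 0.
  rewrite rA (sumFq _ b2 b1 r_mod).
  by rewrite rmorphN rmorphM rmorph_nat natrM (pcharf0 chp) !mul0r oppr0.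
(* A is the image of an element of L, where reduction 0 gives divisibility by p even if E is
   ramified. *)
have vA : vge v 1 A.
  have AE : A = (\sum_t teich D t ^+ (p ^ 2 - 2) * ((teich D t - teich D l) ^+ r0 *
      (teich D t ^+ p + (- teich D l) ^+ p) ^+ r1))%:A.
    rewrite -in_algE rmorph_sum; apply: eq_bigr => t _.
    by rewrite !(rmorphM, rmorphXn, rmorphB, rmorphD, rmorphN).
  by rewrite AE in iA rA0 *; exact: vge1_L.
have := @rd_sum_lin2 _ _ _ _ _ _ D p_prime iX0 iY0 iX1 iY1 r0 r1 ct (fun t => TE t - TE l)
  (fun t => TE t ^+ p + (- TE l) ^+ p) (fun=> 1) (fun=> 1) ct_int (dt_int l) (dt'_int l)
  (fun=> int1 D) (fun=> int1 D) vA.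
cbv zeta; rewrite -subV.
have mul1 (f : Fq -> E) : \sum_t ct t * (f t * 1) = \sum_t ct t * f t.
  by apply: eq_bigr => t _; rewrite mulr1.
rewrite !mul1.
have [_ ->] := red_sumA l r0.-1 r1; have [_ ->] := red_sumA l r0 r1.-1.
rewrite (sumFq _ b3 b4 b5) e1.
have -> : r1%:R * iota (\sum_t t ^+ (p ^ 2 - 2) * (t - l) ^+ (r0 + p * r1.-1)) = 0.
  (* For a1 = 1 the exponent is divisible by q - 1, out of the range of [sumFq]; the factor r1 is
     then 0 modulo p. *)
  have [a11|a1n] := eqVneq a1 1%N.
    have /eqP -> : r1%:R == 0 :> Fbar by rewrite -(dvdn_pcharf chp) r1_div.
    by rewrite mul0r.
  have c1 : (1 < a1)%N by case/andP: a1_bounds => + _; clear -a1n; lia.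
  have c2 : (p * (a1 - 1) = p * a1 - p)%N by rewrite mulnBr muln1.
  have c3 : (p < p * a1)%N by rewrite -{1}[p]muln1 ltn_pmul2l // prime_gt0.
  have c4 : (0 < p * (a1 - 1) < p ^ 2 - 1)%N by rewrite c2; clear -c3 pa2 q1; lia.
  have c5 : r0 + p * r1.-1 = p * (a1 - 1) %[mod p ^ 2 - 1].
    have -> : (r0 + p * r1.-1 = r0 + p * r1 - p)%N.
      by rewrite -subn1 mulnBr muln1 addnBA // -{1}[p]muln1 leq_mul2l orbC ltnW.
    rewrite c2; apply: modn_sub_congr r_mod; last exact: pa1.
    by apply: leq_trans (leq_addl _ _); rewrite -{1}[p]muln1 leq_mul2l orbC ltnW.
  rewrite (sumFq _ b6 c4 c5).
  by rewrite rmorphN rmorphM rmorph_nat natrM (pcharf0 chp) !mul0r oppr0 mulr0.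
rewrite scale0r addr0 rmorphN rmorphM rmorph_nat rmorphXn rmorphN.
rewrite natrB; last by case/andP: b1.
rewrite natrM (pcharf0 chp) mul0r sub0r mulN1r opprK => H.
by exists (red (pi^-1 * A)); exact: H.
Qed.

(** The sum of the [t]^(q-2) vanishes exactly, by t -> -t, as q - 2 is odd. At first order the term
    with X_0 sums t^(q-1) to -1, and the term with X_1 vanishes because q - 2 + p lies strictly
    between q - 1 and 2 (q - 1). *)
Lemma rd_subB_VV : rd D (pi^-1 *: subB VV) (- r0%:R *: ww').
Proof.
have p1 := prime_gt1 p_prime; have q1 := q_gt1 p_prime.
have subV : subB VV = \sum_t ct t *: ((1 *: 'X_iY0 + (pi * TE t) *: 'X_iX0) ^+ r0 *
     (1 *: 'X_iY1 + (pi * TE t ^+ p) *: 'X_iX1) ^+ r1).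
  rewrite /VV subBE subst_sum; apply: eq_bigr => t _.
  rewrite substZ /Vt substM !substXn !substD !substZ -!subBE !subB_vars !scale1r.
  by rewrite !scalerA ![_ * pi]mulrC ![_ + 'X_iY0]addrC ![_ + 'X_iY1]addrC.
have A0 : \sum_t ct t = 0.
  have podd : odd p by have [p2|//] := even_prime p_prime; move: p_gt2; rewrite p2.
  apply/eqP.
  have : \sum_t ct t = - \sum_t ct t.
    rewrite {1}(reindex_inj oppr_inj) -sumrN; apply: eq_bigr => t _.
    rewrite /ct TEN // -[- TE t]mulN1r exprMn -signr_odd oddB // oddX /=.
    by rewrite podd expr1 mulN1r.
  move=> /eqP; rewrite -addr_eq0 -mulr2n -mulr_natl mulf_eq0 => /orP[|//].
  by rewrite (negPf (natE_neq0 D _)).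
have vA : vge v 1 (\sum_t ct t * (1 ^+ r0 * 1 ^+ r1)).
  by under eq_bigr do rewrite !expr1n !mulr1; rewrite A0 vge0.
have iT t : vge v 0 (TE t) := TE_int D t.
have iTp t : vge v 0 (TE t ^+ p) := intX p (iT t).
have := @rd_sum_lin2 _ _ _ _ _ _ D p_prime iY0 iX0 iY1 iX1 r0 r1 ct (fun=> 1)
  (fun=> 1) TE (fun t => TE t ^+ p) ct_int (fun=> int1 D) (fun=> int1 D) iT iTp vA.
rewrite -subV; under [X in pi^-1 * X]eq_bigr do rewrite !expr1n !mulr1.
rewrite A0 mulr0 red0 scale0r add0r.
have rs k : red (\sum_t ct t * (1 ^+ k * 1 ^+ r1 * TE t)) = -1.
  rewrite red_sum => [|t _]; last by rewrite !expr1n !mul1r intM ?ct_int.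
  have -> : -1 = iota (\sum_t t ^+ (p ^ 2 - 1)).
    by rewrite sum_expf q1E dvdnn (_ : (0 < _)%N = true) ?rmorphN ?rmorph1 //; clear -q1; lia.
  rewrite rmorph_sum; apply: eq_bigr => t _.
  rewrite !expr1n !mul1r /ct -exprSr redXn // TE_red rmorphXn; congr (_ ^+ _).
  by clear -q1; lia.
have rs' k : red (\sum_t ct t * (1 ^+ r0 * 1 ^+ k * TE t ^+ p)) = 0.
  rewrite red_sum => [|t _]; last by rewrite !expr1n !mul1r intM ?ct_int.
  transitivity (iota (\sum_t t ^+ (p ^ 2 - 2 + p))); last first.
    rewrite sum_expf q1E; case: ifP => [/andP[_ /dvdnP[d dE]]|_]; last by rewrite rmorph0.
    have pq : (p < p ^ 2)%N by clear -p1; nia.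
    have lem Z : (p ^ 2 - 2 + p <> p ^ 2 - 1 + (p ^ 2 - 1 + Z))%N by clear -pq p1; lia.
    case: d dE => [|[|d]]; rewrite ?mulSn ?mul0n; last by move/lem.
      by clear -p1; lia.
    by clear -p1 pq; lia.
  rewrite rmorph_sum; apply: eq_bigr => t _.
  by rewrite !expr1n !mul1r /ct -exprD redXn // TE_red rmorphXn.
by rewrite rs rs' mulr0 scale0r addr0 mulrN1; exact.
Qed.

Lemma nu_hecke g : g \in unitmx ->
  \sum_l (- iota l) ^+ (p * a1 - 2) *: nu (g *m hA l) ww = nu (g *m hB) ww'.
Proof.
move=> gu; have [F [H [hF hH hFe]]] := VV_hecke gu.
have /choice[c hc] := rd_subA_VV.
have := nu_second p_prime ap_neq0 ap_val gu VV_hom hc rd_subB_VV hF hH hFe.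
have guA l := gA_unit D p_prime l gu; have guB := gB_unit D p_prime gu.
have hX := @XX_hom Fbar; have hw := ww_hom; have hw' := ww'_hom.
have hwZ (b : Fbar) := bihomogZ (a := b) hw.
rewrite (nuZ D p_prime ap _ guB hw').
have -> : \sum_l nu (g *m hA l) (c l *: XX Fbar + (r0%:R * (- iota l) ^+ (p * a1 - 2)) *: ww)
  = r0%:R *: \sum_l (- iota l) ^+ (p * a1 - 2) *: nu (g *m hA l) ww.
  rewrite scaler_sumr; apply: eq_bigr => l _.
  rewrite (nuZD D p_prime ap _ (guA l) hX (hwZ _)) (nu_XX (guA l)) scaler0 add0r.
  by rewrite (nuZ D p_prime ap _ (guA l) hw) scalerA.
move=> /eqP; rewrite scaleNr subr_eq0 => /eqP.
have r0n : r0%:R != 0 :> Fbar by rewrite -(dvdn_pcharf (pFbar D p_prime)).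
by move=> /(scalerI r0n).
Qed.

End HeckeRelation.

(** * Monomials in Q *)

Lemma coef_XD1 (R : comNzRingType) n k : (('X + 1) ^+ n : {poly R})`_k = 'C(n, k)%:R.
Proof.
rewrite addrC exprDn coef_sum; under eq_bigr do rewrite expr1n mul1r coefMn coefXn.
have [kn|nk] := ltnP k n.+1; last first.
  rewrite bin_small // big1 // => i _; rewrite gtn_eqF ?mul0rn //.
  exact: leq_trans (ltn_ord i) nk.
rewrite (bigD1 (Ordinal kn)) //= eqxx big1 ?addr0 // => i ik.
by rewrite eq_sym (_ : (_ == k) = false) ?mul0rn //; apply/negbTE.
Qed.

Lemma coef_lin_exp (R : comNzRingType) (c d : R) n :
  (size ((c%:P + d *: 'X) ^+ n) <= n.+1)%N /\ ((c%:P + d *: 'X) ^+ n)`_n = d ^+ n.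
Proof.
elim: n => [|n [IHs IHc]]; first by rewrite !expr0 size_poly1 coef1.
have lE (Q : {poly R}) k : ((c%:P + d *: 'X) * Q)`_k.+1 = c * Q`_k.+1 + d * Q`_k.
  by rewrite mulrDl coefD coefCM -scalerAl coefZ coefXM.
rewrite !exprS lE IHc (nth_default _ IHs) mulr0 add0r; split=> //.
by apply/leq_sizeP => -[//|k] nk; rewrite lE !nth_default ?mulr0 ?addr0 //;
  apply: leq_trans IHs _; lia.
Qed.

Lemma bin_pchar (R : comNzRingType) p n k : p \in [pchar R] -> (n < p)%N -> (k <= n)%N ->
  'C(n, k)%:R != 0 :> R.
Proof.
move=> chp np kn; rewrite -(dvdn_pcharf chp).
have pp := pcharf_prime chp.
have fact_ndvd m : (m < p)%N -> ~~ (p %| m`!)%N.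
  elim: m => [|m IH] mp; first by rewrite fact0 dvdn1 gtn_eqF ?prime_gt1.
  by rewrite factS Euclid_dvdM // negb_or IH ?(ltnW mp) // gtnNdvd.
apply/negP => pC; case/negP: (fact_ndvd n np).
by rewrite -(bin_fact kn) dvdn_mulr.
Qed.

(** Multiply by t^K with K > 0 and b + K a multiple of q - 1: the power sum on the side of b is -1,
    which forces q - 1 to divide a + K. *)
Lemma exp_inj_mod (F : finFieldType) a b :
  (forall t : F, t != 0 -> t ^+ a = t ^+ b) -> a = b %[mod #|F|.-1].
Proof.
move=> tab; set q1 := #|F|.-1.
have q0 : (0 < q1)%N by have := card_gt1 F; rewrite /q1; lia.
pose K := (q1 * b.+1 - b)%N.
have K0 : (0 < K)%N by rewrite /K subn_gt0; nia.
have bK : (b + K = q1 * b.+1)%N by rewrite /K subnKC //; nia.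
have : \sum_(t : F) t ^+ (a + K) = \sum_(t : F) t ^+ (b + K).
  apply: eq_bigr => t _; rewrite !exprD; have [->|t0] := eqVneq t 0.
    by rewrite [0 ^+ K]expr0n gtn_eqF // !mulr0.
  by rewrite tab.
rewrite !sum_expf -/q1 bK dvdn_mulr // addn_gt0 K0 orbT muln_gt0 q0 /=.
case: ifP => [qa _|_ /eqP]; last by rewrite eq_sym oppr_eq0 oner_eq0.
by apply/eqP; rewrite -(eqn_modDr K) bK modnMr; exact: qa.
Qed.

Section Quotient.
Variables (p : nat) (Qp : fieldType) (L : fieldExtType Qp) (E : fieldExtType L).
Variables (Fq : finFieldType) (Fbar : closedFieldType).
Variable D : padic_setting p E Fq Fbar.
Hypotheses (p_prime : prime p).
Variables (r0 r1 : nat).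
Local Notation iota := (Defs.iota D).
Local Notation projQ := (projQ D r0 r1).
Local Notation kills := (lspan (fun S => Vstar p r0 r1 S \/ Xr D r0 r1 S)).
Local Notation Gact := (Gact D).
Local Notation mY := (monY Fbar r0 r1).
Implicit Types (S T : {mpoly Fbar[4]}) (m : 'M[Fq]_2).

Lemma projQZD a S T : projQ (a *: S + T) = a *: projQ S + projQ T.
Proof. exact: proj_is_linear. Qed.
Lemma projQ0 : projQ 0 = 0. Proof. exact: linear0. Qed.
Lemma projQZ a S : projQ (a *: S) = a *: projQ S. Proof. exact: linearZ. Qed.
Lemma projQD S T : projQ (S + T) = projQ S + projQ T. Proof. exact: linearD. Qed.
Lemma projQ_sum (I : Type) (r : seq I) (C : pred I) (F : I -> {mpoly Fbar[4]}) :
  projQ (\sum_(i <- r | C i) F i) = \sum_(i <- r | C i) projQ (F i).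
Proof. exact: linear_sum. Qed.

Lemma projQ_eq0 S : projQ S = 0 <-> kills S.
Proof. by rewrite -projQ0; split=> [/projP|?]; [|apply/projP]; rewrite subr0. Qed.

Lemma projQ_eq S T : projQ S = projQ T <-> kills (S - T).
Proof. exact: projP. Qed.

Lemma iota_frob_mx m (n : 'M[Fq]_2) :
  map_mx (fun a => iota a ^+ p) (m *m n) =
  map_mx (fun a => iota a ^+ p) m *m map_mx (fun a => iota a ^+ p) n.
Proof.
apply/matrixP => i j; rewrite mxE !mulmx2E rmorphD !rmorphM.
by rewrite frobD ?(pFbar D) // !exprMn !mxE.
Qed.

Lemma GactM m (n : 'M[Fq]_2) S : Gact m (Gact n S) = Gact (m *m n) S.
Proof. by rewrite /Gact subst_comp iota_frob_mx map_mxM. Qed.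

Lemma Gact1 S : Gact 1%:M S = S.
Proof.
rewrite /Gact map_mx1 (_ : map_mx _ _ = 1%:M) ?subst_id //.
apply/matrixP => i j; rewrite !mxE; case: eqP => _; rewrite ?rmorph1 ?expr1n //.
by rewrite rmorph0 expr0n gtn_eqF // prime_gt0.
Qed.

Lemma GactZD m a S T : Gact m (a *: S + T) = a *: Gact m S + Gact m T.
Proof. by rewrite /Gact substD substZ. Qed.

Lemma GactZ m a S : Gact m (a *: S) = a *: Gact m S.
Proof. by rewrite /Gact substZ. Qed.

Lemma Gact_vars m : (Gact m 'X_iX0 = iota (m 0 0) *: 'X_iX0 + iota (m 1 0) *: 'X_iY0) *
  (Gact m 'X_iY0 = iota (m 0 1) *: 'X_iX0 + iota (m 1 1) *: 'X_iY0) *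
  (Gact m 'X_iX1 = iota (m 0 0) ^+ p *: 'X_iX1 + iota (m 1 0) ^+ p *: 'X_iY1) *
  (Gact m 'X_iY1 = iota (m 0 1) ^+ p *: 'X_iX1 + iota (m 1 1) ^+ p *: 'X_iY1).
Proof. by rewrite /Gact !substE !mxE. Qed.

Lemma GactMul m S T : Gact m (S * T) = Gact m S * Gact m T.
Proof. by rewrite /Gact substM. Qed.
Lemma GactX m S n : Gact m (S ^+ n) = Gact m S ^+ n.
Proof. by rewrite /Gact substXn. Qed.
Lemma GactB m S T : Gact m (S - T) = Gact m S - Gact m T.
Proof. by rewrite /Gact substB. Qed.
Lemma GactD m S T : Gact m (S + T) = Gact m S + Gact m T.
Proof. by rewrite /Gact substD. Qed.
Lemma Gact0 m : Gact m 0 = 0.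
Proof. by rewrite /Gact subst0. Qed.

Lemma iota_q (x : Fq) : (iota x ^+ p) ^+ p = iota x.
Proof. by rewrite -exprM mulnn -(Fq_card D) -rmorphXn expf_card. Qed.

Lemma pchar_mpoly : p \in [pchar {mpoly Fbar[4]}].
Proof.
rewrite inE p_prime; apply/eqP.
by rewrite -(rmorph_nat (@mpolyC 4 Fbar)) (pcharf0 (pFbar D p_prime)) rmorph0.
Qed.

Lemma frobZD (a b : Fbar) (x y : {mpoly Fbar[4]}) :
  (a *: x + b *: y) ^+ p = a ^+ p *: x ^+ p + b ^+ p *: y ^+ p.
Proof. by rewrite (frobD _ _ pchar_mpoly) !exprZn. Qed.

(** The scalar is det m for theta_0 and (det m)^p for theta_1, so that V_r^* is stable under
    Gamma. *)
Lemma Gact_theta0 m : exists c, Gact m (theta0 Fbar p) = c *: theta0 Fbar p.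
Proof.
exists (iota (m 0 0) * iota (m 1 1) - iota (m 0 1) * iota (m 1 0)).
rewrite /theta0 GactB (GactMul _ 'X_iX0) (GactMul _ 'X_iY0) !GactX !Gact_vars.
rewrite !frobZD !iota_q -!mul_mpolyC !(rmorphB, rmorphM) /=; ring.
Qed.

Lemma Gact_theta1 m : exists c, Gact m (theta1 Fbar p) = c *: theta1 Fbar p.
Proof.
exists (iota (m 0 0) ^+ p * iota (m 1 1) ^+ p - iota (m 0 1) ^+ p * iota (m 1 0) ^+ p).
rewrite /theta1 GactB (GactMul _ 'X_iX1) (GactMul _ 'X_iY1) !GactX !Gact_vars.
rewrite !frobZD -!mul_mpolyC !(rmorphB, rmorphM) /=; ring.
Qed.

Lemma kills_Gact m S : m \in unitmx -> kills S -> kills (Gact m S).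
Proof.
move=> mu; elim=> [|a x y hx _ IH]; first by rewrite Gact0; exact: span0.
rewrite GactZD; apply: (spanD (spanZ a (span_gen _)) IH).
case: hx => [[hx [P0 [P1 xE]]]|hx]; [left|right].
  split; first exact: subst_bihomog.
  have [c0 t0] := Gact_theta0 m; have [c1 t1] := Gact_theta1 m.
  exists (c0 *: Gact m P0), (c1 *: Gact m P1).
  rewrite xE; apply: etrans (GactD _ _ _) _.
  apply: add_congr; apply: etrans (GactMul _ _ _) _.
    by rewrite t0 -scalerAl scalerAr.
  by rewrite t1 -scalerAl scalerAr.
elim: hx {IH} => [|b u w [n nu ->] _ IH]; first by rewrite Gact0; exact: span0.
rewrite GactZD; apply: (spanD (spanZ b (span_gen _)) IH).
exists (m *m n); last exact: GactM.
by rewrite unitmx_mul mu.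
Qed.

Lemma GactQ_proj m S : m \in unitmx -> GactQ m (projQ S) = projQ (Gact m S).
Proof.
move=> mu; apply/projQ_eq; rewrite -GactB; apply: kills_Gact => //.
by apply/projQ_eq; exact: proj_repr.
Qed.

Lemma KZactQ_proj h S : inKZ D h -> KZactQ h (projQ S) = projQ (KZactF D h S).
Proof.
move=> hK; have [m mu hm] := KZactF_Gact p_prime hK.
rewrite /KZactQ !hm; apply/projQ_eq; rewrite -GactB; apply: kills_Gact => //.
by apply/projQ_eq; exact: proj_repr.
Qed.

Lemma kills_XX : kills (XX r0 r1 Fbar).
Proof.
apply: span_gen; right; apply: span_gen; exists 1%:M; first exact: unitmx1.
by rewrite Gact1.
Qed.

Lemma kills_GXX m : m \in unitmx -> kills (Gact m (XX r0 r1 Fbar)).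
Proof. by move=> mu; apply: kills_Gact => //; exact: kills_XX. Qed.

Lemma kills_YY : kills (YY r0 r1 Fbar).
Proof.
have -> : YY r0 r1 Fbar = Gact (w0 Fq) (XX r0 r1 Fbar).
  by rewrite /XX /YY GactMul !GactX !(Gact_w0_vars D p_prime).
exact: kills_GXX (w0_unit Fq).
Qed.

Lemma mon_theta1 i j : (i + p <= r0)%N -> (j < r1)%N ->
  projQ (mY (i + p) j) = projQ (mY i j.+1).
Proof.
move=> hi hj; apply/projQ_eq; apply: span_gen; left; split.
  by apply: bihomogB; apply: bihomog_monY => //; lia.
exists 0, ('X_iX0 ^+ (r0 - (i + p)) * 'X_iY0 ^+ i * ('X_iX1 ^+ (r1 - j.+1) * 'X_iY1 ^+ j)).
apply: etrans (esym (etrans (add_congr (mulr0 _) erefl) (add0r _))).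
rewrite /monY /theta1.
have -> : (r0 - i = (r0 - (i + p)) + p)%N by lia.
have -> : (r1 - j = (r1 - j.+1).+1)%N by lia.
rewrite !exprD !exprS; ring.
Qed.

Lemma mon_theta0 i j : (i < r0)%N -> (j + p <= r1)%N ->
  projQ (mY i (j + p)) = projQ (mY i.+1 j).
Proof.
move=> hi hj; apply/projQ_eq; apply: span_gen; left; split.
  by apply: bihomogB; apply: bihomog_monY => //; lia.
exists ('X_iX0 ^+ (r0 - i.+1) * 'X_iY0 ^+ i * ('X_iX1 ^+ (r1 - (j + p)) * 'X_iY1 ^+ j)), 0.
apply: etrans (esym (etrans (add_congr erefl (mulr0 _)) (addr0 _))).
rewrite /monY /theta0.
have -> : (r1 - j = (r1 - (j + p)) + p)%N by lia.
have -> : (r0 - i = (r0 - i.+1).+1)%N by lia.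
rewrite !exprD !exprS; ring.
Qed.

Lemma mon_chain t i j : (i + p * t <= r0)%N -> (j + t <= r1)%N ->
  projQ (mY (i + p * t) j) = projQ (mY i (j + t)).
Proof.
elim: t i j => [|t IH] i j hi hj; first by rewrite muln0 !addn0.
rewrite mulnS [(p + _)%N]addnC addnA mon_theta1; [|by lia|by lia].
by rewrite IH; [congr (projQ (monY _ _ _ _ _)); lia | lia | lia].
Qed.

(** theta_1 identifies X_1 Y_0^p with X_0^p Y_1, which trades p units of i for one of j. *)
Lemma mon_eq i j i' j' : (i <= r0)%N -> (j <= r1)%N -> (i' <= r0)%N -> (j' <= r1)%N ->
  (i + p * j = i' + p * j')%N -> projQ (mY i j) = projQ (mY i' j').
Proof.
wlog jj : i j i' j' / (j <= j')%N.
  move=> W hi hj hi' hj' e; have [jj|jj] := leqP j j'; first exact: W.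
  by apply/esym; apply: W => //; exact: ltnW.
move=> hi hj hi' hj' e; have pj : (p * j <= p * j')%N by rewrite leq_mul2l jj orbT.
have iE : i = (i' + p * (j' - j))%N by rewrite mulnBr; clear -pj e; lia.
by rewrite iE mon_chain -?iE // subnKC.
Qed.

Hypotheses (r0_ge : (p ^ 2 <= r0)%N) (r1_ge : (p ^ 2 <= r1)%N).

(** theta_0 identifies X_0 Y_1^p with Y_0 X_1^p and so lowers i + p j by q - 1. Together with
    [mon_eq] this descends to the range from 1 to q - 1. The excluded values 0 and r0 + p r1 belong
    to [XX] and [YY], which these two exchanges cannot reach. *)
Lemma mon_red i j : (i <= r0)%N -> (j <= r1)%N -> (0 < i + p * j < r0 + p * r1)%N ->
  exists n, [/\ (0 < n <= p ^ 2 - 1)%N, n = i + p * j %[mod p ^ 2 - 1]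
     & projQ (mY i j) = projQ (mY n 0)].
Proof.
have p0 := prime_gt0 p_prime; have q1 := q_gt1 p_prime.
move: {2}(i + p * j)%N (erefl (i + p * j)%N) => N.
elim/ltn_ind: N i j => N IH i j NE hi hj; rewrite NE => /andP[N0 N1].
have [Nq|Nq] := leqP N (p ^ 2 - 1).
  exists N; split; rewrite ?N0 ?NE //.
  by apply: mon_eq => //; [clear -Nq r0_ge; lia | rewrite muln0 addn0].
pose M := (N - (p ^ 2 - 1))%N.
have M0 : (0 < M)%N by rewrite /M subn_gt0.
have MN : N = (M + (p ^ 2 - 1))%N by rewrite /M subnK // ltnW.
have [i0 [j0 [h1 h2 h3]]] : exists i0 j0, [/\ (i0 < r0)%N, (j0 + p <= r1)%N &
    (i0.+1 + p * j0 = M)%N].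
  have pr1 : (p <= r1)%N by apply: leq_trans r1_ge; rewrite leq_pmulr.
  have pr0 : (p <= r0)%N by apply: leq_trans r0_ge; rewrite leq_pmulr.
  (* Divide M - 1 by p, with the quotient capped at r1 - p to leave room for Y_1^p. In the capped
     case i0 = N - p r1, which is below r0. *)
  have [hd|hd] := leqP (M.-1 %/ p) (r1 - p).
    exists (M.-1 %% p)%N, (M.-1 %/ p)%N; split; first exact: leq_trans (ltn_pmod _ p0) pr0.
      by clear -hd pr1; lia.
    by rewrite addSn addnC mulnC -divn_eq prednK.
  exists (M.-1 - p * (r1 - p))%N, (r1 - p)%N.
  have hm : (p * (r1 - p) <= M.-1)%N.
    by apply: leq_trans (leq_trunc_div _ p); rewrite mulnC leq_mul2r ltnW ?orbT.
  have e1 : (p * (r1 - p) = p * r1 - p ^ 2)%N by rewrite mulnBr mulnn.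
  have e2 : (p ^ 2 <= p * r1)%N by rewrite -mulnn leq_mul2l pr1 orbT.
  split; [|by rewrite subnK | by rewrite addSn subnK // prednK].
  by clear -e1 e2 hm N1 MN M0 q1; lia.
have [n [n1 n2 n3]] : exists n, [/\ (0 < n <= p ^ 2 - 1)%N, n = i0.+1 + p * j0 %[mod p ^ 2 - 1]
     & projQ (mY i0.+1 j0) = projQ (mY n 0)].
  apply: (IH M); rewrite ?h3 //.
  - by clear -MN q1; lia.
  - by clear -h2; lia.
  - by rewrite M0 (leq_ltn_trans _ N1) // MN leq_addr.
exists n; split=> //; first by rewrite n2 h3 MN modnDr.
rewrite -n3 -mon_theta0 //; apply: mon_eq => //; first exact: ltnW.
rewrite NE mulnDr mulnn MN -h3; clear -q1; lia.
Qed.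

End Quotient.

(** * Elements of V_r as functions on pairs in F_q, and torus eigenvectors in Q *)

Section Socle.
Variables (p : nat) (Qp : fieldType) (L : fieldExtType Qp) (E : fieldExtType L).
Variables (Fq : finFieldType) (Fbar : closedFieldType).
Variable D : padic_setting p E Fq Fbar.
Hypotheses (p_prime : prime p) (p_gt2 : (2 < p)%N).
Variables (r0 r1 a1 : nat).
Hypotheses (r0_ge : (p ^ 2 <= r0)%N) (r1_ge : (p ^ 2 <= r1)%N).
Hypotheses (a1_bounds : (1 <= a1 <= p - 1)%N).
Hypotheses (r_mod : (r0 + p * r1 = p * a1 %[mod p ^ 2 - 1])%N).
Local Notation iota := (Defs.iota D).
Local Notation Qamb := (Qamb D r0 r1).
Local Notation projQ := (projQ D r0 r1).
Local Notation kills := (lspan (fun S => Vstar p r0 r1 S \/ Xr D r0 r1 S)).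
Local Notation Gact := (Gact D).
Local Notation mY := (monY Fbar r0 r1).
Local Notation q1 := (p ^ 2 - 1)%N.
Implicit Types (S T : {mpoly Fbar[4]}) (m : 'M[Fq]_2).

(* theta_0 and theta_1 vanish at (x, y, x^p, y^p) for x, y in F_q, so ev kills V_r^*. *)
Definition ev (x y : Fq) S : Fbar :=
  S.@[fun i : 'I_4 => nth 0 [:: iota x; iota y; iota x ^+ p; iota y ^+ p] i].

Lemma ev_vars x y : (ev x y 'X_iX0 = iota x) * (ev x y 'X_iY0 = iota y) *
  (ev x y 'X_iX1 = iota x ^+ p) * (ev x y 'X_iY1 = iota y ^+ p).
Proof. by rewrite /ev !mevalXU /= !inordK. Qed.
Lemma evM x y S T : ev x y (S * T) = ev x y S * ev x y T. Proof. exact: mevalM. Qed.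
Lemma evD x y S T : ev x y (S + T) = ev x y S + ev x y T. Proof. exact: mevalD. Qed.
Lemma evB x y S T : ev x y (S - T) = ev x y S - ev x y T. Proof. exact: mevalB. Qed.
Lemma evZ x y a S : ev x y (a *: S) = a * ev x y S. Proof. exact: mevalZ. Qed.
Lemma evX x y S n : ev x y (S ^+ n) = ev x y S ^+ n.
Proof. by rewrite /ev rmorphXn. Qed.
Lemma ev0 x y : ev x y 0 = 0. Proof. exact: meval0. Qed.
Lemma ev1 x y : ev x y 1 = 1. Proof. exact: meval1. Qed.
Lemma ev_sum x y (I : Type) (r : seq I) (C : pred I) (F : I -> {mpoly Fbar[4]}) :
  ev x y (\sum_(i <- r | C i) F i) = \sum_(i <- r | C i) ev x y (F i).
Proof. by rewrite /ev rmorph_sum. Qed.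

Lemma ev_Gact x y m S :
  ev x y (Gact m S) = ev (x * m 0 0 + y * m 1 0) (x * m 0 1 + y * m 1 1) S.
Proof.
have chp := pFbar D p_prime.
elim/mpoly4_ind: S => [a P Q IHP IHQ|P Q IHP IHQ||||||].
- by rewrite GactZD !evD !evZ IHP IHQ.
- by rewrite GactMul !evM IHP IHQ.
- by rewrite Gact0 !ev0.
- by rewrite /Defs.Gact subst1 !ev1.
all: rewrite Gact_vars evD !evZ !ev_vars rmorphD !rmorphM ?(frobD _ _ chp) ?exprMn;
  by ring.
Qed.

Lemma ev_theta0 x y : ev x y (theta0 Fbar p) = 0.
Proof. by rewrite /theta0 evB !evM !evX !ev_vars !iota_q // [iota y * _]mulrC subrr. Qed.
Lemma ev_theta1 x y : ev x y (theta1 Fbar p) = 0.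
Proof. by rewrite /theta1 evB !evM !evX !ev_vars [iota y ^+ p * _]mulrC subrr. Qed.

Lemma ev_Vstar x y P0 P1 : ev x y (theta0 Fbar p * P0 + theta1 Fbar p * P1) = 0.
Proof.
have ev_mul0 t P : ev x y t = 0 -> ev x y (t * P) = 0 by rewrite evM => ->; rewrite mul0r.
apply: etrans (evD _ _ _ _) _.
exact: etrans (add_congr (ev_mul0 _ P0 (ev_theta0 x y)) (ev_mul0 _ P1 (ev_theta1 x y))) (addr0 0).
Qed.

Lemma ev_monY x y i j :
  ev x y (mY i j) = iota (x ^+ ((r0 - i) + p * (r1 - j)) * y ^+ (i + p * j)).
Proof.
rewrite /monY !evM !evX !ev_vars !exprD rmorphM !rmorphM !rmorphXn !exprM; ring.
Qed.

(* The functions coming from X_r: a polynomial f in y^p of degree at most a1 on the points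
   (1 : y), and its coefficient of degree a1 at infinity. *)
Definition fnM S := exists2 f : {poly Fbar}, (size f <= a1.+1)%N &
  (forall y, ev 1 y S = f.[iota y ^+ p]) /\ ev 0 1 S = f`_a1.

Lemma fnM_ZD a S T : fnM S -> fnM T -> fnM (a *: S + T).
Proof.
case=> f sf [f1 f2] [g sg [g1 g2]]; exists (a *: f + g).
  apply: leq_trans (size_polyD _ _) _; rewrite geq_max sg andbT.
  exact: leq_trans (size_scale_leq _ _) sf.
by split=> [y|]; rewrite evD evZ ?f1 ?g1 ?f2 ?g2 ?hornerE // coefD coefZ.
Qed.

Lemma fnM0 : fnM 0.
Proof. by exists 0; rewrite ?size_poly0 //; split=> [y|]; rewrite ev0 ?hornerE ?coef0. Qed.

Lemma r_gt0 : (0 < r0 + p * r1)%N.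
Proof. by apply: leq_trans (leq_addr _ _); apply: leq_trans r0_ge; exact: ltnW (q_gt1 p_prime). Qed.

Lemma pa1_gt0 : (0 < p * a1)%N.
Proof. by rewrite muln_gt0 prime_gt0 //; case/andP: a1_bounds. Qed.

Lemma exp_r (x : Fq) : x ^+ (r0 + p * r1) = x ^+ (p * a1).
Proof. by apply: expf_congr; [exact: r_gt0 | exact: pa1_gt0 | rewrite (q1E D)]. Qed.

Lemma kills_fnM S : kills S -> fnM S.
Proof.
elim=> [|a x y hx _ IH]; first exact: fnM0.
apply: fnM_ZD IH; case: hx => [[_ [P0 [P1 ->]]]|].
  exists 0; first by rewrite size_poly0.
  by split=> [y'|]; rewrite ev_Vstar ?hornerE ?coef0.
elim=> [|b u w [m mu ->] _ IH]; first exact: fnM0.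
apply: fnM_ZD IH.
have evE x' y' : ev x' y' (Gact m ('X_iX0 ^+ r0 * 'X_iX1 ^+ r1)) =
    (iota (x' * m 0 0 + y' * m 1 0) ^+ p) ^+ a1.
  by rewrite ev_Gact evM !evX !ev_vars -!exprM -exprD -!rmorphXn exp_r.
have [hs hc] := coef_lin_exp (iota (m 0 0) ^+ p) (iota (m 1 0) ^+ p) a1.
exists (((iota (m 0 0) ^+ p)%:P + iota (m 1 0) ^+ p *: 'X) ^+ a1) => //; split=> [y'|].
  rewrite evE mul1r rmorphD rmorphM (frobD _ _ (pFbar D p_prime)) exprMn.
  by rewrite horner_exp !hornerE mulrC.
by rewrite evE mul0r mul1r add0r hc.
Qed.

Lemma fnM_proj S T : projQ S = projQ T -> fnM (S - T).
Proof. by move=> /projQ_eq /kills_fnM. Qed.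

Lemma poly_fq0 (f : {poly Fbar}) : (size f <= p ^ 2)%N -> (forall y : Fq, f.[iota y] = 0) -> f = 0.
Proof.
move=> sf fy; apply: contraTeq isT => fn0.
have rs : all (root f) (map iota (enum Fq)).
  by apply/allP => _ /mapP[y _ ->]; rewrite /root fy.
have us : uniq (map iota (enum Fq)) by rewrite map_inj_uniq ?enum_uniq //; exact: fmorph_inj.
by have := max_poly_roots fn0 rs us; rewrite size_map -cardT (Fq_card D) ltnNge sf.
Qed.

Lemma size_compXp (f : {poly Fbar}) : (size f <= a1.+1)%N -> (size (f \Po 'X^p) <= p ^ 2)%N.
Proof.
move=> sf; apply: leq_trans (size_comp_poly_leq _ _) _; rewrite size_polyXn /=.
have h : ((size f).-1 * p <= (p - 1) * p)%N.
  rewrite leq_mul2r; apply/orP; right; case/andP: a1_bounds => _ h2.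
  by apply: leq_trans h2; move: sf; clear; lia.
by apply: leq_ltn_trans h _; rewrite -mulnn ltn_mul2r; have := prime_gt0 p_prime; clear; lia.
Qed.

Lemma p_gt0 : (0 < p)%N. Proof. exact: prime_gt0. Qed.

Lemma sum_iota k : \sum_(t : Fq) iota t ^+ k = if (0 < k)%N && (q1 %| k)%N then -1 else 0.
Proof.
under eq_bigr do rewrite -rmorphXn.
by rewrite -rmorph_sum sum_expf (q1E D); case: ifP => _; rewrite ?rmorphN ?rmorph1 ?rmorph0.
Qed.

Definition diagY (t : Fq) : 'M[Fq]_2 := mx2 1 0 0 t.

Lemma diagY_unit t : t != 0 -> diagY t \in unitmx.
Proof. by move=> t0; rewrite unitmxE det_mx2 mul1r mulr0 subr0 unitfE. Qed.

Lemma Gact_diagY t i j : Gact (diagY t) (mY i j) = iota t ^+ (i + p * j) *: mY i j.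
Proof.
have p0 : (p == 0)%N = false by rewrite gtn_eqF // p_gt0.
rewrite /monY !GactMul !GactX !Gact_vars !mx2E !rmorph0 !rmorph1 expr1n expr0n p0.
rewrite mulr0n !scale1r !scale0r !addr0 !add0r !exprZn -!mul_mpolyC exprD exprM !rmorphM /=.
ring.
Qed.

(** Residues are represented from 1 to q - 1 and not from 0, as the monomial with n = 0 is [XX],
    which is zero in Q. *)
Lemma mod_range n n' : (0 < n <= q1)%N -> (0 < n' <= q1)%N -> n = n' %[mod q1] -> n = n'.
Proof.
move: q1 => q /andP[n0 nq] /andP[n0' nq'] e.
have [nE|nl] := eqVneq n q.
  move: e; rewrite nE modnn => /esym/eqP; rewrite -/(_ %| _)%N => /dvdn_leq; clear -n0' nq'; lia.
have [nE'|nl'] := eqVneq n' q.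
  move: e; rewrite nE' modnn => /eqP; rewrite -/(_ %| _)%N => /dvdn_leq; clear -n0 nq nl; lia.
by move: e; rewrite !modn_small //; clear -nq nq' nl nl'; lia.
Qed.

Lemma exists_rep (m0 : nat) : exists2 n, (0 < n <= q1)%N & n = m0 %[mod q1].
Proof.
have q0 : (0 < q1)%N by have := q_gt1 p_prime; clear; lia.
have [m00|mn0] := eqVneq (m0 %% q1)%N 0%N.
  by exists q1; rewrite ?q0 ?leqnn // modnn m00.
by exists (m0 %% q1)%N; rewrite ?modn_mod // lt0n mn0 ltnW // ltn_pmod.
Qed.

(** The two monomials that escape [mon_red] lie in X_r. *)
Lemma mon_class n i j : (0 < n <= q1)%N -> (i <= r0)%N -> (j <= r1)%N ->
  n = i + p * j %[mod q1] ->
  projQ (mY i j) = projQ (mY n 0) \/ projQ (mY i j) = 0.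
Proof.
move=> nb hi hj ne.
have [/andP[]|] := boolP (0 < i + p * j < r0 + p * r1)%N.
  move=> h1 h2; have [|n' [nb' ne' ->]] := mon_red D p_prime r0_ge r1_ge hi hj.
    by rewrite h1.
  by left; rewrite (mod_range nb nb') // ne' ne.
have pj : (p * j <= p * r1)%N by rewrite leq_mul2l hj orbT.
rewrite negb_and -!leqNgt => /orP[h|h]; right; apply/projQ_eq0.
  have -> : i = 0%N by move: h; clear; lia.
  have -> : j = 0%N.
    by apply/eqP; rewrite -leqn0 -(leq_pmul2l p_gt0) muln0; move: h; clear; lia.
  have := kills_XX D p_prime r0 r1; congr lspan.
  by rewrite /monY /XX !subn0 !expr0 !mulr1.
have -> : i = r0 by move: h; clear -hi pj; lia.
have -> : j = r1.
  by apply/eqP; rewrite eqn_leq hj -(leq_pmul2l p_gt0); move: h; clear -hi pj; lia.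
have := kills_YY D p_prime r0 r1; congr lspan.
by rewrite /monY /YY !subnn !expr0 !mul1r.
Qed.

(** Averaging over the torus against the inverse character multiplies an eigenvector by q - 1 = -1
    and keeps only the monomials with i + p j = n modulo q - 1, whose classes are that of the
    monomial for n or zero. *)
Lemma torus_eigen S (m0 n : nat) : (0 < n <= q1)%N -> n = m0 %[mod q1] -> bihomog r0 r1 S ->
  (forall t, t != 0 -> iota t ^+ m0 *: projQ S = projQ (Gact (diagY t) S)) ->
  exists c, projQ S = c *: projQ (mY n 0).
Proof.
move=> nb nm hS eS; have [n0 nq] := andP nb.
(* k = -n modulo q - 1; the additional q - 1 keeps k positive for n = q - 1, so that t = 0
   contributes nothing. *)
pose k := (q1 + (q1 - n))%N.
have k0 : (0 < k)%N by rewrite /k addn_gt0 (leq_trans n0 nq).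
have kn i : n = i %[mod q1] <-> (q1 %| k + i)%N.
  rewrite /k -addnA dvdn_addr //; split=> h.
    by rewrite /dvdn -modnDmr -h modnDmr subnK // modnn.
  apply/eqP; rewrite -(eqn_modDl (q1 - n)) subnK // modnn eq_sym; exact: h.
have key t : iota t ^+ (k + m0) *: projQ S =
    \sum_(i < r0.+1) \sum_(j < r1.+1)
      (iota t ^+ (k + (i + p * j)) * S@_(mnmY r0 r1 i j)) *: projQ (mY i j).
  have [->|t0] := eqVneq t 0.
    have z e : iota 0 ^+ (k + e) = 0 by rewrite rmorph0 expr0n addn_eq0 (gtn_eqF k0).
    rewrite z scale0r big1 // => i _.
    by rewrite big1 // => j _; rewrite z mul0r scale0r.
  rewrite exprD -scalerA eS // {1}(bihomog_decomp hS) -projQZ.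
  have -> : iota t ^+ k *: Gact (diagY t) (\sum_(i < r0.+1) \sum_(j < r1.+1)
      S@_(mnmY r0 r1 i j) *: mY i j) = \sum_(i < r0.+1) \sum_(j < r1.+1)
      (iota t ^+ (k + (i + p * j)) * S@_(mnmY r0 r1 i j)) *: mY i j.
    rewrite /Defs.Gact subst_sum scaler_sumr; apply: eq_bigr => i _.
    rewrite subst_sum scaler_sumr; apply: eq_bigr => j _.
    rewrite substZ -/(Gact _ _) Gact_diagY !scalerA (exprD _ k); congr (_ *: _); ring.
  rewrite projQ_sum; apply: eq_bigr => i _; rewrite projQ_sum; apply: eq_bigr => j _.
  exact: projQZ.
have : \sum_(t : Fq) iota t ^+ (k + m0) *: projQ S = - projQ S.
  rewrite -scaler_suml sum_iota addn_gt0 k0 (_ : (q1 %| _)%N = true) ?scaleN1r //.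
  exact/kn.
under eq_bigr do rewrite key.
rewrite exchange_big /= => /eqP; rewrite -addr_eq0 addrC addr_eq0 => /eqP ->.
have cl (x y : Qamb) : (exists c, x = c *: projQ (mY n 0)) ->
    (exists c, y = c *: projQ (mY n 0)) -> exists c, x + y = c *: projQ (mY n 0).
  by case=> a -> [b ->]; exists (a + b); rewrite scalerDl.
have cl0 : exists c, 0 = c *: projQ (mY n 0) by exists 0; rewrite scale0r.
suff [c ->] : exists c, \sum_(i < r0.+1) \sum_(t : Fq) \sum_(j < r1.+1)
   (iota t ^+ (k + (i + p * j)) * S@_(mnmY r0 r1 i j)) *: projQ (mY i j) =
     c *: projQ (mY n 0) by exists (- c); rewrite scaleNr.
elim/big_ind: _ => [//|x y|i _]; first exact: cl.
rewrite exchange_big /=; elim/big_ind: _ => [//|x y|j _]; first exact: cl.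
rewrite -scaler_suml -mulr_suml sum_iota; case: ifP => [/andP[_ /kn h]|_]; last first.
  by exists 0; rewrite mul0r !scale0r.
have hi : (i <= r0)%N by rewrite -ltnS.
have hj : (j <= r1)%N by rewrite -ltnS.
case: (mon_class nb hi hj h) => ->; first by exists (-1 * S@_(mnmY r0 r1 i j)).
by exists 0; rewrite scaler0 scale0r.
Qed.

End Socle.

(** * Weights of Q *)

Section Weights.
Variables (p : nat) (Qp : fieldType) (L : fieldExtType Qp) (E : fieldExtType L).
Variables (Fq : finFieldType) (Fbar : closedFieldType).
Variable D : padic_setting p E Fq Fbar.
Hypotheses (p_prime : prime p) (p_gt2 : (2 < p)%N).
Variables (r0 r1 a1 : nat).
Hypotheses (r0_ge : (p ^ 2 <= r0)%N) (r1_ge : (p ^ 2 <= r1)%N).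
Hypotheses (a1_bounds : (1 <= a1 <= p - 1)%N).
Hypotheses (r_mod : (r0 + p * r1 = p * a1 %[mod p ^ 2 - 1])%N).
Local Notation iota := (Defs.iota D).
Local Notation Qamb := (Qamb D r0 r1).
Local Notation projQ := (projQ D r0 r1).
Local Notation Gact := (Gact D).
Local Notation mY := (monY Fbar r0 r1).
Local Notation q1 := (p ^ 2 - 1)%N.
Local Notation ev := (ev D).
Implicit Types (S T : {mpoly Fbar[4]}).

Definition upU (b : Fq) : 'M[Fq]_2 := mx2 1 b 0 1.

Lemma upU_unit b : upU b \in unitmx.
Proof. by rewrite unitmxE det_mx2 mul1r mulr0 subr0 unitr1. Qed.

Lemma pchar_poly : p \in [pchar {poly Fbar}].
Proof.
rewrite inE p_prime; apply/eqP.
by rewrite -(rmorph_nat (@polyC Fbar)) (pcharf0 (pFbar D p_prime)) rmorph0.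
Qed.

Lemma XD1_comp k : ('X + 1) ^+ (p * k) = (('X + 1) ^+ k) \Po 'X^p :> {poly Fbar}.
Proof.
by rewrite exprM (frobD _ _ pchar_poly) expr1n rmorphXn rmorphD rmorph1 /= comp_polyX.
Qed.

Lemma low_lt n : (0 < n <= q1)%N -> (n < r0)%N.
Proof.
by case/andP => _ h; apply: leq_trans r0_ge; move: h (q_gt1 p_prime); clear; lia.
Qed.

(** At the points (1, y), c ((y + 1)^n - y^n) equals f(y^p) with deg f <= a1; as all degrees are
    below q, this is an identity of polynomials. If n <> 1, the coefficient c n of y must vanish, so
    n = p k. The coefficient c k of y^(p (k - 1)) is nonzero, so k - 1 <= a1, and the value at
    infinity excludes equality. *)
Lemma U_invariant c n : (0 < n <= q1)%N -> c != 0 ->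
  projQ (Gact (upU 1) (c *: mY n 0)) = projQ (c *: mY n 0) ->
  n = 1%N \/ exists2 n1, n = (p * n1)%N & (n1 <= a1)%N.
Proof.
move=> nb c0 /(fnM_proj p_prime r0_ge a1_bounds r_mod)[f sf [f1 f2]].
have n0 : (0 < n)%N by case/andP: nb.
have nq : (n < p ^ 2)%N by case/andP: nb => _; have := q_gt1 p_prime; clear; lia.
(* The unipotent fixes the point (0, 1), so that the difference vanishes there. *)
have fa : f`_a1 = 0.
  by rewrite -f2 evB (ev_Gact D p_prime) !mx2E !(mul0r, mul1r, mulr0, mulr1, add0r) subrr.
have ev1E y : ev 1 y (c *: mY n 0) = c * iota y ^+ n.
  by rewrite evZ ev_monY expr1n mul1r muln0 addn0 rmorphXn.
have F0 : c *: (('X + 1) ^+ n - 'X^n) - (f \Po 'X^p) = 0.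
  apply: (poly_fq0 (D := D)); last first.
    move=> y; rewrite hornerD hornerN horner_comp hornerXn -f1 evB (ev_Gact D p_prime).
    rewrite !mx2E !(mul0r, mul1r, mulr0, mulr1, add0r, addr0) ev1E ev1E.
    by rewrite hornerZ hornerD hornerN hornerXn horner_exp !hornerE rmorphD rmorph1 -mulrBr
      [1 + _]addrC subrr.
  apply: leq_trans (size_polyD _ _) _; rewrite size_polyN geq_max.
  rewrite (size_compXp p_prime a1_bounds sf) andbT.
  apply: leq_trans (size_scale_leq _ _) _; apply: leq_trans (size_polyD _ _) _.
  rewrite size_polyN size_polyXn geq_max nq andbT.
  by rewrite (_ : 'X + 1 = 'X - (-1)%:P) ?size_exp_XsubC // rmorphN opprK.
have [->|n1] := eqVneq n 1%N; [by left | right].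
have pn : (p %| n)%N.
  move: (congr1 (fun g : {poly Fbar} => g`_1) F0).
  rewrite coefB coefZ coefB coef_XD1 coefXn bin1 eq_sym (negPf n1) subr0 coef0.
  rewrite coef_comp_poly_Xn ?prime_gt0 // dvdn1 gtn_eqF ?prime_gt1 // subr0.
  by move=> /eqP; rewrite mulf_eq0 (negPf c0) /= -(dvdn_pcharf (pFbar D p_prime)).
have [k nE] := dvdnP pn; exists k; first by rewrite mulnC.
have k0 : (0 < k)%N by move: n0; rewrite nE muln_gt0 => /andP[].
have kp : (k < p)%N by move: nq; rewrite nE -mulnn ltn_pmul2r // prime_gt0.
move: (congr1 (fun g : {poly Fbar} => g`_(p * k.-1)) F0).
rewrite nE [(k * p)%N]mulnC XD1_comp.
have -> : 'X^(p * k) = 'X^k \Po 'X^p :> {poly Fbar} by rewrite comp_Xn_poly exprM.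
rewrite -comp_polyB -comp_polyZ -comp_polyB coef_comp_poly_Xn ?prime_gt0 //.
rewrite dvdn_mulr // mulKn ?prime_gt0 // coefB coefZ coefB coef_XD1 coefXn coef0.
rewrite (ltn_eqF (_ : k.-1 < k)%N) ?prednK // subr0 => /eqP; rewrite subr_eq0 => /eqP fk.
have fn : f`_k.-1 != 0.
  rewrite -fk mulf_neq0 //; apply: (bin_pchar (pFbar D p_prime) kp); exact: leq_pred.
rewrite leqNgt; apply/negP => ak; case/negP: fn.
have [e|e] := eqVneq k.-1 a1; first by rewrite e fa.
by rewrite nth_default //; apply: leq_trans sf _; move: ak e; clear; lia.
Qed.

Lemma expand_lin (a b : Fbar) s : (a *: 'X_iX0 + b *: 'X_iY0) ^+ s =
  \sum_(i < s.+1) ('C(s, i)%:R * (a ^+ (s - i) * b ^+ i)) *: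
     ('X_iX0 ^+ (s - i) * 'X_iY0 ^+ i) :> {mpoly Fbar[4]}.
Proof.
rewrite exprDn; apply: eq_bigr => i _.
by rewrite !exprZn -scalerAl -scalerAr scalerA -scaler_nat scalerA.
Qed.

Lemma expand_lin' (a b : Fbar) s : (a *: 'X_iX1 + b *: 'X_iY1) ^+ s =
  \sum_(i < s.+1) ('C(s, i)%:R * (a ^+ (s - i) * b ^+ i)) *:
     ('X_iX1 ^+ (s - i) * 'X_iY1 ^+ i) :> {mpoly Fbar[4]}.
Proof.
rewrite exprDn; apply: eq_bigr => i _.
by rewrite !exprZn -scalerAl -scalerAr scalerA -scaler_nat scalerA.
Qed.

Lemma expand_prod (a b : Fbar) s0 s1 :
  (a *: 'X_iX0 + b *: 'X_iY0) ^+ s0 * (a ^+ p *: 'X_iX1 + b ^+ p *: 'X_iY1) ^+ s1 =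
  \sum_(i < s0.+1) \sum_(j < s1.+1)
    ('C(s0, i)%:R * 'C(s1, j)%:R * (a ^+ (s0 - i + p * (s1 - j)) * b ^+ (i + p * j))) *:
      monY Fbar s0 s1 i j.
Proof.
rewrite expand_lin expand_lin' mulr_suml; apply: eq_bigr => i _.
rewrite mulr_sumr; apply: eq_bigr => j _.
rewrite -scalerAl -scalerAr scalerA /monY -!exprM !exprD; congr (_ *: _); ring.
Qed.

Lemma expand_scalar (a b : Fbar) s0 s1 :
  (a + b) ^+ s0 * (a ^+ p + b ^+ p) ^+ s1 =
  \sum_(i < s0.+1) \sum_(j < s1.+1)
    'C(s0, i)%:R * 'C(s1, j)%:R * (a ^+ (s0 - i + p * (s1 - j)) * b ^+ (i + p * j)).
Proof.
rewrite !exprDn mulr_suml; apply: eq_bigr => i _.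
rewrite mulr_sumr; apply: eq_bigr => j _.
rewrite -[X in X * _ = _]mulr_natl -[X in _ * X = _]mulr_natl -!exprM !exprD; ring.
Qed.

Definition loL (t : Fq) : 'M[Fq]_2 := mx2 1 0 t 1.

Lemma loL_unit t : loL t \in unitmx.
Proof. by rewrite unitmxE det_mx2 mul1r mul0r subr0 unitr1. Qed.

Lemma Gact_loL t : Gact (loL t) (XX r0 r1 Fbar) =
  (1 *: 'X_iX0 + iota t *: 'X_iY0) ^+ r0 * (1 ^+ p *: 'X_iX1 + iota t ^+ p *: 'X_iY1) ^+ r1.
Proof. by rewrite /XX GactMul !GactX !Gact_vars !mx2E rmorph1. Qed.

(* The class of the monomial is a nonzero multiple of a torus average of X_r. *)
Lemma low_vanish k : (0 < k < a1)%N -> projQ (mY (p * k) 0) = 0.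
Proof.
move=> /andP[k0 ka]; set n := (p * k)%N.
have p0 := prime_gt0 p_prime; have [a10 a1p] := andP a1_bounds.
have [pa1 pa2] := andP (pa1_bounds p_prime a1_bounds).
have pq : (p < p ^ 2)%N by rewrite -mulnn ltn_Pmull ?prime_gt1.
have na : (n < p * a1)%N by rewrite ltn_pmul2l.
have n0 : (0 < n)%N by rewrite muln_gt0 p0.
have nb : (0 < n <= q1)%N by rewrite n0; move: na pa2 pq; clear; lia.
have nq : (n < q1)%N by move: na pa2 pq p_gt2; clear; lia.
pose e := (q1 + (q1 - n))%N.
have e0 : (0 < e)%N by rewrite /e; move: nq; clear; lia.
have en i : (q1 %| e + i)%N -> n = i %[mod q1].
  rewrite /e -addnA dvdn_addr // => h.
  by apply/eqP; rewrite -(eqn_modDl (q1 - n)) subnK ?(ltnW nq) // modnn eq_sym; exact: h.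
pose C i j : Fbar := 'C(r0, i)%:R * 'C(r1, j)%:R.
have Z0 : projQ (\sum_(t : Fq) iota t ^+ e *: Gact (loL t) (XX r0 r1 Fbar)) = 0.
  rewrite projQ_sum big1 // => t _; rewrite projQZ.
  have -> : projQ (Gact (loL t) (XX r0 r1 Fbar)) = 0.
    by apply/projQ_eq0; apply: (kills_GXX D p_prime r0 r1); exact: loL_unit.
  exact: scaler0.
have ZE : projQ (\sum_(t : Fq) iota t ^+ e *: Gact (loL t) (XX r0 r1 Fbar)) =
    \sum_(i < r0.+1) \sum_(j < r1.+1) \sum_(t : Fq)
      (C i j * iota t ^+ (e + (i + p * j))) *: projQ (mY i j).
  rewrite projQ_sum; under eq_bigr => t _.
    rewrite Gact_loL expand_prod scaler_sumr projQ_sum.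
    under eq_bigr => i _.
      rewrite scaler_sumr projQ_sum.
      under eq_bigr do rewrite scalerA projQZ expr1n mul1r mulrCA -exprD.
      over.
    over.
  rewrite exchange_big; apply: eq_bigr => i _; rewrite exchange_big; apply: eq_bigr => j _.
  exact: erefl.
have sE : \sum_(t : Fq) iota t ^+ e * ((1 + iota t) ^+ r0 * (1 ^+ p + iota t ^+ p) ^+ r1) =
    \sum_(i < r0.+1) \sum_(j < r1.+1) \sum_(t : Fq) C i j * iota t ^+ (e + (i + p * j)).
  under eq_bigr => t _.
    rewrite expand_scalar mulr_sumr.
    under eq_bigr => i _.
      rewrite mulr_sumr.
      under eq_bigr do rewrite expr1n mul1r mulrCA -exprD.
      over.
    over.
  rewrite exchange_big; apply: eq_bigr => i _; rewrite exchange_big; apply: eq_bigr => j _.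
  exact: erefl.
have main : \sum_(i < r0.+1) \sum_(j < r1.+1) \sum_(t : Fq)
      (C i j * iota t ^+ (e + (i + p * j))) *: projQ (mY i j) =
   (\sum_(i < r0.+1) \sum_(j < r1.+1) \sum_(t : Fq) C i j * iota t ^+ (e + (i + p * j)))
     *: projQ (mY n 0).
  rewrite scaler_suml; apply: eq_bigr => i _; rewrite scaler_suml; apply: eq_bigr => j _.
  rewrite -scaler_suml -mulr_sumr (sum_iota D).
  case: ifP => [/andP[_ /en h]|_]; last by rewrite mulr0 !scale0r.
  have hi : (i <= r0)%N by rewrite -ltnS.
  have hj : (j <= r1)%N by rewrite -ltnS.
  congr (_ *: _).
  have [|n' [nb' ne' ->]] := mon_red D p_prime r0_ge r1_ge hi hj; last first.
    by rewrite (mod_range nb nb') // ne'.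
  (* The extreme exponents are congruent to 0 and p a1, neither of which is n modulo q - 1, as 0 < n
     < p a1 < q - 1. *)
  have pj : (p * j <= p * r1)%N by rewrite leq_mul2l hj orbT.
  apply/andP; split.
    rewrite lt0n; apply/eqP => z; move: h; rewrite z mod0n => /eqP.
    by rewrite -/(_ %| _)%N => /(dvdn_leq n0); rewrite leqNgt nq.
  rewrite ltn_neqAle leq_add // andbT; apply/eqP => z; move: h; rewrite z r_mod.
  rewrite !modn_small //; last by move: pa2 pq p_gt2; clear; lia.
  by move=> nE; move: na; rewrite nE ltnn.
(* On F_q the product is (1 + t)^(r0 + p r1) = (1 + t)^(p a1) = (1 + t^p)^a1; the sum extracts minus
   its coefficient of t^(p k). *)
have scal : \sum_(t : Fq) iota t ^+ e * ((1 + iota t) ^+ r0 * (1 ^+ p + iota t ^+ p) ^+ r1)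
    = - 'C(a1, k)%:R.
  have sz : (size (('X + 1) ^+ (p * a1) : {poly Fbar}) <= #|Fq|.-1)%N.
    rewrite (_ : 'X + 1 = 'X - (-1)%:P) ?size_exp_XsubC ?(q1E D) ?rmorphN ?opprK //.
    by move: pa2 pq p_gt2; clear; lia.
  have jq : (n < #|Fq|.-1)%N by rewrite (q1E D).
  have := sum_extract iota sz jq.
  rewrite XD1_comp coef_comp_poly_Xn // dvdn_mulr // mulKn // coef_XD1 => <-.
  have hX t : ('X + 1 : {poly Fbar}).[iota t] = iota (1 + t).
    by rewrite !hornerE rmorphD rmorph1 addrC.
  apply: eq_bigr => t _; rewrite (q1E D) -XD1_comp horner_exp hX; congr (_ * _).
    rewrite -!rmorphXn; congr (iota _); apply: expf_congr => //; first by rewrite subn_gt0.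
    by rewrite (q1E D) /e modnDl.
  rewrite -(frobD _ _ (pFbar D p_prime)) -exprM -exprD (_ : 1 + iota t = iota (1 + t)).
    by rewrite -!rmorphXn (exp_r D p_prime r0_ge a1_bounds r_mod).
  by rewrite rmorphD rmorph1.
move: Z0; rewrite ZE main -sE scal => /eqP; rewrite scaler_eq0 => /orP[|/eqP //].
rewrite oppr_eq0 (negPf (bin_pchar (pFbar D p_prime) _ _)) //; last exact: ltnW.
by move: a1p p0; clear; lia.
Qed.

(** * Highest and lowest weight vectors of a weight in Q *)

Section Embedding.
Variables (s0 s1 m : nat) (phi : {linear {mpoly Fbar[4]} -> Qamb}).
Hypothesis emb : weight_embedding s0 s1 m phi.
Local Notation Xs := ('X_iX0 ^+ s0 * 'X_iX1 ^+ s1 : {mpoly Fbar[4]}).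
Local Notation Ys := ('X_iY0 ^+ s0 * 'X_iY1 ^+ s1 : {mpoly Fbar[4]}).

Lemma Xs_hom : bihomog s0 s1 Xs. Proof. by clear; bihom. Qed.
Lemma Ys_hom : bihomog s0 s1 Ys. Proof. by clear; bihom. Qed.

Lemma phiG g S : g \in unitmx -> bihomog s0 s1 S ->
  iota (\det g) ^+ m *: phi (Gact g S) = GactQ g (phi S).
Proof. by case: emb => _ _ _ h gu hS; rewrite -(h g S gu hS) linearZ. Qed.

Lemma phiXs_neq0 : phi Xs != 0.
Proof.
case: emb => _ _ h _; apply/eqP => /(h _ Xs_hom).2.
rewrite !mpolyXn -mpolyXD => /(congr1 (mcoeff (U_(iX0) *+ s0 + U_(iX1) *+ s1)%MM)) /eqP.
by rewrite mcoeffX eqxx mcoeff0 oner_eq0.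
Qed.

(** diag(1, t) fixes X_0 and X_1, so it acts on the highest weight vector through det^m alone, and
    [torus_eigen] applies. *)
Lemma phi_Xs : exists c n, [/\ c != 0, (0 < n <= q1)%N, n = m %[mod q1] &
  phi Xs = c *: projQ (mY n 0)].
Proof.
case: emb => _ _ h _; have [[W [hW WE]] _] := h _ Xs_hom.
have [n nb nm] := exists_rep p_prime m.
have p0 : (p == 0)%N = false by rewrite gtn_eqF // prime_gt0.
have [c cE] : exists c, projQ W = c *: projQ (mY n 0).
  apply: (torus_eigen p_prime r0_ge r1_ge nb nm hW) => t t0.
  rewrite -(GactQ_proj D p_prime) ?diagY_unit // -WE -phiG ?diagY_unit //; last exact: Xs_hom.
  rewrite det_mx2 mul1r mulr0 subr0; congr (_ *: phi _).
  rewrite GactMul !GactX !Gact_vars !mx2E rmorph0 rmorph1 expr1n expr0n p0.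
  by rewrite mulr0n !scale1r !scale0r !addr0.
exists c, n; split; rewrite ?WE //.
by apply/eqP => c0; move: phiXs_neq0; rewrite WE cE c0 scale0r eqxx.
Qed.

(** Compare central characters: a scalar t acts by t^(s0 + p s1 + 2 m) on the weight and by t^(r0 +
    p r1) on V_r. *)
Lemma scalar_weight : (s0 + p * s1 + 2 * m = p * a1 %[mod q1])%N.
Proof.
have [c [n [c0 nb nm pE]]] := phi_Xs; have nr := low_lt nb.
rewrite -r_mod -(q1E D); apply: exp_inj_mod => t t0.
have tu : mx2 t 0 0 t \in unitmx.
  by rewrite unitmxE det_mx2 mulr0 subr0 unitfE mulf_neq0.
have p0 : (p == 0)%N = false by rewrite gtn_eqF // prime_gt0.
have := phiG tu Xs_hom; rewrite det_mx2 mulr0 subr0 pE -projQZ (GactQ_proj D p_prime) //.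
have -> : Gact (mx2 t 0 0 t) Xs = iota t ^+ (s0 + p * s1) *: Xs.
  rewrite GactMul !GactX !Gact_vars !mx2E rmorph0 expr0n p0 mulr0n !scale0r !addr0.
  by rewrite !exprZn -scalerAl -scalerAr scalerA -exprM -exprD.
have -> : Gact (mx2 t 0 0 t) (c *: mY n 0) = iota t ^+ (r0 + p * r1) *: (c *: mY n 0).
  rewrite GactZ /monY !GactMul !GactX !Gact_vars !mx2E rmorph0 expr0n p0 mulr0n.
  have -> : iota t ^+ (r0 + p * r1) = iota t ^+ (r0 - n) * iota t ^+ n * (iota t ^+ p) ^+ r1.
    by rewrite -exprD subnK ?(ltnW nr) // -exprM -exprD.
  rewrite !scale0r !addr0 !add0r subn0 !expr0 !exprZn -!mul_mpolyC !rmorphM /=; ring.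
have -> : phi (iota t ^+ (s0 + p * s1) *: Xs) = iota t ^+ (s0 + p * s1) *: phi Xs.
  exact: linearZ.
rewrite projQZ projQZ pE scalerA => /eqP.
have nz : c *: projQ (mY n 0) != 0 by rewrite -pE phiXs_neq0.
have -> : iota (t * t) ^+ m * iota t ^+ (s0 + p * s1) = iota (t ^+ (s0 + p * s1 + 2 * m)).
  by rewrite -expr2 !rmorphXn -exprM -exprD addnC.
rewrite -[iota t ^+ (r0 + _)]rmorphXn -subr_eq0 -scalerBl scaler_eq0 (negPf nz) orbF.
by rewrite subr_eq0 (inj_eq (fmorph_inj iota)) => /eqP.
Qed.

Lemma weight_X_neq n1 : (n1 <= a1)%N -> (0 < n1)%N -> (n1 = a1 -> False) -> forall c : Fbar,
  c != 0 -> phi Xs = c *: projQ (mY (p * n1) 0) -> False.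
Proof.
move=> h1 h2 h3 c c0 e; move: phiXs_neq0; rewrite e low_vanish ?scaler0 ?eqxx //.
by rewrite h2 ltn_neqAle h1 andbT; apply/eqP.
Qed.

Lemma Gact_w0_X : Gact (w0 Fq) Xs = Ys.
Proof. by rewrite GactMul !GactX !(Gact_w0_vars D p_prime). Qed.

Lemma det_w0 : \det (w0 Fq) = -1.
Proof. by rewrite det_mx2 mul0r mul1r sub0r. Qed.

Lemma phi_Ys c n : phi Xs = c *: projQ (mY n 0) ->
  (-1) ^+ m *: phi Ys = projQ (c *: Gact (w0 Fq) (mY n 0)).
Proof.
move=> e; have := phiG (w0_unit Fq) Xs_hom; rewrite Gact_w0_X det_w0 rmorphN rmorph1 => ->.
by rewrite e -projQZ (GactQ_proj D p_prime) ?w0_unit // GactZ.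
Qed.

(** The powers of b that occur are positive and at most 1 + s0 + p s1, which is below q - 1 for s1
    <= p - 2. *)
Lemma sum_upU_Ys : (s1 < p - 1)%N ->
  \sum_(b : Fq) iota b *: Gact (upU b) Ys = 0.
Proof.
move=> s1p; have s0p : (s0 < p)%N by case: emb.
have p1 := prime_gt1 p_prime; have p0 : (p == 0)%N = false by rewrite gtn_eqF // prime_gt0.
have GE b : Gact (upU b) Ys =
    (iota b *: 'X_iX0 + 1 *: 'X_iY0) ^+ s0 * (iota b ^+ p *: 'X_iX1 + 1 ^+ p *: 'X_iY1) ^+ s1.
  by rewrite GactMul !GactX !Gact_vars !mx2E rmorph1.
under eq_bigr => b _.
  rewrite GE expand_prod scaler_sumr.
  under eq_bigr => i _.
    rewrite scaler_sumr.
    under eq_bigr do rewrite scalerA expr1n mulr1 mulrCA -exprS.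
    over.
  over.
rewrite exchange_big big1 // => i _; rewrite exchange_big big1 // => j _ /=.
rewrite -scaler_suml -mulr_sumr (sum_iota D); case: ifP => [|_]; last by rewrite mulr0 scale0r.
move=> /andP[_ /dvdn_leq]; rewrite ltn0Sn => /(_ isT); rewrite leqNgt => /negP[].
have h1 : (s0 - i < p)%N by apply: leq_ltn_trans s0p; exact: leq_subr.
have h2 : (p * (s1 - j) <= p * (p - 2))%N.
  by rewrite leq_mul2l; apply/orP; right; apply: leq_trans (leq_subr _ _) _; move: s1p; clear; lia.
have h3 : (p * (p - 2) = p ^ 2 - p * 2)%N by rewrite mulnBr mulnn.
have h4 : (p * 2 <= p ^ 2)%N by rewrite -mulnn leq_mul2l p1 orbT.
by move: h1 h2 h4 p_gt2; rewrite h3; clear; lia.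
Qed.

(** Transport [sum_upU_Ys] to Q and evaluate at (1, y). The translate by b gives (b + y) to a
    positive multiple of q - 1, the indicator of b <> -y, so that the weighted sum over b is c y.
    This is not of the form f(y^p) with deg f <= a1. *)
Lemma top_excluded c : (s1 < p - 1)%N -> c != 0 -> phi Xs = c *: projQ (mY (p * a1) 0) -> False.
Proof.
move=> s1p c0 e; set n := (p * a1)%N in e.
have := phi_Ys e; set W := Gact (w0 Fq) (mY n 0) => eY.
have p0 := prime_gt0 p_prime; have p1 := prime_gt1 p_prime.
have pb : (p * a1 <= q1)%N.
  have [_ pa2] := andP (pa1_bounds p_prime a1_bounds); by move: pa2 p1; clear; lia.
have nb : (0 < n <= q1)%N by rewrite pb (pa1_gt0 p_prime a1_bounds).
have nr := low_lt nb.
have : projQ (\sum_(b : Fq) iota b *: Gact (upU b) (c *: W)) = projQ 0.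
  rewrite projQ0; apply: etrans (projQ_sum _ _ _ _ _ _) _.
  transitivity ((-1) ^+ m *: phi (\sum_(b : Fq) iota b *: Gact (upU b) Ys)); last first.
    by rewrite sum_upU_Ys // linear0 scaler0.
  rewrite (linear_sum phi) [RHS]scaler_sumr.
  apply: eq_bigr => b _.
  rewrite linearZ /= projQZ -(GactQ_proj D p_prime r0 r1 _ (upU_unit b)) -eY.
  have := phiG (upU_unit b) Ys_hom; rewrite det_mx2 mul1r mulr0 subr0 rmorph1 expr1n scale1r => ->.
  have [Y YE] : exists Y, phi Ys = projQ Y.
    by case: emb => _ _ h _; have [[Y [_ YE]] _] := h _ Ys_hom; exists Y.
  rewrite YE -[(-1) ^+ m *: projQ Y]projQZ !(GactQ_proj D p_prime r0 r1 _ (upU_unit b)) GactZ projQZ.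
  by rewrite !scalerA [iota b * _]mulrC.
move=> /(fnM_proj p_prime r0_ge a1_bounds r_mod)[f sf [f1 _]].
have evE y : ev 1 y (\sum_(b : Fq) iota b *: Gact (upU b) (c *: W) - 0) = c * iota y.
  rewrite subr0 ev_sum.
  have tE b : ev 1 y (iota b *: Gact (upU b) (c *: W)) = c * iota (b * (b + y) ^+ q1).
    rewrite evZ (ev_Gact D p_prime) evZ /W (ev_Gact D p_prime) !mx2E.
    rewrite !(mul0r, mul1r, mulr0, mulr1, add0r, addr0) ev_monY expr1n mulr1 subn0 mulrCA.
    rewrite -rmorphM; congr (_ * iota (_ * _)); apply: expf_congr.
    - by rewrite addn_gt0 subn_gt0 nr.
    - by move: (q_gt1 p_prime); clear; lia.
    rewrite (q1E D) modnn; apply/eqP; rewrite -/(_ %| _)%N.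
    have <- : (r0 + p * r1 - n = r0 - n + p * r1)%N by rewrite addnBAC // ltnW.
    rewrite -eqn_mod_dvd; first by apply/eqP; exact: r_mod.
    exact: leq_trans (ltnW nr) (leq_addr _ _).
  under eq_bigr do rewrite tE.
  rewrite -mulr_sumr -rmorph_sum; congr (_ * iota _).
  have term b : b * (b + y) ^+ q1 = b - (if b == - y then b else 0).
    case: eqP => [->|/eqP by_]; last first.
      by rewrite subr0 -(q1E D) expf_card1 ?mulr1 // addr_eq0.
    rewrite addNr expr0n subrr (_ : (_ == 0)%N = false) ?mulr0 //.
    by move: (q_gt1 p_prime); clear; lia.
  under eq_bigr do rewrite term.
  rewrite sumrB -big_mkcond big_pred1_eq opprK.
  have -> : \sum_(b : Fq) b = \sum_(b : Fq) b ^+ 1 by apply: eq_bigr => b _; rewrite expr1.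
  rewrite sum_expf (q1E D) dvdn1 (_ : (_ == 1)%N = false) ?add0r //.
  by move: p_gt2; rewrite -mulnn; clear; nia.
have F0 : c *: 'X - (f \Po 'X^p) = 0.
  apply: (poly_fq0 (D := D)).
    apply: leq_trans (size_polyD _ _) _; rewrite size_polyN geq_max.
    rewrite (size_compXp p_prime a1_bounds sf) andbT.
    by apply: leq_trans (size_scale_leq _ _) _; rewrite size_polyX; exact: q_gt1.
  by move=> y; rewrite hornerD hornerN horner_comp hornerXn -f1 evE hornerZ hornerX subrr.
move: (congr1 (fun g : {poly Fbar} => g`_1) F0); rewrite coefB coefZ coefX mulr1 coef0.
rewrite coef_comp_poly_Xn // dvdn1 (gtn_eqF p1) subr0 => z.
by move: c0; rewrite z eqxx.
Qed.

(* A highest weight vector is a torus eigenvector, hence a multiple of a single monomial;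
   invariance under the unipotents and the action of w0 exclude every monomial but ww. *)
Lemma weight_classification : (s0 + p * s1 + 2 = p * a1)%N /\
  exists c, phi Xs = c *: projQ (ww Fbar r0 r1) /\ phi Ys = - c *: projQ (ww' Fbar r0 r1).
Proof.
have [s0p s1p _ _] := emb; have sw := scalar_weight.
have [c [n [c0 nb nm pE]]] := phi_Xs.
have [a10 a1p] := andP a1_bounds; have p1 := prime_gt1 p_prime; have p0 := prime_gt0 p_prime.
have [pa1 pa2] := andP (pa1_bounds p_prime a1_bounds).
have pq : (p < p ^ 2)%N by rewrite -mulnn ltn_Pmull.
have p2q : (p * 2 <= p ^ 2)%N by rewrite -mulnn leq_mul2l p1 orbT.
have inv : projQ (Gact (upU 1) (c *: mY n 0)) = projQ (c *: mY n 0).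
  have := phiG (upU_unit 1) Xs_hom; rewrite det_mx2 mul1r mulr0 subr0 rmorph1 expr1n scale1r.
  have -> : Gact (upU 1) Xs = Xs.
    rewrite GactMul !GactX !Gact_vars !mx2E rmorph0 rmorph1 expr1n expr0n (gtn_eqF p0) mulr0n.
    by rewrite !scale1r !scale0r !addr0.
  by rewrite pE -projQZ (GactQ_proj D p_prime r0 r1 _ (upU_unit 1)).
have ps1 : (p * s1 <= p * (p - 1))%N by rewrite leq_mul2l; apply/orP; right; move: s1p; clear; lia.
have pp1 : (p * (p - 1) = p ^ 2 - p)%N by rewrite mulnBr mulnn muln1.
case: (U_invariant nb c0 inv) => [n1|[n1 nE n1a]].
  have sw' : (s0 + p * s1 + 2 = p * a1 %[mod q1])%N.
    have e2 : 2 * m = 2 %[mod q1] by rewrite -modnMmr -nm n1 modnMmr muln1.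
    by rewrite -sw -(modnDmr _ (2 * m)) e2 modnDmr.
  split.
    by apply: (modn_eq_small sw'); move: s0p ps1 pa1 pa2 pq p_gt2; rewrite pp1; clear; lia.
  exists c; split.
    by rewrite pE n1 /monY /ww subn0 !expr1 expr0 mulr1 subn1.
  have := phi_Ys pE.
  (* m is 1 modulo the even number q - 1, hence odd. *)
  have -> : (-1) ^+ m = -1 :> Fbar.
    have podd : odd p by have [p2|//] := even_prime p_prime; move: p_gt2; rewrite p2.
    have q1_even : odd q1 = false by rewrite oddB ?expn_gt0 ?p0 // oddX podd.
    have m1 : (m %% q1 = 1)%N.
      by rewrite -nm n1 modn_small //; move: p2q p_gt2; clear; lia.
    by rewrite -signr_odd (divn_eq m q1) m1 oddD oddM q1_even andbF.
  rewrite scaleN1r projQZ => /eqP; rewrite eqr_oppLR => /eqP ->; rewrite scaleNr.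
  congr (- (_ *: projQ _)); rewrite n1 /monY /ww' !GactMul !GactX !(Gact_w0_vars D p_prime).
  by rewrite subn0 !expr1 expr0 mulr1 subn1.
have n10 : (0 < n1)%N by case/andP: nb => + _; rewrite nE muln_gt0 => /andP[].
have [n1E|n1E] := eqVneq n1 a1; last first.
  exfalso; rewrite nE in pE; apply: (weight_X_neq n1a n10 _ c0 pE); exact/eqP.
exfalso; rewrite nE n1E in pE nm.
apply: (top_excluded _ c0 pE).
rewrite ltnNge; apply/negP => s1_ge.
(* For s1 = p - 1 the central character excludes the top monomial: this sum lies strictly between q
   - 1 and 2 (q - 1). *)
have dv : (q1 %| s0 + p * s1 + p * a1)%N.
  have h0 : (s0 + p * s1 + m = 0 %[mod q1])%N.
    apply/eqP; rewrite -(eqn_modDr m) add0n -addnA addnn -mul2n; apply/eqP.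
    by rewrite sw; exact: nm.
  by rewrite /dvdn -modnDmr nm modnDmr h0 mod0n.
have ps1' : (p * (p - 1) <= p * s1)%N by rewrite leq_mul2l s1_ge orbT.
have [d dE] := dvdnP dv.
have [d1|d2] := leqP d 1.
  have : (d * q1 <= 1 * q1)%N by rewrite leq_mul2r d1 orbT.
  by rewrite -dE; move: ps1' pa1 pq; rewrite pp1; clear; lia.
have : (2 * q1 <= d * q1)%N by rewrite leq_mul2r d2 orbT.
by rewrite -dE; move: ps1 pa2 s0p p2q p_gt2; rewrite pp1; clear; lia.
Qed.

End Embedding.
End Weights.

(** * Vanishing of T on the weights *)

Lemma scaler_sum2 (R : nzRingType) (M : lmodType R) (I J K : finType)
    (a : J -> K -> R) (b : I -> J -> K -> R) (x : I -> M) :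
  \sum_i (\sum_j \sum_k a j k * b i j k) *: x i = \sum_j \sum_k a j k *: \sum_i b i j k *: x i.
Proof.
transitivity (\sum_i \sum_j \sum_k (a j k * b i j k) *: x i).
  by apply: eq_bigr => i _; rewrite scaler_suml; apply: eq_bigr => j _; rewrite scaler_suml.
rewrite exchange_big; apply: eq_bigr => j _; rewrite exchange_big; apply: eq_bigr => k _.
by rewrite scaler_sumr; apply: eq_bigr => i _; rewrite scalerA.
Qed.

Section TopSubst.
Variables (R : comNzRingType) (p : nat).

(** On a weight, the terms of T at g (p, [l]; 0, 1) thus involve only the highest weight vector;
    [subst_topY] shows that the remaining term involves only the lowest one. *)
Lemma subst_topX s0 s1 (x : R) (P : {mpoly R[4]}) : bihomog s0 s1 P ->
  subst (mx2 1 x 0 0) (mx2 1 (x ^+ p) 0 0) P =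
  (\sum_(i < s0.+1) \sum_(j < s1.+1) P@_(mnmY s0 s1 i j) * x ^+ (i + p * j))
    *: ('X_iX0 ^+ s0 * 'X_iX1 ^+ s1).
Proof.
move=> hP; rewrite {1}(bihomog_decomp hP) subst_sum scaler_suml; apply: eq_bigr => i _.
rewrite subst_sum scaler_suml; apply: eq_bigr => j _; rewrite substZ -scalerA; congr (_ *: _).
rewrite /monY !substM !substXn !substE !mx2E !scale0r !scale1r !addr0 !exprZn.
rewrite -!scalerAr -!scalerAl scalerA -!exprD (subnK (ltn_ord i : (i <= s0)%N)).
rewrite (subnK (ltn_ord j : (j <= s1)%N)); congr (_ *: _).
by rewrite exprD exprM mulrC.
Qed.

Lemma subst_topY s0 s1 (P : {mpoly R[4]}) : bihomog s0 s1 P ->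
  subst (mx2 0 0 0 1) (mx2 0 0 0 1) P =
  (\sum_(i < s0.+1) \sum_(j < s1.+1)
     P@_(mnmY s0 s1 i j) * ((i == s0 :> nat) && (j == s1 :> nat))%:R)
    *: ('X_iY0 ^+ s0 * 'X_iY1 ^+ s1).
Proof.
move=> hP; rewrite {1}(bihomog_decomp hP) subst_sum scaler_suml; apply: eq_bigr => i _.
rewrite subst_sum scaler_suml; apply: eq_bigr => j _; rewrite substZ -scalerA; congr (_ *: _).
rewrite /monY !substM !substXn !substE !mx2E !scale0r !scale1r !add0r !expr0n !subn_eq0.
have hi : (s0 <= i)%N = (i == s0 :> nat) by rewrite eqn_leq -[(i <= s0)%N]ltnS ltn_ord.
have hj : (s1 <= j)%N = (j == s1 :> nat) by rewrite eqn_leq -[(j <= s1)%N]ltnS ltn_ord.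
rewrite hi hj; case: eqP => [->|_]; last by rewrite !mul0r scale0r.
by case: eqP => [->|_]; rewrite ?mul0r ?mulr0 ?scale0r ?scale1r // !mul1r.
Qed.

End TopSubst.

(** * The induced map on ind Q, and the passage from one relation to whole weights *)

Section Factorization.
Variables (p : nat) (Qp : fieldType) (L : fieldExtType Qp) (E : fieldExtType L).
Variables (Fq : finFieldType) (Fbar : closedFieldType).
Variable D : padic_setting p E Fq Fbar.
Hypotheses (p_prime : prime p) (p_gt2 : (2 < p)%N).
Variables (r0 r1 a1 : nat) (ap : E).
Hypotheses (r0_ge : (p ^ 2 <= r0)%N) (r1_ge : (p ^ 2 <= r1)%N).
Hypotheses (a1_bounds : (1 <= a1 <= p - 1)%N).
Hypotheses (r_mod : (r0 + p * r1 = p * a1 %[mod p ^ 2 - 1])%N).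
Hypotheses (r0_ndiv : ~~ (p %| r0)%N) (r1_div : a1 = 1%N -> (p %| r1)%N).
Hypotheses (ap_neq0 : ap != 0) (ap_val : 2%:R^-1 < v D ap < 1).
Local Notation v := (v D).
Local Notation red := (red D).
Local Notation brF := (bracket D (KZactF D)).
Local Notation KZactQ := (@KZactQ p Qp L E Fq Fbar D r0 r1).
Local Notation brQ := (bracket D KZactQ).
Local Notation indVr := (indVr D r0 r1).
Local Notation nu := (nu D r0 r1 ap).
Local Notation nat_map := (nat_map D r0 r1 ap).
Local Notation hA := (hA D).
Local Notation hB := (@hB p Qp L).
Local Notation iota := (Defs.iota D).
Local Notation Qamb := (Qamb D r0 r1).
Local Notation projQ := (projQ D r0 r1).
Local Notation wF := (ww Fbar r0 r1).
Local Notation wF' := (ww' Fbar r0 r1).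
Local Notation q1 := (p ^ 2 - 1)%N.
Implicit Types (g h : 'M[L]_2) (S : {mpoly Fbar[4]}) (l : Fq).

Lemma nat_map_kill f : indVr f -> (forall x, projQ (f x) = 0) -> nat_map f = 0.
Proof.
move=> hf kf; have [s hs] := coversP p_prime hf; have [_ sr _] := hs; have [hh _ _ _] := hf.
rewrite (nat_mapE r0 r1 ap hs) big1_seq // => x /andP[_ /sr[xu _]].
have xu' : invmx x \in unitmx by rewrite unitmx_inv.
rewrite -(nu_nu0 D p_prime ap xu' (hh x)).
have /projQ_eq0 kx := kf x.
exact: (nu_kill p_prime p_gt2 r0_ge ap_neq0 ap_val xu' kx).2.
Qed.

(** The value of [nat_map] at a lift of F to ind V_r. By [nat_map_kill] it does not depend on the
    lift; functions without a lift go to 0. *)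
Definition Phi (F : 'M[L]_2 -> Qamb) : ThetaBar D r0 r1 ap :=
  xget 0 [set z | exists f, [/\ indVr f, F = projQ \o f & z = nat_map f]].

Lemma Phi_proj f : indVr f -> Phi (projQ \o f) = nat_map f.
Proof.
move=> hf; apply: xget_unique; first by exists f.
move=> z [f' [hf' ff' ->]]; apply/eqP; rewrite -subr_eq0; apply/eqP.
rewrite addrC -scaleN1r -(nat_mapZD p_prime ap (-1) hf hf').
apply: nat_map_kill; first exact: indVrZD.
move=> x; have ex : projQ (f x) = projQ (f' x) := congr1 (fun F => F x) ff'.
have -> : (-1 *: f + f') x = -1 *: f x + f' x by [].
by rewrite projQD projQZ ex scaleN1r addNr.
Qed.

Lemma projQ_br g S : projQ \o brF g S = brQ g (projQ S).
Proof.
apply/funext => x; rewrite /bracket /=; case: asboolP => [hK|_]; last exact: projQ0.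
by apply/esym; exact: KZactQ_proj.
Qed.

Lemma KZactF_kU (z : L) : vge v 0 z%:A ->
  KZactF D (kU z) wF = red z%:A *: XX r0 r1 Fbar + wF.
Proof.
move=> hz; have kK := kU_inK hz; have r0n := r0_gt1 p_prime r0_ge.
rewrite /KZactF (KZact_dec p_prime _ _ (inK_dec kK)) /ww !substM !substXn !substE /kU !map_mx2 !mx2E.
rewrite /= ?scale0r ?scale1r ?red0 ?red1 ?rmorph0 ?rmorph1 ?scale0r ?scale1r ?red0 ?red1.
rewrite ?scale0r ?scale1r ?addr0 mulrDr mulrDl -scalerAr -scalerAl; congr (_ *: _ + _).
by rewrite /XX -exprSr prednK // ltnW.
Qed.

Lemma KZactF_kU' (z : L) : vge v 0 z%:A -> red z%:A = 0 -> KZactF D (kU z) wF' = wF'.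
Proof.
move=> hz rz; have kK := kU_inK hz; have p0 : (p == 0)%N = false by rewrite gtn_eqF // prime_gt0.
rewrite /KZactF (KZact_dec p_prime _ _ (inK_dec kK)) /ww' !substM !substXn !substE /kU !map_mx2 !mx2E.
rewrite /= red_sigma // rz expr0n p0 mulr0n.
rewrite ?rmorph0 ?rmorph1 ?scale0r ?scale1r ?red0 ?red1 ?scale0r ?scale1r.
by rewrite ?addr0 ?add0r.
Qed.

(** [kU [t] *m hA l] is [hA (l + t) *m kU z] with z = ([l] + [t] - [l + t]) / p integral, and [kU z]
    changes w only by a multiple of [XX], which [nu] kills. *)
Lemma nu_shift g t l : g \in unitmx ->
  nu (g *m kU (teich D t) *m hA l) wF = nu (g *m hA (l + t)) wF.
Proof.
move=> gu; pose y := teich D l + teich D t - teich D (l + t).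
have hw := @ww_hom p Fbar p_prime r0 r1 r0_ge.
have ti k : vge v 0 (teich D k)%:A := teich_int D k.
have yE : y%:A = TE D l + TE D t - TE D (l + t) by rewrite /y scalerBl scalerDl.
have iy : vge v 0 y%:A by rewrite yE; apply: vgeB; [apply: vgeD|]; exact: TE_int.
have ry : red y%:A = 0.
  rewrite yE redB; [|by apply: vgeD; exact: TE_int|exact: TE_int].
  by rewrite redD; [|exact: TE_int|exact: TE_int]; rewrite !TE_red rmorphD subrr.
have vy := vge1_L iy ry.
pose z := y / p%:R; have pL := pL_neq0 D p_prime; have pE := pE_neq0 D p_prime.
have hz : vge v 0 z%:A.
  have -> : z%:A = y%:A * (p%:R : E)^-1.
    by rewrite /z -!in_algE rmorphM fmorphV rmorph_nat.
  have -> : 0 = 1 + -1 :> rat by rewrite subrr.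
  by apply: vgeM => //; rewrite /vge v_inv // val_p lexx orbT.
have -> : g *m kU (teich D t) *m hA l = g *m hA (l + t) *m kU z.
  rewrite -!mulmxA; congr (_ *m _); rewrite !hAE /kU !mx2M.
  apply: mx2P; rewrite !mx2E !(mul0r, mul1r, mulr0, mulr1, addr0, add0r) //.
  by rewrite /z mulrC mulfVK // /y subrK.
have guA := gA_unit D p_prime (l + t) gu.
rewrite -(nu_act p_prime r0 r1 ap _ wF (inK_inKZ (kU_inK hz))) (KZactF_kU hz).
rewrite (nuZD D p_prime ap _ guA (@XX_hom r0 r1 Fbar) hw).
by rewrite (nu_XX p_prime p_gt2 r1 r0_ge ap_neq0 ap_val guA) scaler0 add0r.
Qed.

(** Moving the unipotent past [hB] multiplies its entry by p, so that its reduction is trivial. *)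
Lemma nu_shift' g t : g \in unitmx -> nu (g *m kU (teich D t) *m hB) wF' = nu (g *m hB) wF'.
Proof.
move=> gu; pose z : L := p%:R * teich D t.
have zE : z%:A = (p%:R : E) * TE D t by rewrite /z -in_algE rmorphM rmorph_nat.
have hz : vge v 0 z%:A by rewrite zE; apply: intM; [exact: int_nat | exact: TE_int].
have rz : red z%:A = 0 by rewrite zE redM ?int_nat ?TE_int // red_p mul0r.
have -> : g *m kU (teich D t) *m hB = g *m hB *m kU z.
  rewrite -!mulmxA; congr (_ *m _); rewrite !hBE /kU !mx2M.
  by apply: mx2P; rewrite !mx2E !(mul0r, mul1r, mulr0, mulr1, addr0, add0r) // /z mulrC.
by rewrite -(nu_act p_prime r0 r1 ap _ wF' (inK_inKZ (kU_inK hz))) KZactF_kU'.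
Qed.

(** Translating g by the unipotent of [t] shifts the summation index on the left and leaves the
    right side alone. The result is a family of relations, polynomial in t, with constant right
    side. *)
Lemma nu_hecke_shift g t : g \in unitmx ->
  \sum_l (iota t - iota l) ^+ (p * a1 - 2) *: nu (g *m hA l) wF = nu (g *m hB) wF'.
Proof.
move=> gu; have gku : g *m kU (teich D t) \in unitmx.
  by rewrite unitmx_mul gu (inK_unit (kU_inK (teich_int D t))).
have := nu_hecke p_prime p_gt2 r0_ge r1_ge a1_bounds ap_neq0 ap_val r_mod r0_ndiv r1_div gku.
rewrite (nu_shift' t gu) => e; apply: etrans e.
transitivity (\sum_l (iota t - iota (l + t)) ^+ (p * a1 - 2) *: nu (g *m hA (l + t)) wF).
  exact: (reindex_inj (@addIr Fq t)).
apply: eq_bigr => l _; rewrite (nu_shift t l gu).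
by have -> : iota t - iota (l + t) = - iota l by rewrite rmorphD opprD addrCA subrr addr0.
Qed.

(* Both sides of the hypothesis are polynomials in t of degree less than q - 1; compare
   coefficients. *)
Lemma shift_coef (M : lmodType Fbar) (nl : Fq -> M) (n' : M) s0 s1 i0 j0 :
    (s0 < p)%N -> (s1 < p)%N -> (s0 + p * s1 < q1)%N -> (i0 <= s0)%N -> (j0 <= s1)%N ->
    (forall t, \sum_l (iota t - iota l) ^+ (s0 + p * s1) *: nl l = n') ->
  \sum_l (- iota l) ^+ (i0 + p * j0) *: nl l = ((i0 == s0) && (j0 == s1))%:R *: n'.
Proof.
move=> s0p s1p sq hi0 hj0 hsh.
have chp := pFbar D p_prime; have p0 := prime_gt0 p_prime.
pose N i j := (s0 - i + p * (s1 - j))%N.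
pose C i j : Fbar := 'C(s0, i)%:R * 'C(s1, j)%:R.
have Nq i j : (N i j < q1)%N.
  have h1 : (s0 - i <= s0)%N := leq_subr _ _.
  have h2 : (p * (s1 - j) <= p * s1)%N by rewrite leq_mul2l leq_subr orbT.
  by apply: leq_ltn_trans sq; exact: leq_add.
(* N i j has the base p digits s0 - i and s1 - j. *)
have ninj i j : (i <= s0)%N -> (j <= s1)%N -> N i j = N i0 j0 -> i = i0 /\ j = j0.
  move=> hi hj Ne.
  have e1 : (s1 - j = s1 - j0)%N.
    have := congr1 (fun k => k %/ p)%N Ne.
    rewrite /N ![(_ + p * _)%N]addnC ![(p * _)%N]mulnC !divnMDl // !divn_small ?addn0 //;
      by apply: leq_ltn_trans s0p; exact: leq_subr.
  have e2 : (s0 - i = s0 - i0)%N by move: Ne; rewrite /N e1 => /addIn.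
  by move: e1 e2 hi hj hi0 hj0; clear; lia.
have shiftE t : \sum_(i < s0.+1) \sum_(j < s1.+1)
    (C i j * iota t ^+ N i j) *: (\sum_l (- iota l) ^+ (i + p * j) *: nl l) = n'.
  rewrite -(hsh t).
  transitivity (\sum_l (\sum_(i < s0.+1) \sum_(j < s1.+1)
      C i j * (iota t ^+ N i j * (- iota l) ^+ (i + p * j))) *: nl l).
    under [in RHS]eq_bigr => l _.
      rewrite scaler_suml; under eq_bigr => i _ do rewrite scaler_suml.
      over.
    rewrite [RHS]exchange_big; apply: eq_bigr => i _.
    rewrite [RHS]exchange_big; apply: eq_bigr => j _ /=.
    by rewrite scaler_sumr; apply: eq_bigr => l _; rewrite scalerA mulrA.
  by apply: eq_bigr => l _; congr (_ *: _); rewrite -expand_scalar -(frobD _ _ chp) -exprM -exprD.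
(* Multiplying by t^e and summing over t extracts the coefficient of t^(N i0 j0). *)
pose e := (q1 - N i0 j0)%N.
have key : \sum_(t : Fq) iota t ^+ e *: n' =
    - (C i0 j0 *: (\sum_l (- iota l) ^+ (i0 + p * j0) *: nl l)).
  transitivity (\sum_(i < s0.+1) \sum_(j < s1.+1)
    (C i j * \sum_(t : Fq) iota t ^+ (e + N i j)) *:
      (\sum_l (- iota l) ^+ (i + p * j) *: nl l)).
    transitivity (\sum_(t : Fq) \sum_(i < s0.+1) \sum_(j < s1.+1)
        (C i j * iota t ^+ (e + N i j)) *: (\sum_l (- iota l) ^+ (i + p * j) *: nl l)).
      apply: eq_bigr => t _; rewrite -(shiftE t) scaler_sumr; apply: eq_bigr => i _.
      by rewrite scaler_sumr; apply: eq_bigr => j _; rewrite scalerA mulrCA -exprD.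
    rewrite exchange_big; apply: eq_bigr => i _; rewrite exchange_big; apply: eq_bigr => j _ /=.
    by rewrite -scaler_suml mulr_sumr.
  rewrite pair_big /=.
  have l0 : (i0 < s0.+1)%N by [].
  have l1 : (j0 < s1.+1)%N by [].
  rewrite (bigD1 (Ordinal l0, Ordinal l1)) //= [X in _ + X]big1 ?addr0.
    rewrite (sum_iota D) /e subnK ?(ltnW (Nq _ _)) // dvdnn.
    by rewrite (leq_ltn_trans _ (Nq i0 j0)) //= mulrN1 scaleNr.
  move=> [i j] /= ij; rewrite (sum_iota D); case: ifP => [|_]; last first.
    by rewrite mulr0 scale0r.
  move=> /andP[_ dv]; case/negP: ij.
  have hi : (i <= s0)%N by rewrite -ltnS.
  have hj : (j <= s1)%N by rewrite -ltnS.
  have NN : N i j = N i0 j0.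
    apply: (@modn_eq_small _ _ q1); [|have := Nq i j; clear; lia|have := Nq i0 j0; clear; lia].
    apply/eqP; rewrite -(eqn_modDl e) {2}/e subnK ?(ltnW (Nq _ _)) // modnn; exact: dv.
  have [ei ej] := ninj _ _ hi hj NN.
  by apply/eqP; congr (_, _); apply: val_inj.
have C0 : C i0 j0 != 0 by rewrite mulf_neq0 // (bin_pchar chp).
(* The constant right side contributes only to the exponent N i0 j0 = 0, which means i0 = s0 and j0
   = s1. *)
have [/andP[/eqP ei /eqP ej]|nt] := boolP ((i0 == s0) && (j0 == s1)).
  move: key; rewrite -scaler_suml (sum_iota D) /e /N ei ej !subnn muln0 subn0 dvdnn.
  rewrite /C !binn mulr1 !scale1r (leq_ltn_trans _ (Nq i0 j0)) //= scaleN1r.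
  by move=> /oppr_inj ->.
move: key; rewrite -scaler_suml (sum_iota D) scale0r.
have -> : (0 < e)%N && (q1 %| e)%N = false.
  apply/negP => /andP[e0 /(dvdn_leq e0)]; rewrite /e => h.
  have N0 : N i0 j0 = 0%N by move: h (Nq i0 j0); clear; lia.
  case/negP: nt; move: N0; rewrite /N => /eqP; rewrite addn_eq0 muln_eq0 (gtn_eqF p0) /=.
  by rewrite !subn_eq0 => /andP[h1 h2]; rewrite !eqn_leq hi0 hj0 h1 h2.
rewrite scale0r => /esym/eqP; rewrite oppr_eq0 scaler_eq0 (negPf C0) /=.
by move/eqP.
Qed.

Lemma projQ_compZD a (f f' : 'M[L]_2 -> {mpoly Fbar[4]}) :
  projQ \o (a *: f + f') = a *: (projQ \o f) + (projQ \o f').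
Proof. by apply/funext => x; exact: projQZD. Qed.

Lemma projQ_comp0 : projQ \o (0 : 'M[L]_2 -> {mpoly Fbar[4]}) = 0.
Proof. by apply/funext => x; exact: projQ0. Qed.

Lemma projQ_comp_sum (I : finType) (F : I -> 'M[L]_2 -> {mpoly Fbar[4]}) :
  projQ \o (\sum_i F i) = \sum_i (projQ \o F i).
Proof.
apply: (big_morph (fun f => projQ \o f)); last exact: projQ_comp0.
by move=> f f'; rewrite -[f in LHS]scale1r projQ_compZD scale1r.
Qed.

(** For a the coefficients of P, the left side is the image of T [g, phi P]; the opposite factors c
    and - c are those of [weight_classification]. *)
Lemma shift_comb (M : lmodType Fbar) (nl : Fq -> M) (n' : M) s0 s1 (a : nat -> nat -> Fbar) c :
    (s0 < p)%N -> (s1 < p)%N -> (s0 + p * s1 < q1)%N ->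
    (forall t, \sum_l (iota t - iota l) ^+ (s0 + p * s1) *: nl l = n') ->
  \sum_l ((\sum_(i < s0.+1) \sum_(j < s1.+1) a i j * (- iota l) ^+ (i + p * j)) * c) *: nl l +
  ((\sum_(i < s0.+1) \sum_(j < s1.+1)
      a i j * ((i == s0 :> nat) && (j == s1 :> nat))%:R) * - c) *: n' = 0.
Proof.
move=> s0p s1p sq hsh.
set cA := fun l => \sum_(i < s0.+1) \sum_(j < s1.+1) a i j * (- iota l) ^+ (i + p * j).
set cB := \sum_(i < s0.+1) \sum_(j < s1.+1) a i j * ((i == s0 :> nat) && (j == s1 :> nat))%:R.
have co i j : (i <= s0)%N -> (j <= s1)%N ->
    \sum_l (- iota l) ^+ (i + p * j) *: nl l = ((i == s0) && (j == s1))%:R *: n'.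
  move=> hi hj; apply: (shift_coef s0p s1p sq hi hj) => t; exact: hsh.
have key : \sum_l cA l *: nl l = cB *: n'.
  transitivity (\sum_(i < s0.+1) \sum_(j < s1.+1)
      a i j *: (\sum_l (- iota l) ^+ (i + p * j) *: nl l)).
    exact: scaler_sum2.
  rewrite scaler_suml; apply: eq_bigr => i _; rewrite scaler_suml; apply: eq_bigr => j _.
  by rewrite -scalerA; apply: congr1; exact: (co i j (ltn_ord i) (ltn_ord j)).
have -> : \sum_l (cA l * c) *: nl l = c *: (\sum_l cA l *: nl l).
  by rewrite [RHS]scaler_sumr; apply: eq_bigr => l _; rewrite scalerA [c * _]mulrC.
by rewrite key scalerA mulrN scaleNr [c * _]mulrC subrr.
Qed.

(** T [g, phi P] involves only the images of the highest and lowest weight vectors, which are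
    multiples of the classes of w and w'. This gives an explicit lift to ind V_r. *)
Lemma hecke_lift s0 s1 m (phi : {linear {mpoly Fbar[4]} -> Qamb}) g P :
    weight_embedding s0 s1 m phi -> g \in unitmx -> bihomog s0 s1 P ->
  exists f, [/\ indVr f, hecke_formula D KZactQ 0 iota phi g P = projQ \o f & nat_map f = 0].
Proof.
move=> emb gu hP; have [s0p s1p _ _] := emb.
have [sE [c [eX eY]]] := weight_classification p_prime p_gt2 r0_ge r1_ge a1_bounds r_mod emb.
pose a i j := P@_(mnmY s0 s1 i j).
pose cA l := \sum_(i < s0.+1) \sum_(j < s1.+1) a i j * (- iota l) ^+ (i + p * j).
pose cB : Fbar := \sum_(i < s0.+1) \sum_(j < s1.+1)
  a i j * ((i == s0 :> nat) && (j == s1 :> nat))%:R.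
have hw : bihomog r0 r1 wF := @ww_hom p Fbar p_prime r0 r1 r0_ge.
have hw' : bihomog r0 r1 wF' := @ww'_hom p Fbar p_prime r0 r1 r0_ge.
have gA l := gA_unit D p_prime l gu; have gB := gB_unit D p_prime gu.
pose f1 := \sum_l brF (g *m hA l) ((cA l * c) *: wF).
pose f2 := brF (g *m hB) ((cB * - c) *: wF').
have i1 : indVr f1.
  by apply: indVr_sum => l _; apply: (indVr_br D p_prime (gA l)); exact: bihomogZ.
have i2 : indVr f2 by apply: (indVr_br D p_prime gB); exact: bihomogZ.
exists (1 *: f1 + f2); split; first exact: indVrZD.
- have sA l : phi (subst (mx2 1 (- iota l) 0 0) (mx2 1 ((- iota l) ^+ p) 0 0) P) =
      (cA l * c) *: projQ wF.
    rewrite -scalerA -eX -linearZ /=; apply: congr1; exact: subst_topX.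
  have sB : phi (subst (mx2 0 0 0 1) (mx2 0 0 0 1) P) = (cB * - c) *: projQ wF'.
    rewrite -scalerA -eY -linearZ /=; apply: congr1; exact: subst_topY.
  rewrite projQ_compZD scale1r projQ_comp_sum /hecke_formula sB.
  apply: add_congr; last by rewrite -projQZ -hBE; apply/esym; exact: projQ_br.
  by apply: eq_bigr => l _; rewrite sA -projQZ -hAE; apply/esym; exact: projQ_br.
rewrite (nat_mapZD p_prime ap 1 i1 i2) scale1r.
have e1 : nat_map f1 = \sum_l (cA l * c) *: nu (g *m hA l) wF.
  rewrite /f1 (nat_map_sum p_prime); last first.
    by move=> l _; apply: (indVr_br D p_prime (gA l)); exact: bihomogZ.
  by apply: eq_bigr => l _; exact: nuZ.
have e2 : nat_map f2 = (cB * - c) *: nu (g *m hB) wF' by exact: nuZ.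
move: e1 e2 => -> ->; have hsh t := nu_hecke_shift t gu.
have pb := pa1_bounds p_prime a1_bounds; have p1 := prime_gt1 p_prime.
have sE' : (p * a1 - 2 = s0 + p * s1)%N by rewrite -sE addnK.
have sq : (s0 + p * s1 < q1)%N by clear -sE pb p1; lia.
rewrite sE' in hsh; exact: (shift_comb a c s0p s1p sq hsh).
Qed.

Lemma heckeQ_lift (f Tf : 'M[L]_2 -> Qamb) : heckeQ f Tf ->
  exists f', [/\ indVr f', Tf = projQ \o f' & nat_map f' = 0].
Proof.
suff H u : lspan (fun u : ('M[L]_2 -> Qamb) * ('M[L]_2 -> Qamb) =>
      exists s0 s1 m phi g P, [/\ weight_embedding s0 s1 m phi, g \in unitmx, bihomog s0 s1 P &
      u = (brQ g (phi P), hecke_formula D KZactQ 0 iota phi g P)]) u ->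
    exists f', [/\ indVr f', u.2 = projQ \o f' & nat_map f' = 0].
  by move=> /H.
elim=> [|b x y [s0 [s1 [m [phi [g [P [emb gu hP ->]]]]]]] _ [f2 [h2 e2 n2]]].
  exists 0; split; [exact: indVr0 | by rewrite projQ_comp0 | exact: nat_map0].
have [f1 [h1 e1 n1]] := hecke_lift emb gu hP.
exists (b *: f1 + f2); split; first exact: indVrZD.
- by rewrite projQ_compZD -e1 -e2.
- by rewrite nat_mapZD // n1 n2 scaler0 addr0.
Qed.

End Factorization.

Theorem theorem9p3 (p : nat) (Qp : fieldType) (L : fieldExtType Qp)
    (E : fieldExtType L) (Fq : finFieldType) (Fbar : closedFieldType)
    (D : padic_setting p E Fq Fbar) (k0 k1 r0 r1 a1 : nat) (ap : E)
    (p_prime : prime p) (p_gt2 : (2 < p)%N)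
    (r0E : r0 = (k0 - 2)%N) (r1E : r1 = (k1 - 2)%N)
    (r0_ge : (p ^ 2 <= r0)%N) (r1_ge : (p ^ 2 <= r1)%N)
    (a1_bounds : (1 <= a1 <= p - 1)%N)
    (r_mod : (r0 + p * r1 = p * a1 %[mod p ^ 2 - 1])%N)
    (r0_ndiv : ~~ (p %| r0)%N)
    (r1_div : a1 = 1%N -> (p %| r1)%N)
    (ap_neq0 : ap != 0) (ap_val : 2%:R^-1 < v D ap < 1) :
  exists (nat_map : ('M[L]_2 -> {mpoly Fbar[4]}) -> ThetaBar D r0 r1 ap)
         (Phi : ('M[L]_2 -> Qamb D r0 r1) -> ThetaBar D r0 r1 ap),
    [/\ natural_surjection nat_map,
        factors_through_indQ nat_map Phi
      & forall f Tf, indsocQ f -> heckeQ f Tf -> Phi Tf = 0].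
Proof.
exists (nat_map D r0 r1 ap), (@Phi p Qp L E Fq Fbar D r0 r1 ap).
have PhiE f : indVr D r0 r1 f -> Phi ap (projQ D r0 r1 \o f) = nat_map D r0 r1 ap f.
  exact: (Phi_proj p_prime p_gt2 r0_ge ap_neq0 ap_val).
split; first exact: natural_nat_map.
  by move=> f hf; rewrite PhiE.
move=> f Tf _ /(heckeQ_lift p_prime p_gt2 r0_ge r1_ge a1_bounds r_mod r0_ndiv r1_div ap_neq0 ap_val).
by move=> [f' [hf' -> n0]]; rewrite PhiE.
Qed.
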